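(* In the $K$-stage two-way rate-distortion problem with a helper described in the context, where $Y-X-Z$ is a Markov chain, $\mathcal R_K^O(D_x,D_z)=\mathcal R_K(D_x,D_z)$.
   Context: Let $\mathcal X,\mathcal Y,\mathcal Z,\hat{\mathcal X},\hat{\mathcal Z}$ be finite alphabets, $(X_i,Y_i,Z_i)$ i.i.d. $\sim p(x,y)p(z|x)$ (Markov chain $Y-X-Z$), and $d_x:\mathcal X\times\hat{\mathcal X}\to[0,\infty)$, $d_z:\mathcal Z\times\hat{\mathcal Z}\to[0,\infty)$. Fix $K\ge1$. An $(n,M_y,(M_{x,k})_{k=1}^K,(M_{z,k})_{k=1}^K,D_x,D_z)$ code consists of a helper encoder $T_y=f_y(Y^n)\in\{1,\dots,M_y\}$; for $k=1,\dots,K$, User Z's encoder $T_{z,k}=f_{z,k}(Z^n,T_y,T_{x,1},\dots,T_{x,k-1})\in\{1,\dots,M_{z,k}\}$ and User X's encoder $T_{x,k}=f_{x,k}(X^n,T_y,T_{z,1},\dots,T_{z,k})\in\{1,\dots,M_{x,k}\}$; and decoders $\hat Z^n=g_x(X^n,T_y,T_{z,1},\dots,T_{z,K})$, $\hat X^n=g_z(Z^n,T_y,T_{x,1},\dots,T_{x,K})$ with $\mathbb E[\frac1n\sum_i d_x(X_i,\hat X_i)]\le D_x$ and $\mathbb E[\frac1n\sum_i d_z(Z_i,\hat Z_i)]\le D_z$. Its rates are $R_y=\frac1n\log M_y$, $R_x=\frac1n\sum_{k=1}^K\log M_{x,k}$, $R_z=\frac1n\sum_{k=1}^K\log M_{z,k}$.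 A triple $(R_x,R_y,R_z)$ is achievable if for every $\epsilon>0$ and all large $n$ there exist such codes with rates at most $(R_x+\epsilon,R_y+\epsilon,R_z+\epsilon)$ and distortions at most $(D_x+\epsilon,D_z+\epsilon)$; $\mathcal R_K^O(D_x,D_z)$ is the closure of the achievable set. $\mathcal R_K(D_x,D_z)$ is the set of triples $(R_x,R_y,R_z)$ with $R_y\ge I(U;Y|Z)$, $R_z\ge\sum_{k=1}^K I(Z;V_k|X,U,V^{k-1},W^{k-1})$, $R_x\ge\sum_{k=1}^K I(X;W_k|Z,U,V^k,W^{k-1})$ for some finite-alphabet random variables $U,V_1,\dots,V_K,W_1,\dots,W_K$ (with $V^k=(V_1,\dots,V_k)$, $W^k=(W_1,\dots,W_k)$) satisfying the Markov chains $U-Y-(X,Z)$, $V_k-(Z,U,V^{k-1},W^{k-1})-(X,Y)$ and $W_k-(X,U,V^k,W^{k-1})-(Z,Y)$ for $k=1,\dots,K$, and deterministic functions with $\mathbb E\, d_x(X,\hat X(U,W^K,Z))\le D_x$ and $\mathbb E\, d_z(Z,\hat Z(U,V^K,X))\le D_z$. *)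

(* Defs.v *)
From HB Require Import structures.
From mathcomp Require Import all_boot all_order all_algebra.
From mathcomp Require Import reals exp.
Set Implicit Arguments. Unset Strict Implicit. Unset Printing Implicit Defensive.
Import Order.TTheory GRing.Theory Num.Theory.
Local Open Scope ring_scope.

(* Information measures for random variables on a finite probability  *)
(* space (Om, P).  A random variable A : Om -> T is represented (for   *)
(* joint/conditioning purposes) by its equality relation                *)
(* [w ~ w' iff A w = A w'];  tuples of random variables are conjunctions*)
(* of such relations.  All logarithms are natural logarithms (rates use *)
(* the same ln, so the base convention is consistent).                 *)
Section Info.
Variables (R : realType) (Om : finType) (P : Om -> R).

Definition evr (T : eqType) (A : Om -> T) : rel Om := fun w w' => A w == A w'.
Definition andr (e1 e2 : rel Om) : rel Om := fun w w' => e1 w w' && e2 w w'.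

Definition PrE (E : pred Om) : R := \sum_(w | E w) P w.

(* entropy H(A) = E[-ln p_A(A)] of the random variable with relation e *)
Definition Ent (e : rel Om) : R := - \sum_w P w * ln (PrE (e w)).

Definition CMI (eA eB eC : rel Om) : R :=
  Ent (andr eA eC) + Ent (andr eB eC) - Ent (andr (andr eA eB) eC) - Ent eC.

(* Markov chain A - B - C :  p(a,b,c) p(b) = p(a,b) p(b,c) for all a,b,c *)
Definition markov (eA eB eC : rel Om) : Prop :=
  forall w1 w2, eB w1 w2 ->
    PrE (fun w => [&& eA w1 w, eB w1 w & eC w2 w]) * PrE (eB w1)
    = PrE (fun w => eA w1 w && eB w1 w) * PrE (fun w => eB w1 w && eC w2 w).

Definition histr (K : nat) (T : 'I_K -> finType) (V : forall k : 'I_K, Om -> T k)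
  (m : nat) : rel Om :=
  fun w w' => [forall j : 'I_K, (j < m)%N ==> (V j w == V j w')].

End Info.

Section Problem.
Variables (R : realType) (X Y Z Xh Zh : finType).
Variables (pxy : X -> Y -> R) (pzx : X -> Z -> R).
Variables (dx : X -> Xh -> R) (dz : Z -> Zh -> R).
Variable K : nat.

Definition is_source : Prop :=
  (forall x y, 0 <= pxy x y) /\ (\sum_x \sum_y pxy x y = 1) /\
  (forall x z, 0 <= pzx x z) /\ (forall x, \sum_z pzx x z = 1).

(* Messages are natural numbers; T_y = fy Y^n must be < My, the k-th   *)
(* messages (stage k = 0..K-1, i.e. stages 1..K of the paper) are      *)
(* < Mz k and < Mx k respectively.                                     *)
(*   fz k zn ty [T_x,1..T_x,k-1]         = T_z,k                       *)
(*   fx k xn ty [T_z,1..T_z,k]           = T_x,k                       *)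
Fixpoint msgs (n : nat)
  (fz : nat -> n.-tuple Z -> nat -> seq nat -> nat)
  (fx : nat -> n.-tuple X -> nat -> seq nat -> nat)
  (xn : n.-tuple X) (zn : n.-tuple Z) (ty : nat) (k : nat) : seq nat * seq nat :=
  match k with
  | 0 => ([::], [::])
  | k'.+1 =>
      let: (txs, tzs) := msgs fz fx xn zn ty k' in
      let tz := fz k' zn ty txs in
      let tx := fx k' xn ty (rcons tzs tz) in
      (rcons txs tx, rcons tzs tz)
  end.

Definition ptuple (n : nat) (xn : n.-tuple X) (yn : n.-tuple Y) (zn : n.-tuple Z) : R :=
  \prod_(i < n) (pxy (tnth xn i) (tnth yn i) * pzx (tnth xn i) (tnth zn i)).

Definition exp_dist_x (n : nat) fy fz fx (gz : n.-tuple Z -> nat -> seq nat -> n.-tuple Xh) : R :=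
  \sum_(xn : n.-tuple X) \sum_(yn : n.-tuple Y) \sum_(zn : n.-tuple Z)
    ptuple xn yn zn *
    (n%:R^-1 * \sum_(i < n)
       dx (tnth xn i) (tnth (gz zn (fy yn) (msgs fz fx xn zn (fy yn) K).1) i)).

Definition exp_dist_z (n : nat) fy fz fx (gx : n.-tuple X -> nat -> seq nat -> n.-tuple Zh) : R :=
  \sum_(xn : n.-tuple X) \sum_(yn : n.-tuple Y) \sum_(zn : n.-tuple Z)
    ptuple xn yn zn *
    (n%:R^-1 * \sum_(i < n)
       dz (tnth zn i) (tnth (gx xn (fy yn) (msgs fz fx xn zn (fy yn) K).2) i)).

Definition code_exists (n : nat) (rx ry rz Dx' Dz' : R) : Prop :=
  exists (My : nat) (Mx Mz : nat -> nat)
         (fy : n.-tuple Y -> nat)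
         (fz : nat -> n.-tuple Z -> nat -> seq nat -> nat)
         (fx : nat -> n.-tuple X -> nat -> seq nat -> nat)
         (gx : n.-tuple X -> nat -> seq nat -> n.-tuple Zh)
         (gz : n.-tuple Z -> nat -> seq nat -> n.-tuple Xh),
    [/\ (forall yn, (fy yn < My)%N),
        (forall k zn ty s, (k < K)%N -> (fz k zn ty s < Mz k)%N),
        (forall k xn ty s, (k < K)%N -> (fx k xn ty s < Mx k)%N),
        [/\ n%:R^-1 * ln (My%:R) <= ry,
            n%:R^-1 * \sum_(k < K) ln ((Mx k)%:R) <= rx &
            n%:R^-1 * \sum_(k < K) ln ((Mz k)%:R) <= rz] &
        exp_dist_x fy fz fx gz <= Dx' /\ exp_dist_z fy fz fx gx <= Dz'].

Definition achievable (Dx Dz Rx Ry Rz : R) : Prop :=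
  forall eps : R, 0 < eps -> exists N : nat, forall n : nat, (N <= n)%N ->
    code_exists n (Rx + eps) (Ry + eps) (Rz + eps) (Dx + eps) (Dz + eps).

Definition in_RO (Dx Dz Rx Ry Rz : R) : Prop :=
  forall delta : R, 0 < delta -> exists Rx' Ry' Rz' : R,
    [/\ achievable Dx Dz Rx' Ry' Rz', `|Rx' - Rx| < delta,
        `|Ry' - Ry| < delta & `|Rz' - Rz| < delta].

Definition in_RK (Dx Dz Rx Ry Rz : R) : Prop :=
  exists (Om : finType) (P : Om -> R)
         (Xr : Om -> X) (Yr : Om -> Y) (Zr : Om -> Z)
         (TU : finType) (U : Om -> TU)
         (TV TW : 'I_K -> finType)
         (V : forall k : 'I_K, Om -> TV k) (W : forall k : 'I_K, Om -> TW k)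
         (Xhr : Om -> Xh) (Zhr : Om -> Zh),
  [/\ ((forall w, 0 <= P w) /\ \sum_w P w = 1) /\
      (forall x y z, PrE P (fun w => [&& Xr w == x, Yr w == y & Zr w == z])
                     = pxy x y * pzx x z),
      markov P (evr U) (evr Yr) (andr (evr Xr) (evr Zr)),
      (forall k : 'I_K,
         markov P (evr (V k))
           (andr (andr (andr (evr Zr) (evr U)) (histr V k)) (histr W k))
           (andr (evr Xr) (evr Yr))) /\
      (forall k : 'I_K,
         markov P (evr (W k))
           (andr (andr (andr (evr Xr) (evr U)) (histr V k.+1)) (histr W k))
           (andr (evr Zr) (evr Yr))),
      ((* Xhat = Xhat(U, W^K, Z), Zhat = Zhat(U, V^K, X) *)
      (forall w w', U w = U w' -> (forall k, W k w = W k w') -> Zr w = Zr w' ->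
         Xhr w = Xhr w') /\
      (forall w w', U w = U w' -> (forall k, V k w = V k w') -> Xr w = Xr w' ->
         Zhr w = Zhr w')) /\
      (\sum_w P w * dx (Xr w) (Xhr w) <= Dx /\ \sum_w P w * dz (Zr w) (Zhr w) <= Dz) &
      [/\ CMI P (evr U) (evr Yr) (evr Zr) <= Ry,
          \sum_(k < K) CMI P (evr Zr) (evr (V k))
              (andr (andr (andr (evr Xr) (evr U)) (histr V k)) (histr W k)) <= Rz &
          \sum_(k < K) CMI P (evr Xr) (evr (W k))
              (andr (andr (andr (evr Zr) (evr U)) (histr V k.+1)) (histr W k)) <= Rx]].

End Problem.

(* Main.v *)
(* Both regions are compared with a third one, described by interactive protocols: in stage
   0 the helper, then users Z and X in turn, draw a letter from a kernel that depends on the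
   common history and on what the speaker observes.  The auxiliary variables of the
   single-letter region are the letters of such a protocol.

   Converse.  A block code with a uniformly chosen coordinate i becomes a protocol whose
   first letter is (i, T_y, X^{i-1}, Z_{i+1}^n) and whose later letters are the messages.
   Conditioning arguments bound the single-letter rates by the entropies of the messages,
   and the distortion is handled by exchanging the Z-parts of two copies of the block, which
   agree on the transcript.  Caratheodory's theorem bounds the alphabet of a protocol, stage
   by stage, without changing rates or distortions, so the protocol region is closed by
   compactness, and the codes for all eps yield one protocol.

   Achievability.  At every node of the tree of histories of the n-fold product protocol the
   letters are binned at random; the speaker deterministically picks a letter from the
   codebook (the bins with zero second index) and sends its first bin index, and each
   listener searches that bin for a letter of large conditional likelihood.  A second-moment
   bound for the total weight of the codebook, together with the law of large numbers for
   the log-likelihoods, makes the probability of a bad source block O(1/n).  The binnings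
   are derandomized from the leaves to the root.  Since Y - X - Z is a Markov chain,
   H(U|X) <= H(U|Z), so the helper's message also serves user X. *)
Require Import Defs.
From HB Require Import structures.
From mathcomp Require Import all_boot all_order all_algebra.
From mathcomp Require Import boolp classical_sets functions reals topology normedtype sequences derive exp.
From mathcomp Require Import ring lra zify.
Set Implicit Arguments. Unset Strict Implicit. Unset Printing Implicit Defensive.
Import Order.TTheory GRing.Theory Num.Theory.
Import numFieldNormedType.Exports.
Local Open Scope ring_scope.

(** * Interactive protocols *)

(** Protocols are the meeting point of the two regions because the variables read off a block code
    need not satisfy the chains of the single-letter region. Given T_y, the unseen block X_{i+1}^n
    may still depend on Y_i, so the chain of a message of user X is available only against (X_i,
    Z_i). Every quantity of the region beyond the first letter depends only on the joint law of
    (X,Z) and the history. Redrawing each letter from its conditional law given the history and the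
    speaker's observation keeps that law and restores the chains with Y. Histories are lists and
    kernels are functions of a list, so the subtree below a first letter is again a protocol,
    started from a non normalized measure. The alphabet reduction and the derandomization are
    inductions over such subtrees. They require functionals homogeneous in the measure: an entropy
    alone is not, but a difference of two is. The two users' rates telescope, which leaves only
    stages 0, 1 and 2K+1, hence five functionals, and this count enters the alphabet bound. *)

Section Lists.
Variables (R : realType) (A : finType).
Implicit Types F G : seq A -> R.

Fixpoint lsum (n : nat) F : R :=
  if n is n'.+1 then \sum_a lsum n' (fun h => F (a :: h)) else F [::].

Lemma eq_lsum n F G : (forall h, size h = n -> F h = G h) -> lsum n F = lsum n G.
Proof.
elim: n F G => [|n IH] F G FG /=; first exact: FG.
by apply: eq_bigr => a _; apply: IH => h sh; apply: FG; rewrite /= sh.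
Qed.

Lemma lsum_rcons n F : lsum n.+1 F = lsum n (fun h => \sum_a F (rcons h a)).
Proof.
elim: n F => [//|n IH] F; rewrite -[RHS]/(\sum_a lsum n _); apply: eq_bigr => a _.
exact: (IH (fun h => F (a :: h))).
Qed.

Lemma lsumD n F G : lsum n (fun h => F h + G h) = lsum n F + lsum n G.
Proof. by elim: n F G => [//|n IH] F G /=; rewrite -big_split; apply: eq_bigr => a _; apply: IH. Qed.

Lemma lsumZ n c F : lsum n (fun h => c * F h) = c * lsum n F.
Proof. by elim: n F => [//|n IH] F /=; rewrite mulr_sumr; apply: eq_bigr => a _; apply: IH. Qed.

Lemma lsumN n F : lsum n (fun h => - F h) = - lsum n F.
Proof. by rewrite -[RHS]mulN1r -lsumZ; apply: eq_lsum => h _; rewrite mulN1r. Qed.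

Lemma lsumB n F G : lsum n (fun h => F h - G h) = lsum n F - lsum n G.
Proof. by rewrite lsumD lsumN. Qed.

Lemma lsum0 n : lsum n (fun=> 0) = 0.
Proof. by elim: n => [//|n IH] /=; rewrite big1. Qed.

Lemma lsum_sum n (I : finType) (F : I -> seq A -> R) :
  lsum n (fun h => \sum_i F i h) = \sum_i lsum n (F i).
Proof.
elim: n F => [//|n IH] F /=; rewrite exchange_big; apply: eq_bigr => a _.
exact: IH.
Qed.

Lemma ler_lsum n F G : (forall h, size h = n -> F h <= G h) -> lsum n F <= lsum n G.
Proof.
elim: n F G => [|n IH] F G FG /=; first exact: FG.
by apply: ler_sum => a _; apply: IH => h sh; apply: FG; rewrite /= sh.
Qed.

Lemma lsum_ge0 n F : (forall h, size h = n -> 0 <= F h) -> 0 <= lsum n F.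
Proof. by move=> F0; rewrite -(lsum0 n); apply: ler_lsum. Qed.

Lemma lsum_pick n (g : seq A) F : size g = n ->
  lsum n (fun h => if g == h then F h else 0) = F g.
Proof.
elim: n g F => [|n IH] [|b g] F //= [sg].
rewrite (bigD1 b) //= big1 ?addr0 => [|a /negbTE nab].
  rewrite -(IH g (fun h => F (b :: h)) sg); apply: eq_lsum => h _.
  by rewrite eqseq_cons eqxx.
by rewrite -[RHS](lsum0 n); apply: eq_lsum => h _; rewrite eqseq_cons eq_sym nab.
Qed.

Lemma lsum_tuple n F : lsum n F = \sum_(h : n.-tuple A) F h.
Proof.
have -> : lsum n F = lsum n (fun h => \sum_(g : n.-tuple A) if tval g == h then F h else 0).
  apply: eq_lsum => h sh; rewrite (bigD1 (Tuple (introT eqP sh))) //= eqxx big1 ?addr0 // => g.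
  by rewrite -val_eqE /= => /negbTE ->.
by rewrite lsum_sum; apply: eq_bigr => g _; rewrite lsum_pick ?size_tuple.
Qed.

End Lists.

Section Protocols.
Variables (R : realType) (T S : finType) (key : nat -> T -> S).

Definition valid (A : finType) (Q : seq A -> S -> A -> R) : Prop :=
  (forall h s a, 0 <= Q h s a) /\ (forall h s, \sum_a Q h s a = 1).

(** The joint weight of a source letter and a history, for a protocol entered at stage [j] with
    measure [m]. The first letter is absorbed into the measure, so that the remaining history lives
    in the subtree below it. *)
Fixpoint mu (A : finType) (j : nat) (Q : seq A -> S -> A -> R) (m : T -> R)
    (h : seq A) : T -> R :=
  if h is a :: h' then mu j.+1 (fun g => Q (a :: g)) (fun t => m t * Q [::] (key j t) a) h'
  else m.

Section Mu.
Variable A : finType.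
Implicit Types (Q : seq A -> S -> A -> R) (m : T -> R) (h : seq A).

Lemma valid_shift Q a : valid Q -> valid (fun g => Q (a :: g)).
Proof. by case=> Q0 Q1; split=> h s. Qed.

Lemma mu_rcons j Q m h a t :
  mu j Q m (rcons h a) t = mu j Q m h t * Q h (key (j + size h) t) a.
Proof.
elim: h j Q m => [|b h IH] j Q m /=; first by rewrite addn0.
by rewrite IH addSnnS.
Qed.

Lemma mu_ge0 j Q m h t : valid Q -> (forall t, 0 <= m t) -> 0 <= mu j Q m h t.
Proof.
elim: h j Q m => [|b h IH] j Q m vQ m0 //=.
by apply: IH => [|u]; [exact: valid_shift | rewrite mulr_ge0 // vQ.1].
Qed.

Lemma sum_mu_rcons j Q m h t : valid Q ->
  \sum_a mu j Q m (rcons h a) t = mu j Q m h t.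
Proof.
move=> vQ; under eq_bigr do rewrite mu_rcons.
by rewrite -mulr_sumr vQ.2 mulr1.
Qed.

(** Letters after position [i] sum out one at a time, since kernels are normalized at every
    history. *)
Lemma lsum_mu_take j Q m i d (G : T -> seq A -> R) : valid Q ->
  lsum (i + d) (fun h => \sum_t mu j Q m h t * G t (take i h))
  = lsum i (fun h => \sum_t mu j Q m h t * G t h).
Proof.
move=> vQ; elim: d => [|d IH].
  by rewrite addn0; apply: eq_lsum => h sh; rewrite -sh take_size.
rewrite addnS lsum_rcons -IH; apply: eq_lsum => h sh.
rewrite exchange_big; apply: eq_bigr => t _.
rewrite -(sum_mu_rcons j m h t vQ) mulr_suml; apply: eq_bigr => a _.
by rewrite -cats1 takel_cat // sh leq_addr.
Qed.

End Mu.

End Protocols.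

(** * Entropies of finite measures, normalized or not *)

Section Marginals.
Variables (R : realType) (T : finType).
Implicit Types m : T -> R.

(** As [ln] is 0 on nonpositive numbers, this is the usual extension by 0 at 0, and it vanishes on
    the negative half-line. *)
Definition xlnx (x : R) : R := x * ln x.

Lemma ln_prod (I : Type) (r : seq I) (E : pred I) (F : I -> R) :
  (forall i, E i -> 0 < F i) -> ln (\prod_(i <- r | E i) F i) = \sum_(i <- r | E i) ln (F i).
Proof.
move=> F0.
suff [] : 0 < \prod_(i <- r | E i) F i /\
    ln (\prod_(i <- r | E i) F i) = \sum_(i <- r | E i) ln (F i) by [].
apply: (big_rec2 (fun x y => 0 < x /\ ln x = y)); first by rewrite ltr01 ln1.
by move=> i y x Ei [x0 <-]; rewrite mulr_gt0 ?F0 // lnM ?posrE ?F0.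
Qed.

Definition marg (B : finType) (f : T -> B) m (b : B) : R := \sum_(t | f t == b) m t.

Definition hent (B : finType) (f : T -> B) m : R := - \sum_b xlnx (marg f m b).

Lemma xlnxM (a b : R) : 0 <= a -> 0 <= b -> xlnx (a * b) = a * xlnx b + b * xlnx a.
Proof.
rewrite !le0r => /orP[/eqP->|a0] /orP[/eqP->|b0]; rewrite /xlnx ?(mul0r,mulr0,addr0,add0r) //.
by rewrite lnM // mulrDr; ring.
Qed.

Lemma marg_ge0 (B : finType) (f : T -> B) m b : (forall t, 0 <= m t) -> 0 <= marg f m b.
Proof. by move=> m0; apply: sumr_ge0. Qed.

Lemma eq_marg (B : finType) (f : T -> B) m m' : m =1 m' -> marg f m =1 marg f m'.
Proof. by move=> mm b; apply: eq_bigr. Qed.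

Lemma eq_hent (B : finType) (f : T -> B) m m' : m =1 m' -> hent f m = hent f m'.
Proof. by move=> mm; congr (- _); apply: eq_bigr => b _; rewrite (eq_marg f mm). Qed.

Lemma sum_marg (B : finType) (f : T -> B) m : \sum_b marg f m b = \sum_t m t.
Proof. by rewrite [RHS](partition_big f xpredT). Qed.

Lemma sum_marg_mul (B : finType) (f : T -> B) m (G : B -> R) :
  \sum_b marg f m b * G b = \sum_t m t * G (f t).
Proof.
rewrite [RHS](partition_big f xpredT) //=; apply: eq_bigr => b _.
by rewrite mulr_suml; apply: eq_bigr => t /eqP->.
Qed.

Lemma margZ (B : finType) (f : T -> B) m c b : marg f (fun t => c * m t) b = c * marg f m b.
Proof. by rewrite /marg mulr_sumr. Qed.

Lemma hentE (B : finType) (f : T -> B) m : hent f m = - \sum_t m t * ln (marg f m (f t)).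
Proof. by rewrite -(sum_marg_mul f m (fun b => ln (marg f m b))). Qed.

(** The defect does not involve [f]. It cancels in the difference of two entropies of the same
    measure, the form in which rates are handled. *)
Lemma hentZ (B : finType) (f : T -> B) m c : 0 <= c -> (forall t, 0 <= m t) ->
  hent f (fun t => c * m t) = c * hent f m - xlnx c * \sum_t m t.
Proof.
move=> c0 m0; rewrite /hent -(sum_marg f m) mulrN -opprD; congr (- _).
rewrite !mulr_sumr -big_split; apply: eq_bigr => b _ /=.
by rewrite margZ xlnxM // ?marg_ge0 // [xlnx c * _]mulrC.
Qed.

Lemma marg_comp (B C : finType) (f : T -> B) (g : B -> C) m c :
  marg (g \o f) m c = \sum_(b | g b == c) marg f m b.
Proof.
rewrite /marg (partition_big f (fun b => g b == c)) //=; apply: eq_bigr => b /eqP gb.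
by apply: eq_bigl => t /=; case: (f t =P b) => [->|]; rewrite ?gb ?eqxx ?andbF.
Qed.

Lemma marg_scale (B : finType) (f : T -> B) (c : B -> R) m b :
  marg f (fun t => c (f t) * m t) b = c b * marg f m b.
Proof. by rewrite /marg mulr_sumr; apply: eq_bigr => t /eqP->. Qed.

End Marginals.

Section EntropyGrowth.
Variables (R : realType) (T S A : finType) (key : nat -> T -> S).
Variables (Q : seq A -> S -> A -> R) (m : T -> R).
Hypotheses (vQ : valid Q) (m0 : forall t, 0 <= m t).

(** For a probability [m], the joint entropy of [f] and the first [j] letters: the measures below
    the histories are not normalized, so no separate term for the history appears. *)
Definition lent (B : finType) (f : T -> B) (j : nat) : R :=
  lsum j (fun h => hent f (mu key 0 Q m h)).

(** The conditional entropy of letter [j] given the history and the observation of its speaker. *)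
Definition lentQ (j : nat) : R :=
  - lsum j (fun h => \sum_t \sum_a mu key 0 Q m (rcons h a) t * ln (Q h (key j t) a)).

(** Chain rule. Once [f] determines what the speaker observes, the kernel is constant on the fibres
    of [f], and the new letter adds the same entropy for every such [f]. *)
Lemma lent_refine (B : finType) (f : T -> B) (g : B -> S) j :
  (forall t, key j t = g (f t)) -> lent f j.+1 = lent f j + lentQ j.
Proof.
move=> kg; rewrite /lent /lentQ lsum_rcons -lsumB; apply: eq_lsum => h sh.
have M a : mu key 0 Q m (rcons h a) =1 (fun t => Q h (g (f t)) a * mu key 0 Q m h t).
  by move=> t; rewrite mu_rcons add0n sh kg mulrC.
have h0 t : 0 <= mu key 0 Q m h t by apply: mu_ge0.
have E : \sum_t \sum_a mu key 0 Q m (rcons h a) t * ln (Q h (key j t) a)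
   = \sum_b \sum_a marg f (mu key 0 Q m h) b * xlnx (Q h (g b) a).
  under [RHS]eq_bigr do rewrite -mulr_sumr.
  rewrite (sum_marg_mul f _ (fun b => \sum_a xlnx (Q h (g b) a))).
  apply: eq_bigr => t _; rewrite mulr_sumr; apply: eq_bigr => a _.
  by rewrite M kg /xlnx; ring.
rewrite E.
under eq_bigr => a _ do rewrite (eq_hent f (M a)) /hent.
rewrite sumrN exchange_big -opprD -big_split /=; congr (- _).
apply: eq_bigr => b _; rewrite -[xlnx (marg _ _ _)]mul1r -(vQ.2 h (g b)) mulr_suml -big_split /=.
by apply: eq_bigr => a _; rewrite (marg_scale f (fun b => Q h (g b) a)) xlnxM ?vQ.1 ?marg_ge0.
Qed.

End EntropyGrowth.

Section Tuples.
Variables (R : realType) (T : finType).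

Lemma sum_tuple_prod n (F : 'I_n -> T -> R) :
  \sum_(w : n.-tuple T) \prod_i F i (tnth w i) = \prod_i \sum_x F i x.
Proof.
rewrite bigA_distr_bigA /= (reindex (fun f : {ffun 'I_n -> T} => [tuple f i | i < n])) /=.
  by apply: eq_bigr => f _; apply: eq_bigr => i _; rewrite tnth_mktuple.
exists (fun w : n.-tuple T => [ffun i => tnth w i]) => [f _|w _].
  by apply/ffunP=> i; rewrite ffunE tnth_mktuple.
by apply: eq_from_tnth => i; rewrite tnth_mktuple ffunE.
Qed.

Variables (n : nat) (p : T -> R).
Hypothesis p1 : \sum_x p x = 1.

Definition prodm (w : n.-tuple T) : R := \prod_i p (tnth w i).

Lemma sum_prodm_coord (i : 'I_n) (g : T -> R) :
  \sum_w prodm w * g (tnth w i) = \sum_x p x * g x.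
Proof.
have E w : prodm w * g (tnth w i) = \prod_j (p (tnth w j) * (if j == i then g (tnth w j) else 1)).
  rewrite big_split /=; congr (_ * _); rewrite (bigD1 i) //= eqxx big1 ?mulr1 // => j.
  by move/negbTE->.
under eq_bigr do rewrite E.
rewrite (sum_tuple_prod (fun j x => p x * (if j == i then g x else 1))) (bigD1 i) //= eqxx.
rewrite [X in _ * X]big1 ?mulr1 // => j /negbTE ->.
by under eq_bigr do rewrite mulr1.
Qed.

Lemma sum_prodm : \sum_w prodm w = 1.
Proof. by rewrite (sum_tuple_prod (fun _ => p)) big1. Qed.

Lemma prodm_ge0 w : (forall x, 0 <= p x) -> 0 <= prodm w.
Proof. by move=> p0; apply: prodr_ge0. Qed.

End Tuples.

(** * The source and the region of protocols *)

Section Source.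
Variables (R : realType) (X Y Z Xh Zh : finType).
Variables (pxy : X -> Y -> R) (pzx : X -> Z -> R).
Variables (dx : X -> Xh -> R) (dz : Z -> Zh -> R).

Definition src := (X * Y * Z)%type.
Definition sx (t : src) : X := t.1.1.
Definition sy (t : src) : Y := t.1.2.
Definition sz (t : src) : Z := t.2.
Definition sxz (t : src) : X * Z := (sx t, sz t).
Definition syz (t : src) : Y * Z := (sy t, sz t).

Definition psrc (t : src) : R := pxy (sx t) (sy t) * pzx (sx t) (sz t).

Definition skey := (Y + Z + X)%type.

(* Side information of user X ([u = true]) and of user Z ([u = false]). *)
Definition ukey (u : bool) (t : src) : skey := if u then inr (sx t) else inl (inr (sz t)).

(* The terminal that speaks in stage [j]: the helper first, then users Z and X in turn. *)
Definition key (j : nat) (t : src) : skey :=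
  if j is j'.+1 then ukey (odd j') t else inl (inl (sy t)).

(* [minf x0 F] is the minimum of [F]; [x0] only witnesses that the index type is inhabited. *)
Definition minf (I : finType) (x0 : I) (F : I -> R) : R := \big[Num.min/F x0]_i F i.

(** The expected cost under [m] of the best decoder that observes [f]: the optimal reconstruction is
    chosen separately for each observed value. *)
Definition psi (B I : finType) (i0 : I) (f : src -> B) (c : src -> I -> R) (m : src -> R) : R :=
  \sum_b minf i0 (fun i => \sum_(t | f t == b) m t * c t i).

Definition psi_x (x0 : Xh) : (src -> R) -> R := psi x0 sz (fun t => dx (sx t)).
Definition psi_z (z0 : Zh) : (src -> R) -> R := psi z0 sx (fun t => dz (sz t)).

(** With U the first letter and H the whole history, the rates are I(U;Y|Z), I(Z;H|X,U) and
    I(X;H|Z,U); the last two are the telescoped sums over the K rounds. *)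
Definition region (K : nat) (x0 : Xh) (z0 : Zh) (A : finType) (Q : seq A -> skey -> A -> R)
    (Dx Dz Rx Ry Rz : R) : Prop :=
  let N := K.*2.+1 in
  let L (B : finType) (f : src -> B) j := lent key Q psrc f j in
  [/\ L _ syz 0 - L _ sz 0 - (L _ syz 1 - L _ sz 1) <= Ry,
      L _ sxz 1 - L _ sx 1 - (L _ sxz N - L _ sx N) <= Rz,
      L _ sxz 1 - L _ sz 1 - (L _ sxz N - L _ sz N) <= Rx,
      lsum N (fun h => psi_x x0 (mu key 0 Q psrc h)) <= Dx &
      lsum N (fun h => psi_z z0 (mu key 0 Q psrc h)) <= Dz].

(* The single-letter region with the auxiliary variables described by an interactive
   protocol: after the common history [h], the speaker of stage [size h] draws the next
   letter from [Q h s], where [s] is what it observes. *)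
Definition NF (K : nat) (Dx Dz Rx Ry Rz : R) : Prop :=
  exists (x0 : Xh) (z0 : Zh) (A : finType) (Q : seq A -> skey -> A -> R),
    valid Q /\ region K x0 z0 Q Dx Dz Rx Ry Rz.

End Source.

(** * Entropy of random variables given as equivalence relations *)

Section Equivalences.
Variable (Om : finType).
Implicit Type e : rel Om.

Lemma eqrel_refl e : equivalence_rel e -> forall w, e w w.
Proof. by move=> ee w; have [] := ee w w w. Qed.

Lemma eqrel_left e w w' v : equivalence_rel e -> e w w' -> e w v = e w' v.
Proof. by move=> ee; have [_] := ee w w' v. Qed.

Lemma eqrel_sym e : equivalence_rel e -> symmetric e.
Proof.
move=> ee x y; apply/idP/idP => h; first by rewrite -(eqrel_left x ee h) eqrel_refl.
by rewrite -(eqrel_left y ee h) eqrel_refl.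
Qed.

End Equivalences.

Section Representatives.
Variables (Om : finType) (e : rel Om).
Hypothesis ee : equivalence_rel e.

(** Representatives turn a relation into a map with values in [Om], so variables of different types
    become letters of one alphabet. *)
Definition rep (w : Om) : Om := odflt w [pick v | e w v].

Lemma rep_eq w w' : (rep w == rep w') = e w w'.
Proof.
have er v : e v (rep v).
  by rewrite /rep; case: pickP => [u //|/(_ v)]; rewrite (eqrel_refl ee).
apply/eqP/idP => [E|eww'].
  by rewrite (eqrel_left w' ee (er w)) E -(eqrel_left w' ee (er w')) eqrel_refl.
rewrite /rep (eq_pick (fun v => eqrel_left v ee eww')).
by case: pickP => [//|/(_ w')]; rewrite (eqrel_refl ee).
Qed.

End Representatives.

Section RelationEntropy.
Variables (R : realType) (Om : finType) (P : Om -> R).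
Implicit Types e f g : rel Om.

Lemma ln_le_sub1 (x : R) : 0 < x -> ln x <= x - 1.
Proof. by move=> x0; have := @le_ln1Dx R (x - 1); rewrite addrCA subrr addr0; apply; lra. Qed.

Lemma eq_PrE (E E' : pred Om) : E =1 E' -> PrE P E = PrE P E'.
Proof. by move=> EE; apply: eq_bigl. Qed.

Lemma eq_Ent e e' : e =2 e' -> Ent P e = Ent P e'.
Proof.
by move=> ee; congr (- _); apply: eq_bigr => w _; rewrite (eq_PrE (ee w)).
Qed.

Lemma eq_markov e f g e' f' g' : e =2 e' -> f =2 f' -> g =2 g' ->
  markov P e f g -> markov P e' f' g'.
Proof.
move=> ee ff gg; suff [-> -> ->] : [/\ e = e', f = f' & g = g'] by [].
by split; apply/funext => w; apply/funext.
Qed.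

Lemma andr_equiv e f : equivalence_rel e -> equivalence_rel f -> equivalence_rel (andr e f).
Proof.
move=> ee ef x y z; split; first by rewrite /andr (eqrel_refl ee) (eqrel_refl ef).
by case/andP=> exy fxy; rewrite /andr (eqrel_left z ee exy) (eqrel_left z ef fxy).
Qed.

Lemma evr_equiv (T : eqType) (F : Om -> T) : equivalence_rel (evr F).
Proof. by move=> x y z; rewrite /evr; split=> [|/eqP ->]. Qed.

Hypothesis P0 : forall w, 0 <= P w.

Lemma PrE_ge0 (E : pred Om) : 0 <= PrE P E.
Proof. exact: sumr_ge0. Qed.

Lemma PrE_le (E E' : pred Om) : {subset E <= E'} -> PrE P E <= PrE P E'.
Proof.
move=> EE; rewrite /PrE big_mkcond [leRHS]big_mkcond; apply: ler_sum => w _.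
by have := EE w; rewrite !unfold_in; case: (E w) => [->//|_]; case: (E' w).
Qed.

Lemma PrE_gt0 (E : pred Om) w : E w -> 0 < P w -> 0 < PrE P E.
Proof. by move=> Ew Pw; rewrite /PrE (bigD1 w) //= ltr_wpDr // sumr_ge0. Qed.

Lemma Ent_le e f : (forall w, e w w) -> (forall w w', e w w' -> f w w') -> Ent P f <= Ent P e.
Proof.
move=> er ef; rewrite lerN2; apply: ler_sum => w _.
have := P0 w; rewrite le0r => /orP[/eqP->|Pw]; first by rewrite !mul0r.
apply: ler_wpM2l => //; rewrite ler_ln ?posrE.
- by apply: PrE_le => v; apply: ef.
- exact: PrE_gt0 (er w) Pw.
- exact: PrE_gt0 (ef _ _ (er w)) Pw.
Qed.

(** By ln x <= x - 1, it suffices that the expectation of p(a,c) p(b,c) / (p(a,b,c) p(c)) is at most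
    1. The two numerators are expanded as sums over points [u] and [v], and the sum over [w] is
    taken first. *)
Lemma CMI_ge0 e f g : equivalence_rel e -> equivalence_rel f -> equivalence_rel g ->
  0 <= CMI P e f g.
Proof.
move=> ee ef eg; have eeg := andr_equiv ee eg; have efg := andr_equiv ef eg.
have eefg := andr_equiv (andr_equiv ee ef) eg.
pose a w := PrE P (andr e g w); pose b w := PrE P (andr f g w).
pose c w := PrE P (g w); pose d w := PrE P (andr (andr e f) g w).
have -> : CMI P e f g = - \sum_w P w * (ln (a w) + ln (b w) - ln (d w) - ln (c w)).
  rewrite /CMI /Ent -/a -/b -/c -/d -!sumrN -!big_split /=.
  by apply: eq_bigr => w _; rewrite /a /b /c /d; ring.
have gE w v : g w v -> c w = c v.
  by move=> gwv; apply: eq_PrE => u; exact: eqrel_left.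
have dE w v : andr (andr e f) g w v -> d w = d v.
  by move=> h; apply: eq_PrE => u; exact: eqrel_left.
have step w : P w * (ln (a w) + ln (b w) - ln (d w) - ln (c w))
     <= P w * (a w * b w * (d w)^-1 * (c w)^-1) - P w.
  have := P0 w; rewrite le0r => /orP[/eqP->|Pw]; first by rewrite !mul0r subr0.
  have a0 : 0 < a w by apply: PrE_gt0 Pw; exact: eqrel_refl.
  have b0 : 0 < b w by apply: PrE_gt0 Pw; exact: eqrel_refl.
  have c0 : 0 < c w by apply: PrE_gt0 Pw; exact: eqrel_refl.
  have d0 : 0 < d w by apply: PrE_gt0 Pw; exact: eqrel_refl.
  rewrite -{3}[P w]mulr1 -mulrBr ler_pM2l //.
  rewrite -lnM ?posrE // -ln_div ?posrE ?mulr_gt0 // -ln_div ?posrE ?divr_gt0 ?mulr_gt0 //.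
  by apply: ln_le_sub1; rewrite !mulr_gt0 ?invr_gt0.
rewrite oppr_ge0; apply: le_trans (ler_sum _ (fun w _ => step w)) _.
rewrite big_split /= sumrN subr_le0.
have -> : \sum_w P w * (a w * b w / d w / c w)
   = \sum_u \sum_v P u * P v * \sum_(w | andr e g w u && andr f g w v) P w / d w / c w.
  transitivity (\sum_w \sum_u \sum_v (if andr e g w u && andr f g w v
       then P u * P v * (P w / d w / c w) else 0)).
    apply: eq_bigr => w _.
    have -> : P w * (a w * b w / d w / c w) = a w * b w * (P w / d w / c w) by ring.
    rewrite /a /b /PrE big_mkcond mulr_suml mulr_suml; apply: eq_bigr => u _.
    rewrite big_mkcond mulr_sumr mulr_suml; apply: eq_bigr => v _.
    by case: (andr e g w u); case: (andr f g w v); rewrite ?(mul0r,mulr0).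
  rewrite exchange_big; apply: eq_bigr => u _; rewrite exchange_big; apply: eq_bigr => v _.
  by rewrite mulr_sumr [RHS]big_mkcond.
apply: ler_sum => u _.
(* For fixed [u] and [v] the admissible [w] form one joint class or none. This is an inequality
   because the class may be empty or of probability 0. *)
have inner v : \sum_(w | andr e g w u && andr f g w v) P w / d w / c w
     <= if g u v then (c u)^-1 else 0.
  case: (pickP (fun w => andr e g w u && andr f g w v)) => [w0 /andP[h1 h2]|no]; last first.
    by rewrite big_pred0 //; case: ifP => // _; rewrite invr_ge0 PrE_ge0.
  move: (h1) (h2) => /andP[e1 g1] /andP[f2 g2].
  have guv : g u v by rewrite -(eqrel_left v eg g1).
  rewrite guv (eq_bigl (andr (andr e f) g w0)) => [|w]; last first.
    rewrite (eqrel_sym eeg) (eqrel_sym efg) /andr.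
    rewrite -(eqrel_left w ee e1) -(eqrel_left w ef f2) -(eqrel_left w eg g1) -(eqrel_left w eg g2).
    by case: (e w0 w) (f w0 w) (g w0 w) => [] [] [].
  rewrite (eq_bigr (fun w => P w / d w0 / c u)) => [|w hw]; last first.
    by rewrite (dE _ _ hw) -(gE w u) // -(eqrel_left u eg (andP hw).2).
  rewrite -!mulr_suml -[leRHS]mul1r; apply: ler_wpM2r; first by rewrite invr_ge0 PrE_ge0.
  rewrite -/(d w0); case: (eqVneq (d w0) 0) => [->|dn0]; last by rewrite divff.
  by rewrite invr0 mulr0.
apply: le_trans (_ : \sum_v P u * P v * (if g u v then (c u)^-1 else 0) <= _).
  by apply: ler_sum => v _; apply: ler_wpM2l; rewrite ?mulr_ge0.
rewrite (eq_bigr (fun v => P u * ((if g u v then P v else 0) * (c u)^-1))); last first.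
  by move=> v _; case: (g u v); rewrite ?(mulr0,mul0r) ?mulrA.
rewrite -mulr_sumr -mulr_suml -big_mkcond /= -/(PrE P (g u)) -/(c u).
rewrite -[leRHS]mulr1; apply: ler_wpM2l => //.
by case: (eqVneq (c u) 0) => [->|dn0]; rewrite ?mul0r ?divff.
Qed.

Lemma Ent_submod e f g : equivalence_rel e -> equivalence_rel f -> equivalence_rel g ->
  Ent P (andr (andr e f) g) + Ent P g <= Ent P (andr e g) + Ent P (andr f g).
Proof. by move=> ee ef eg; have := CMI_ge0 ee ef eg; rewrite /CMI; lra. Qed.

Lemma markov_joint e f g : equivalence_rel f -> markov P e f g -> markov P e f (andr f g).
Proof.
move=> ef mk w1 w2 f12.
have E w : f w1 w && andr f g w2 w = f w1 w && g w2 w.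
  by rewrite /andr (eqrel_left w ef f12); case: (f w2 w).
rewrite (@eq_PrE _ (fun w => [&& e w1 w, f w1 w & g w2 w])) => [|w]; last by rewrite E.
by rewrite mk //; congr (_ * _); apply: eq_PrE => w; rewrite E.
Qed.

(** The product identity is additive in its third event, so it is summed over the [g]-classes inside
    a [g']-class. A class that misses the [f]-class contributes 0 to both sides. *)
Lemma markov_coarsen e f g g' : equivalence_rel g -> equivalence_rel g' ->
  (forall w w', g w w' -> g' w w') -> markov P e f g -> markov P e f g'.
Proof.
move=> eg eg' gg mk w1 w2 f12.
have split_rep (E : pred Om) : PrE P (fun w => E w && g' w2 w)
   = \sum_c PrE P (fun w => E w && g' w2 w && (rep g w == c)).
  by rewrite /PrE (partition_big (rep g) xpredT).
rewrite (@eq_PrE _ (fun w => (e w1 w && f w1 w) && g' w2 w)) => [|w]; last by rewrite andbA.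
rewrite !split_rep mulr_suml mulr_sumr; apply: eq_bigr => c _.
case: (pickP (fun w => f w1 w && g' w2 w && (rep g w == c))) => [w3 /andP[/andP[f13 g23] /eqP c3]|no].
  have C w : g' w2 w && (rep g w == c) = g w3 w.
    rewrite -c3 [rep g w == _]eq_sym (rep_eq eg); case: (boolP (g w3 w)) => [h|]; last by rewrite andbF.
    by rewrite (eqrel_left w eg' g23) gg.
  rewrite (@eq_PrE _ (fun w => [&& e w1 w, f w1 w & g w3 w])) => [|w]; last by rewrite -andbA C andbA.
  by rewrite mk //; congr (_ * _); apply: eq_PrE => w; rewrite -andbA C.
rewrite [X in _ = _ * X]big_pred0 // mulr0 [X in X * _]big_pred0 ?mul0r // => w.
by have := no w; rewrite -!andbA; case: (e w1 w).
Qed.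

Hypothesis P1 : \sum_w P w = 1.

Lemma Ent_le_card (B : finType) (F : Om -> B) : Ent P (evr F) <= ln #|B|%:R.
Proof.
have [w0 _] : exists w, P w != 0.
  apply/existsP; rewrite -negb_forall; apply/negP => /forallP h.
  by move: P1; rewrite big1 => [/eqP|w _]; [rewrite eq_sym oner_eq0|exact/eqP].
have B0 : 0 < (#|B|%:R : R) by rewrite ltr0n; apply/card_gt0P; exists (F w0).
pose p w := PrE P (evr F w).
have step w : P w * - (ln (p w) + ln #|B|%:R) <= P w * ((p w)^-1 / #|B|%:R) - P w.
  have := P0 w; rewrite le0r => /orP[/eqP->|Pw]; first by rewrite !mul0r subr0.
  have p0 : 0 < p w by apply: PrE_gt0 Pw; rewrite /evr.
  rewrite -{3}[P w]mulr1 -mulrBr ler_pM2l // -lnM ?posrE // -lnV ?posrE ?mulr_gt0 //.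
  by rewrite -invfM; apply: ln_le_sub1; rewrite invr_gt0 mulr_gt0.
rewrite -subr_le0.
have -> : Ent P (evr F) - ln #|B|%:R = \sum_w P w * - (ln (p w) + ln #|B|%:R).
  under [RHS]eq_bigr do rewrite mulrN mulrDr.
  by rewrite sumrN big_split /= opprD -mulr_suml P1 mul1r.
apply: le_trans (ler_sum _ (fun w _ => step w)) _.
rewrite big_split /= sumrN P1 subr_le0.
under eq_bigr do rewrite mulrA.
rewrite -mulr_suml ler_pdivrMr // mul1r.
rewrite (partition_big F xpredT) //= -sum1_card natr_sum; apply: ler_sum => b _.
rewrite (eq_bigr (fun w => P w / PrE P (fun w => F w == b))); last first.
  by move=> w /eqP Fw; congr (_ / _); apply: eq_PrE => v; rewrite /evr -Fw eq_sym.
rewrite -mulr_suml -/(PrE P (fun w => F w == b)).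
by case: (eqVneq (PrE P (fun w => F w == b)) 0) => [->|h]; rewrite ?mul0r ?divff.
Qed.

End RelationEntropy.

Section ProductEntropy.
Variables (R : realType) (T : finType) (p : T -> R) (n : nat).
Hypotheses (p0 : forall x, 0 <= p x) (p1 : \sum_x p x = 1).

Definition crel (s : 'I_n -> rel T) : rel (n.-tuple T) :=
  fun w w' => [forall i, s i (tnth w i) (tnth w' i)].

Lemma crel_equiv s : (forall i, equivalence_rel (s i)) -> equivalence_rel (crel s).
Proof.
move=> es x y z; split; first by apply/forallP => i; apply: eqrel_refl.
by move=> /forallP h; apply: eq_forallb => i; apply: eqrel_left.
Qed.

Lemma andr_crel s s' : andr (crel s) (crel s') =2 crel (fun i => andr (s i) (s' i)).
Proof.
move=> w w'; apply/andP/forallP => [[/forallP h /forallP h'] i|h].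
  by rewrite /andr h h'.
by split; apply/forallP => i; case/andP: (h i).
Qed.

Lemma PrE_crel s w :
  PrE (prodm (n:=n) p) (crel s w) = \prod_i PrE p (s i (tnth w i)).
Proof.
rewrite /PrE (eq_bigr (fun i => \sum_x if s i (tnth w i) x then p x else 0)); last first.
  by move=> i _; rewrite big_mkcond.
rewrite -(sum_tuple_prod (fun i x => if s i (tnth w i) x then p x else 0)) big_mkcond.
apply: eq_bigr => v _; case: ifP => [/forallP h|/negbT].
  by apply: eq_bigr => i _; rewrite h.
rewrite negb_forall => /existsP[i /negbTE ni].
by rewrite (bigD1 i) //= ni mul0r.
Qed.

Lemma Ent_crel (s : 'I_n -> rel T) : (forall i x, s i x x) ->
  Ent (prodm (n:=n) p) (crel s) = \sum_i Ent p (s i).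
Proof.
move=> sr; rewrite /Ent sumrN; congr (- _).
under [RHS]eq_bigr => i _ do rewrite -(sum_prodm_coord p1 i).
rewrite exchange_big; apply: eq_bigr => w _ /=.
rewrite -mulr_sumr PrE_crel.
have := prodm_ge0 w p0; rewrite le0r => /orP[/eqP->|wn0]; first by rewrite !mul0r.
congr (_ * _); apply: ln_prod => i _; apply: (PrE_gt0 p0 (sr i _)).
rewrite lt0r p0 andbT; apply: contraTneq wn0 => pi0.
by rewrite /prodm (bigD1 i) //= pi0 mul0r ltxx.
Qed.

End ProductEntropy.

Section Minf.
Variables (R : realType) (I : finType) (x0 : I).
Implicit Types F G : I -> R.

Lemma minf_le F i : minf x0 F <= F i.
Proof. exact: bigmin_le_cond. Qed.

Lemma minf_ge F c : (forall i, c <= F i) -> c <= minf x0 F.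
Proof. by move=> cF; apply: le_bigmin. Qed.

Lemma eq_minf F G : F =1 G -> minf x0 F = minf x0 G.
Proof. by move=> FG; rewrite /minf FG; apply: eq_bigr. Qed.

Lemma minfZ F c : 0 <= c -> minf x0 (fun i => c * F i) = c * minf x0 F.
Proof.
move=> c0; apply/le_anti/andP; split; last first.
  by apply: minf_ge => i; rewrite ler_wpM2l // minf_le.
move: c0; rewrite le0r => /orP[/eqP->|c0]; first by rewrite mul0r (le_trans (minf_le _ x0)) ?mul0r.
by rewrite -ler_pdivrMl //; apply: minf_ge => i; rewrite ler_pdivrMl // minf_le.
Qed.

End Minf.

(** * The joint law of a source letter and a sequence of variables *)

Section Law.
Variables (R : realType) (Om T A : finType) (P : Om -> R) (Tm : Om -> T) (l : nat -> Om -> A).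
Hypothesis P0 : forall w, 0 <= P w.

Definition pre (j : nat) (w : Om) : seq A := mkseq (fun i => l i w) j.

Definition law (h : seq A) (t : T) : R :=
  PrE P (fun w => (Tm w == t) && (pre (size h) w == h)).

Lemma law_ge0 h t : 0 <= law h t. Proof. exact: PrE_ge0. Qed.

Lemma lsum_PrE j (F : Om -> R) :
  lsum j (fun h => \sum_(w | pre j w == h) F w) = \sum_w F w.
Proof.
under eq_lsum do rewrite big_mkcond.
rewrite lsum_sum; apply: eq_bigr => w _.
by rewrite (lsum_pick (fun=> F w)) // size_mkseq.
Qed.

Lemma sum_law (D : pred T) (h : seq A) (G : T -> R) :
  \sum_(t | D t) law h t * G t
  = \sum_(w | D (Tm w) && (pre (size h) w == h)) P w * G (Tm w).
Proof.
rewrite [RHS](partition_big Tm D) => [|w /andP[]//]; apply: eq_bigr => t Dt.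
rewrite mulr_suml; apply: eq_big => [w|w /andP[/eqP-> _] //].
by case: (Tm w =P t) => [->|]; rewrite ?Dt ?andbT ?andbF.
Qed.

Lemma lsum_law j (G : T -> seq A -> R) :
  lsum j (fun h => \sum_t law h t * G t h) = \sum_w P w * G (Tm w) (pre j w).
Proof.
rewrite -(lsum_PrE j); apply: eq_lsum => h sh; rewrite sum_law sh /=.
by apply: eq_bigr => w /eqP->.
Qed.

Lemma marg_law (B : finType) (f : T -> B) h b :
  marg f (law h) b = PrE P (fun w => (f (Tm w) == b) && (pre (size h) w == h)).
Proof.
rewrite /marg; have := sum_law (fun t => f t == b) h (fun=> 1).
by under eq_bigr do rewrite mulr1; move=> ->; apply: eq_bigr => w _; rewrite mulr1.
Qed.

Lemma Ent_law (B : finType) (f : T -> B) j :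
  Ent P (andr (evr (f \o Tm)) (evr (pre j))) = lsum j (fun h => hent f (law h)).
Proof.
under eq_lsum do rewrite hentE.
rewrite lsumN (lsum_law j (fun t h => ln (marg f (law h) (f t)))); congr (- _).
apply: eq_bigr => w _; congr (_ * ln _); rewrite marg_law size_mkseq.
by apply: eq_PrE => v; rewrite /andr /evr /= eq_sym [pre j w == _]eq_sym.
Qed.

Lemma pre_rcons j w : pre j.+1 w = rcons (pre j w) (l j w).
Proof. by rewrite /pre /mkseq -addn1 iotaD map_cat cats1. Qed.

Lemma law_rcons h a t :
  law (rcons h a) t
  = PrE P (fun w => [&& Tm w == t, pre (size h) w == h & l (size h) w == a]).
Proof. by apply: eq_PrE => w; rewrite size_rcons pre_rcons eqseq_rcons. Qed.

Lemma sum_law_rcons h t : \sum_a law (rcons h a) t = law h t.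
Proof.
rewrite /law /PrE [RHS](partition_big (l (size h)) xpredT) //=.
by apply: eq_bigr => a _; rewrite -/(PrE _ _) -/(law _ _) law_rcons; apply: eq_PrE => w; rewrite andbA.
Qed.

Lemma sum_marg_law_rcons (B : finType) (f : T -> B) h b :
  \sum_a marg f (law (rcons h a)) b = marg f (law h) b.
Proof. by rewrite exchange_big; apply: eq_bigr => t _; apply: sum_law_rcons. Qed.

Lemma law_rcons_le h a t : law (rcons h a) t <= law h t.
Proof.
by rewrite -(sum_law_rcons h t) (bigD1 a) //= lerDl sumr_ge0 // => c _; apply: law_ge0.
Qed.

Lemma marg_law_rcons_le (B : finType) (f : T -> B) h a b :
  marg f (law (rcons h a)) b <= marg f (law h) b.
Proof.
rewrite -(sum_marg_law_rcons f h b) (bigD1 a) //= lerDl sumr_ge0 // => c _.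
by apply: marg_ge0 => t; apply: law_ge0.
Qed.

(** Passage from the relational chain to an identity between laws. [markov] speaks of pairs of
    points, so the values must be realized by points; when they are not, both sides vanish. *)
Lemma markov_law (B S : finType) (f : T -> B) (k : T -> S) (g : B -> S) (e : nat -> rel Om) h a b :
  (forall t, k t = g (f t)) ->
  (forall j w w', (l j w == l j w') = e j w w') ->
  markov P (e (size h)) (andr (evr (k \o Tm)) (evr (pre (size h)))) (evr (f \o Tm)) ->
  marg f (law (rcons h a)) b * marg k (law h) (g b)
  = marg k (law (rcons h a)) (g b) * marg f (law h) b.
Proof.
move=> kg le mk; set j := size h in mk *.
have ML (D : finType) (q : T -> D) d : marg q (law (rcons h a)) d
   = PrE P (fun w => [&& q (Tm w) == d, pre j w == h & l j w == a]).
  by rewrite marg_law; apply: eq_PrE => w; rewrite size_rcons pre_rcons eqseq_rcons.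
case: (pickP (fun w => [&& k (Tm w) == g b, pre j w == h & l j w == a])) => [w1|no1]; last first.
  rewrite !ML [X in X * _]big_pred0 ?[X in _ = X * _]big_pred0 ?mul0r // => w.
  apply/negP => /andP[/eqP fw hw]; have /negP := no1 w; apply.
  by rewrite kg fw eqxx.
case: (pickP (fun w => (f (Tm w) == b) && (pre j w == h))) => [w2|no2]; last first.
  rewrite ML [X in X * _]big_pred0 ?mul0r; last first.
    by move=> w; have := no2 w; case: eqP => //= _; case: eqP.
  by rewrite (marg_law f h b) [X in _ * X]big_pred0 ?mulr0.
move=> /andP[/eqP f2 /eqP h2] /and3P[/eqP k1 /eqP h1 /eqP a1].
have /mk : andr (evr (k \o Tm)) (evr (pre j)) w1 w2.
  by rewrite /andr /evr /= k1 h1 h2 kg f2 !eqxx.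
rewrite !ML !marg_law -/j => E.
transitivity (PrE P (fun w => [&& e j w1 w, andr (evr (k \o Tm)) (evr (pre j)) w1 w & evr (f \o Tm) w2 w])
  * PrE P (andr (evr (k \o Tm)) (evr (pre j)) w1)).
  congr (_ * _); apply: eq_PrE => w; rewrite /andr /evr -?le /= k1 h1 ?a1 ?f2.
    rewrite ![_ == h]eq_sym [_ == a]eq_sym [_ == b]eq_sym; case: (b =P f (Tm w)) => [bE|_]; last by rewrite !andbF.
    by rewrite kg -bE eqxx /= andbT andbC.
  by rewrite [_ == h]eq_sym [_ == g b]eq_sym.
rewrite E; congr (_ * _); apply: eq_PrE => w; rewrite /andr /evr -?le /= k1 h1 ?a1 ?f2.
  by rewrite ![_ == h]eq_sym [_ == a]eq_sym [_ == g b]eq_sym andbC -andbA.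
rewrite ![_ == h]eq_sym [_ == b]eq_sym; case: (b =P f (Tm w)) => [bE|_]; last by rewrite !andbF.
by rewrite kg -bE eqxx /= andbT.
Qed.

End Law.

(** * From random variables with Markov chains to a protocol *)

Section Realization.
Variables (R : realType) (X Y Z Xh Zh : finType).
Variables (pxy : X -> Y -> R) (pzx : X -> Z -> R).
Variables (dx : X -> Xh -> R) (dz : Z -> Zh -> R).
Notation T := (src X Y Z).
Notation p := (psrc pxy pzx).
Variables (Om : finType) (P : Om -> R) (Tm : Om -> T) (er : nat -> rel Om) (N : nat).
Hypotheses (P0 : forall w, 0 <= P w) (P1 : \sum_w P w = 1).
Hypothesis (lawT : forall t, PrE P (fun w => Tm w == t) = p t).
Hypothesis (er_equiv : forall j, equivalence_rel (er j)).

Definition hist (j : nat) : rel Om := fun w w' => [forall i : 'I_j, er i w w'].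

Hypothesis mk0 : markov P (er 0) (evr (@sy X Y Z \o Tm)) (evr Tm).
Hypothesis mkS : forall j, (0 < j < N)%N ->
  markov P (er j) (andr (evr (@key X Y Z j \o Tm)) (hist j)) (evr (@sxz X Y Z \o Tm)).

Let l (j : nat) (w : Om) : Om := rep (er j) w.

Lemma hist_pre j w w' : (pre l j w == pre l j w') = hist j w w'.
Proof.
elim: j => [|j IH]; first by rewrite eqxx; symmetry; apply/forallP => -[].
rewrite !pre_rcons eqseq_rcons IH rep_eq //.
apply/andP/forallP => [[/forallP h1 h2] i|h]; last first.
  by split; [apply/forallP => i; apply: (h (widen_ord (leqnSn j) i)) | apply: (h ord_max)].
have := ltn_ord i; rewrite ltnS leq_eqVlt => /orP[/eqP->//|ij].
exact: (h1 (Ordinal ij)).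
Qed.

Definition kxz (u : bool) (b : X * Z) : skey X Y Z := if u then inr b.1 else inl (inr b.2).

Lemma ukey_xz u (t : T) : ukey u t = kxz u (sxz t). Proof. by case: u. Qed.

Let w0 : Om.
Proof.
case: (pickP (fun w : Om => true)) => [w _|no]; first exact: w.
by exfalso; move: P1; rewrite big_pred0 // => /eqP; rewrite eq_sym oner_eq0.
Qed.

Let L := law P Tm l.

(** The conditional law of the next class given the history and the speaker's observation. The point
    mass at [w0] serves conditions of probability 0, as [valid] asks for normalization
    everywhere. *)
Definition rQ (h : seq Om) (s : skey X Y Z) (a : Om) : R :=
  let m := marg (@key X Y Z (size h)) (L h) s in
  if m == 0 then (a == w0)%:R else marg (@key X Y Z (size h)) (L (rcons h a)) s / m.

Let L0 h t : 0 <= L h t. Proof. exact: law_ge0. Qed.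

Lemma valid_rQ : valid rQ.
Proof.
split=> h s.
  by move=> a; rewrite /rQ; case: eqP => // _; rewrite divr_ge0 // marg_ge0.
rewrite /rQ; case: eqP => [_|/eqP nz]; last by rewrite -mulr_suml sum_marg_law_rcons divff.
by rewrite (bigD1 w0) //= eqxx big1 ?addr0 // => a /negbTE ->.
Qed.

Let M := mu (@key X Y Z) 0 rQ p.

Lemma L_nil : L [::] =1 p.
Proof. by move=> t; rewrite -lawT; apply: eq_PrE => w; rewrite andbT. Qed.

(** The chain of the first variable is against the whole source letter, so here the full law is
    reproduced, including Y, which the helper's rate involves. *)
Lemma mu_rQ1 u : M [:: u] =1 L [:: u].
Proof.
move=> t; rewrite /M /= -L_nil /rQ /=.
have mkE := @markov_law R Om T Om P Tm l T _ id (@sy X Y Z) (@sy X Y Z) er [::] u t.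
have {mkE} : L [:: u] t * marg (@sy X Y Z) (L [::]) (sy t)
   = marg (@sy X Y Z) (L [:: u]) (sy t) * L [::] t.
  have mid m : marg id m t = m t :> R by rewrite /marg big_pred1_eq.
  rewrite -(mid (L [:: u])) -(mid (L [::])); apply: mkE => // [j w w'|]; first exact: rep_eq.
  by apply: eq_markov mk0 => // w w'; rewrite /andr /evr eqxx andbT.
have kE h : marg (@key X Y Z 0) (L h) (inl (inl (sy t))) = marg (@sy X Y Z) (L h) (sy t).
  by apply: eq_bigl => v; rewrite /key; apply/eqP/eqP => [[]|->].
rewrite !kE => E; case: eqP => [m0|/eqP nz].
  have h0 : L [::] t <= 0.
    by rewrite -m0 /marg (bigD1 t) //= lerDl sumr_ge0.
  have -> : L [::] t = 0 by apply/le_anti; rewrite h0 L0.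
  by rewrite mul0r; apply/le_anti; rewrite L0 (le_trans (law_rcons_le Tm l P0 [::] u t)).
by rewrite mulrA [_ * marg _ _ _]mulrC -E mulfK.
Qed.

(** Later chains are only against (X,Z), so only this marginal is reproduced. The induction closes
    because every later speaker observes a function of (X,Z). *)
Lemma mu_rQ h : (0 < size h <= N)%N ->
  marg (@sxz X Y Z) (M h) =1 marg (@sxz X Y Z) (L h).
Proof.
elim/last_ind: h => [//|h a IH]; rewrite size_rcons => /andP[_ hN] b.
case: (posnP (size h)) => [/size0nil->|h0]; first exact: (eq_marg _ (mu_rQ1 a)).
have [j hj] : exists j, size h = j.+1 by case: (size h) h0 => // j; exists j.
have hN' : (0 < j.+1 < N)%N by rewrite -hj h0.
have kE t : key (size h) t = kxz (odd j) (sxz t) by rewrite hj /= ukey_xz.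
have -> : marg (@sxz X Y Z) (M (rcons h a)) b = rQ h (kxz (odd j) b) a * marg (@sxz X Y Z) (M h) b.
  rewrite -(marg_scale _ (fun b => rQ h (kxz (odd j) b) a)).
  by apply: eq_marg => t; rewrite /M mu_rcons add0n kE mulrC.
rewrite IH ?h0 ?(ltnW hN) // /rQ; case: eqP => [m0|/eqP nz].
  have : marg (@sxz X Y Z) (L h) b = 0.
    apply/le_anti; rewrite marg_ge0 // andbT -m0.
    have -> : marg (@key X Y Z (size h)) (L h) (kxz (odd j) b)
       = marg (kxz (odd j) \o (@sxz X Y Z)) (L h) (kxz (odd j) b).
      by apply: eq_bigl => t; rewrite kE.
    rewrite marg_comp (bigD1 b) //= lerDl.
    by rewrite sumr_ge0 // => c _; rewrite marg_ge0.
  move=> h00; rewrite h00 mulr0; apply/esym/le_anti; rewrite marg_ge0 // andbT -h00.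
  exact: marg_law_rcons_le.
rewrite mulrAC; apply: (mulIf nz); rewrite mulfVK //.
symmetry; apply: (@markov_law R Om T Om P Tm l _ _ _ _ _ er h a b kE).
  by move=> i w w'; apply: rep_eq.
rewrite hj; apply: eq_markov (mkS hN') => // w w'; by rewrite /andr -hist_pre.
Qed.

Lemma lent_rQ1 (B : finType) (f : T -> B) j : (j <= 1)%N ->
  lent (@key X Y Z) rQ p f j = Ent P (andr (evr (f \o Tm)) (hist j)).
Proof.
move=> j1; transitivity (Ent P (andr (evr (f \o Tm)) (evr (pre l j)))); last first.
  by apply: eq_Ent => w w'; rewrite /andr -hist_pre.
rewrite Ent_law; apply: eq_lsum => h sh; apply: eq_hent => t.
case: j j1 sh => [|[]] //= _; first by move/size0nil->; rewrite /= -L_nil.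
by case: h => [|u []] //= _; apply: mu_rQ1.
Qed.

Lemma lent_rQ (B : finType) (f : T -> B) (g : X * Z -> B) j : f =1 g \o (@sxz X Y Z) ->
  (0 < j <= N)%N -> lent (@key X Y Z) rQ p f j = Ent P (andr (evr (f \o Tm)) (hist j)).
Proof.
move=> fg jN; transitivity (Ent P (andr (evr (f \o Tm)) (evr (pre l j)))); last first.
  by apply: eq_Ent => w w'; rewrite /andr -hist_pre.
rewrite Ent_law; apply: eq_lsum => h sh; congr (- _); apply: eq_bigr => b _; congr xlnx.
have E m : marg f m b = marg (g \o (@sxz X Y Z)) m b :> R.
  by apply: eq_bigl => t; rewrite fg.
by rewrite !E !marg_comp; apply: eq_bigr => c _; rewrite mu_rQ // sh.
Qed.

(** The last hypothesis says that, on a class with fixed history and fixed [f], the estimate of an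
    independent copy costs on average as much as the true one. Each fixed estimate costs at least
    the minimum in [psi], so [D] may use more than the single-letter decoder observes. *)
Lemma psi_rQ (B I : finType) (i0 : I) (f : T -> B) (c : T -> I -> R)
    (g : X * Z -> B) (c' : X * Z -> I -> R) (D : Om -> I) :
  (0 < N)%N -> f =1 g \o (@sxz X Y Z) -> (forall t i, c t i = c' (sxz t) i) ->
  (forall w0, let C := [pred w | hist N w0 w && (f (Tm w) == f (Tm w0))] in
     (\sum_(w in C) P w * c (Tm w) (D w)) * PrE P C
     = \sum_(w' in C) P w' * \sum_(w in C) P w * c (Tm w) (D w')) ->
  lsum N (fun h => psi i0 f c (M h)) <= \sum_w P w * c (Tm w) (D w).
Proof.
move=> N0 fg cc sw; rewrite -(lsum_PrE l N); apply: ler_lsum => h sh.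
rewrite (partition_big (fun w => f (Tm w)) xpredT) //=; apply: ler_sum => z _.
set C0 := fun w => (pre l N w == h) && (f (Tm w) == z).
have mE m i : \sum_(t | f t == z) m t * c t i
    = \sum_(b | g b == z) marg (@sxz X Y Z) m b * c' b i :> R.
  rewrite (partition_big (@sxz X Y Z) (fun b => g b == z)) => [|t]; last by rewrite fg.
  apply: eq_bigr => b /eqP bz; rewrite mulr_suml.
  apply: eq_big => [t|t /andP[_ /eqP <-]]; last by rewrite cc.
  by rewrite fg /=; case: (sxz t =P b) => [->|]; rewrite ?bz ?eqxx ?andbF.
have FE i : \sum_(t | f t == z) M h t * c t i = \sum_(w | C0 w) P w * c (Tm w) i.
  transitivity (\sum_(t | f t == z) L h t * c t i).
    by rewrite !mE; apply: eq_bigr => b _; rewrite mu_rQ // sh N0 leqnn.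
  by rewrite sum_law sh; apply: eq_bigl => w; rewrite /C0 andbC.
rewrite (eq_minf i0 FE).
have [PC|PC] := eqVneq (PrE P C0) 0.
  have Pz w : C0 w -> P w = 0.
    by move=> Cw; apply/le_anti; rewrite P0 andbT -PC /PrE (bigD1 w) //= lerDl sumr_ge0.
  by rewrite (le_trans (minf_le i0 _ i0)) // !big1 // => w Cw; rewrite Pz ?mul0r.
case: (pickP C0) => [w1 C1|no]; last by exfalso; move/eqP: PC; apply; apply: big_pred0.
have PC0 : 0 < PrE P C0 by rewrite lt0r PC PrE_ge0.
have CE : [pred w | hist N w1 w && (f (Tm w) == f (Tm w1))] =1 C0.
  by move=> w /=; case/andP: C1 => /eqP E1 /eqP ->; rewrite -hist_pre E1 eq_sym.
have := sw w1 => /=; rewrite (eq_PrE P CE) (eq_bigl _ _ CE) [X in _ = X -> _](eq_bigl _ _ CE).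
under [X in _ = X -> _]eq_bigr => w _ do rewrite (eq_bigl _ _ CE).
move=> E; rewrite -(ler_pM2r PC0) E /PrE mulr_sumr; apply: ler_sum => w _.
by rewrite mulrC ler_wpM2l // minf_le.
Qed.

End Realization.

(** * From a protocol to random variables *)

Section PathSpace.
Variables (R : realType) (T S A : finType) (key : nat -> T -> S) (N : nat).
Variables (Q : seq A -> S -> A -> R) (m : T -> R) (a0 : A).
Hypotheses (vQ : valid Q) (m0 : forall t, 0 <= m t) (m1 : \sum_t m t = 1).

Definition tpath := (T * N.-tuple A)%type.
Definition ppath (w : tpath) : R := mu key 0 Q m w.2 w.1.
Definition lpath (j : nat) (w : tpath) : A := nth a0 w.2 j.

Lemma ppath_ge0 w : 0 <= ppath w. Proof. exact: mu_ge0. Qed.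

Lemma pre_lpath j w : (j <= N)%N -> pre lpath j w = take j w.2.
Proof.
move=> jN; apply: (@eq_from_nth _ a0) => [|i].
  by rewrite size_mkseq size_take size_tuple; case: ltnP => // ?; apply/eqP; rewrite eqn_leq jN.
by rewrite size_mkseq => ij; rewrite nth_mkseq // nth_take.
Qed.

Lemma sum_ppath j (G : T -> seq A -> R) : (j <= N)%N ->
  \sum_w ppath w * G w.1 (pre lpath j w) = lsum j (fun h => \sum_t mu key 0 Q m h t * G t h).
Proof.
move=> jN; rewrite -(lsum_mu_take key 0 m j (N - j) G vQ) subnKC // lsum_tuple exchange_big.
rewrite pair_big /=; apply: eq_bigr => w _; by rewrite pre_lpath.
Qed.

Lemma ppath1 : \sum_w ppath w = 1.
Proof.
have := sum_ppath (fun _ _ => 1) (leq0n N) => /=.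
by under eq_bigr do rewrite mulr1; move=> ->; under eq_bigr do rewrite mulr1.
Qed.

Lemma law_ppath h t : (size h <= N)%N -> law ppath (fun w => w.1) lpath h t = mu key 0 Q m h t.
Proof.
move=> hN; have := sum_ppath (fun u g => if (u == t) && (g == h) then 1 else 0) hN.
move=> E.
transitivity (\sum_w ppath w * (if (w.1 == t) && (pre lpath (size h) w == h) then 1 else 0)).
  by rewrite /law /PrE big_mkcond; apply: eq_bigr => w _; case: ifP; rewrite ?mulr1 ?mulr0.
rewrite E; transitivity (lsum (size h) (fun g => if h == g then mu key 0 Q m g t else 0)); last exact: lsum_pick.
apply: eq_lsum => g _; rewrite (bigD1 t) //= eqxx /= [g == h]eq_sym big1 ?addr0.
  by case: eqP; rewrite ?mulr1 ?mulr0.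
by move=> u /negbTE ->; rewrite mulr0.
Qed.

Lemma Ent_ppath (B : finType) (f : T -> B) j : (j <= N)%N ->
  Ent ppath (andr (evr (fun w => f w.1)) (evr (pre lpath j))) = lent key Q m f j.
Proof.
move=> jN; rewrite (Ent_law ppath (fun w => w.1) lpath f j).
by apply: eq_lsum => h sh; apply: eq_hent => t; rewrite law_ppath // sh.
Qed.

(** Stated for the whole prefix and not for letter [j] alone, because the auxiliary variables built
    from a protocol will be prefixes. All four probabilities factor through [Q h s a]. *)
Lemma markov_ppath j : (j < N)%N ->
  markov ppath (evr (pre lpath j.+1)) (andr (evr (fun w => key j w.1)) (evr (pre lpath j)))
     (evr (fun w => w.1)).
Proof.
move=> jN w1 w2 /andP[/eqP k12 /eqP h12]; set h := pre lpath j w1.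
have sh : size h = j by rewrite size_mkseq.
set s := key j w1.1; set a := lpath j w1.
have hE w : (evr (pre lpath j.+1) w1 w) = (h == pre lpath j w) && (a == lpath j w).
  by rewrite /evr !pre_rcons eqseq_rcons.
have PB : PrE ppath (andr (evr (fun w => key j w.1)) (evr (pre lpath j)) w1)
     = marg (key j) (mu key 0 Q m h) s.
  transitivity (marg (key j) (law ppath (fun w => w.1) lpath h) s).
    by rewrite marg_law sh; apply: eq_PrE => w; rewrite /andr /evr eq_sym [h == _]eq_sym.
  by apply: eq_marg => t; rewrite law_ppath // sh ltnW.
have mR t : key j t = s -> mu key 0 Q m (rcons h a) t = Q h s a * mu key 0 Q m h t.
  by move=> kt; rewrite mu_rcons sh add0n kt mulrC.
have -> : PrE ppath (fun w => [&& evr (pre lpath j.+1) w1 w,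
     andr (evr (fun w => key j w.1)) (evr (pre lpath j)) w1 w & evr (fun w => w.1) w2 w])
   = Q h s a * mu key 0 Q m h w2.1.
  rewrite -mR // -law_ppath ?size_rcons ?sh // law_rcons; apply: eq_PrE => w.
  rewrite hE sh /andr /evr -/h eq_sym [a == _]eq_sym [_ == w2.1]eq_sym.
  by case: (w2.1 =P w.1) => [<-|]; rewrite ?andbF // k12 eqxx /=; case: (pre lpath j w == h); rewrite ?andbF ?andbT.
have -> : PrE ppath (fun w => evr (pre lpath j.+1) w1 w
     && andr (evr (fun w => key j w.1)) (evr (pre lpath j)) w1 w)
   = Q h s a * marg (key j) (mu key 0 Q m h) s.
  transitivity (marg (key j) (law ppath (fun w => w.1) lpath (rcons h a)) s).
    rewrite marg_law size_rcons sh; apply: eq_PrE => w.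
    rewrite hE pre_rcons eqseq_rcons /andr /evr -/h -/s [h == _]eq_sym [a == _]eq_sym [s == _]eq_sym.
    by case: (_ == s); case: (_ == h); case: (_ == a).
  rewrite /marg mulr_sumr; apply: eq_bigr => t /eqP kt.
  by rewrite law_ppath ?size_rcons ?sh // mR.
have -> : PrE ppath (fun w => andr (evr (fun w => key j w.1)) (evr (pre lpath j)) w1 w
     && evr (fun w => w.1) w2 w) = mu key 0 Q m h w2.1.
  rewrite -law_ppath ?sh ?(ltnW jN) // /law sh; apply: eq_PrE => w; rewrite /andr /evr -/h -/s.
  rewrite [_ == w2.1]eq_sym [h == _]eq_sym; case: (w2.1 =P w.1) => [<-|]; rewrite ?andbF //.
  by rewrite -k12 eqxx andbT.
by rewrite PB; ring.
Qed.

End PathSpace.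

Section ConditionalEntropy.
Variables (R : realType) (T S A : finType) (key : nat -> T -> S).
Variables (Q : seq A -> S -> A -> R) (m : T -> R).
Hypotheses (vQ : valid Q) (m0 : forall t, 0 <= m t) (m1 : \sum_t m t = 1).

(** Conditioning reduces entropy: submodularity on the path space for the prefix of length [j.+1],
    [f], and the pair of [g] with the prefix of length [j]. *)
Lemma lent_cond (B C : finType) (f : T -> B) (g : T -> C) (k : B -> C) j :
  (forall t, g t = k (f t)) ->
  lent key Q m f j.+1 - lent key Q m f j <= lent key Q m g j.+1 - lent key Q m g j.
Proof.
move=> gk.
have [t0 _] : exists t : T, true.
  case: (pickP (fun _ : T => true)) => [t _|no]; first by exists t.
  by exfalso; move: m1; rewrite big_pred0 // => /eqP; rewrite eq_sym oner_eq0.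
have [a0 _] : exists a : A, true.
  case: (pickP (fun _ : A => true)) => [a _|no]; first by exists a.
  by exfalso; move: (vQ.2 [::] (key 0 t0)); rewrite big_pred0 // => /eqP; rewrite eq_sym oner_eq0.
pose P : tpath T A j.+1 -> R := ppath key Q m.
have ev (D : finType) (q : T -> D) : equivalence_rel (evr (fun w : tpath T A j.+1 => q w.1)) by exact: evr_equiv.
have ep i : equivalence_rel (evr (pre (lpath (N := j.+1) (T := T) a0) i)) by exact: evr_equiv.
have Pg w : 0 <= P w by apply: ppath_ge0.
have EE (D : finType) (q : T -> D) i : (i <= j.+1)%N ->
    lent key Q m q i = Ent P (andr (evr (fun w => q w.1)) (evr (pre (lpath a0) i))).
  by move=> ij; rewrite /P Ent_ppath.
pose F : rel (tpath T A j.+1) := evr (fun w => f w.1).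
pose G : rel (tpath T A j.+1) := evr (fun w => g w.1).
pose E i : rel (tpath T A j.+1) := evr (pre (lpath a0) i).
have ES w w' : E j.+1 w w' = E j w w' && (lpath a0 j w == lpath a0 j w').
  by rewrite /E /evr !pre_rcons eqseq_rcons.
have FG w w' : F w w' -> G w w' by rewrite /F /G /evr !gk => /eqP ->.
have h : Ent P (andr (andr (E j.+1) F) (andr G (E j))) + Ent P (andr G (E j))
    <= Ent P (andr (E j.+1) (andr G (E j))) + Ent P (andr F (andr G (E j))).
  apply: (@Ent_submod R _ P Pg (E j.+1) F (andr G (E j)));
    by [exact: ep | exact: ev | apply: andr_equiv; [exact: ev | exact: ep]].
have e1 : Ent P (andr (andr (E j.+1) F) (andr G (E j))) = Ent P (andr F (E j.+1)).
  apply: eq_Ent => w w'; rewrite /andr ES; case: (boolP (F w w')) => [/FG ->|_]; rewrite ?andbF //.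
  by case: (E j w w'); rewrite ?andbF ?andbT.
have e2 : Ent P (andr (E j.+1) (andr G (E j))) = Ent P (andr G (E j.+1)).
  apply: eq_Ent => w w'; rewrite /andr ES; case: (G w w'); rewrite ?andbF //.
  by case: (E j w w'); rewrite ?andbF ?andbT.
have e3 : Ent P (andr F (andr G (E j))) = Ent P (andr F (E j)).
  by apply: eq_Ent => w w'; rewrite /andr; case: (boolP (F w w')) => [/FG ->|_].
rewrite !EE // -/F -/G -!/(E _); move: h; rewrite e1 e2 e3; lra.
Qed.

End ConditionalEntropy.

Section Telescope.
Variables (R : realType) (X Y Z A : finType).
Variables (pxy : X -> Y -> R) (pzx : X -> Z -> R).
Hypothesis hp : is_source pxy pzx.
Notation T := (src X Y Z).
Notation p := (psrc pxy pzx).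
Variable (Q : seq A -> skey X Y Z -> A -> R).
Hypothesis vQ : valid Q.
Notation L := (lent (@key X Y Z) Q p).

Lemma psrc_ge0 t : 0 <= p t.
Proof. by case: hp => h1 [_ [h2 _]]; rewrite mulr_ge0. Qed.

Lemma psrc1 : \sum_t p t = 1.
Proof.
case: hp => _ [h1 [_ h2]]; rewrite -h1 pair_big /=.
rewrite -(pair_big xpredT xpredT (fun xy z => pxy xy.1 xy.2 * pzx xy.1 z)) /=.
by apply: eq_bigr => xy _; rewrite -mulr_sumr h2 mulr1.
Qed.

(** Stage [k.*2.+2] belongs to user X, whose letter is drawn from X and the history. It adds the
    same entropy to both terms, so H(Z | X, history) does not move. *)
Lemma lent_X (k : nat) : L (@sxz _ _ _) k.*2.+3 - L (@sx _ _ _) k.*2.+3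
  = L (@sxz _ _ _) k.*2.+2 - L (@sx _ _ _) k.*2.+2.
Proof.
have o : odd k.*2.+1 by rewrite /= odd_double.
rewrite (lent_refine vQ psrc_ge0 (f := @sxz X Y Z) (g := fun b => inr b.1)); last first.
  by move=> t; rewrite /key o.
rewrite (lent_refine vQ psrc_ge0 (f := @sx X Y Z) (g := fun b => inr b)); last first.
  by move=> t; rewrite /key o.
by ring.
Qed.

Lemma lent_Z (k : nat) : L (@sxz _ _ _) k.*2.+2 - L (@sz _ _ _) k.*2.+2
  = L (@sxz _ _ _) k.*2.+1 - L (@sz _ _ _) k.*2.+1.
Proof.
have o : odd k.*2 = false by rewrite odd_double.
rewrite (lent_refine vQ psrc_ge0 (f := @sxz X Y Z) (g := fun b => inl (inr b.2))); last first.
  by move=> t; rewrite /key o.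
rewrite (lent_refine vQ psrc_ge0 (f := @sz X Y Z) (g := fun b => inl (inr b))); last first.
  by move=> t; rewrite /key o.
by ring.
Qed.

(** Between two stages of user Z only user X speaks, and [lent_X] closes that gap. *)
Lemma telescope_z K :
  \sum_(k < K) (L (@sxz _ _ _) k.*2.+1 - L (@sx _ _ _) k.*2.+1
     - (L (@sxz _ _ _) k.*2.+2 - L (@sx _ _ _) k.*2.+2))
  = L (@sxz _ _ _) 1 - L (@sx _ _ _) 1 - (L (@sxz _ _ _) K.*2.+1 - L (@sx _ _ _) K.*2.+1).
Proof.
elim: K => [|K IH]; first by rewrite big_ord0 double0 subrr.
by rewrite big_ord_recr /= IH -lent_X doubleS; ring.
Qed.

Lemma telescope_x K :
  \sum_(k < K) (L (@sxz _ _ _) k.*2.+2 - L (@sz _ _ _) k.*2.+2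
     - (L (@sxz _ _ _) k.*2.+3 - L (@sz _ _ _) k.*2.+3))
  = L (@sxz _ _ _) 1 - L (@sz _ _ _) 1 - (L (@sxz _ _ _) K.*2.+1 - L (@sz _ _ _) K.*2.+1).
Proof.
elim: K => [|K IH]; first by rewrite big_ord0 double0 subrr.
by rewrite big_ord_recr /= IH lent_Z doubleS; ring.
Qed.

End Telescope.

(** * The single-letter region as a set of protocols *)

Section InterleavedHistory.
Variables (Om : finType) (K : nat) (e : nat -> rel Om).
Variables (TU : finType) (U : Om -> TU) (TV TW : 'I_K -> finType).
Variables (V : forall k, Om -> TV k) (W : forall k, Om -> TW k).

(** Users alternate and user Z begins, so [n <= m <= n.+1] describes exactly the possible numbers of
    letters of users Z and X; the successor counts the helper's letter. *)
Lemma hist_interleave (eV eW : nat -> rel Om) m n w w' :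
  (forall k : 'I_K, eV k = evr (V k)) -> (forall k : 'I_K, eW k = evr (W k)) ->
  e 0 = evr U -> (forall k, (k < K)%N -> e k.*2.+1 = eV k) ->
  (forall k, (k < K)%N -> e k.*2.+2 = eW k) ->
  (n <= m <= n.+1)%N -> (m <= K)%N ->
  hist e (m + n).+1 w w' = [&& evr U w w', histr V m w w' & histr W n w w'].
Proof.
move=> hV hW e0 eO eE /andP[nm mn] mK; apply/forallP/and3P => [h|[hu hv hw] [i ilt]].
  split.
  - by have := h ord0; rewrite e0.
  - apply/forallP => k; apply/implyP => km.
    have klt : (k.*2.+1 < (m + n).+1)%N by lia.
    by have := h (Ordinal klt); rewrite /= eO // hV.
  - apply/forallP => k; apply/implyP => km.
    have klt : (k.*2.+2 < (m + n).+1)%N by lia.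
    by have := h (Ordinal klt); rewrite /= eE // hW.
case: i ilt => [|i] ilt /=; first by rewrite e0.
have ih : (i./2 < K)%N by lia.
case: (boolP (odd i)) => oi.
  have iE : i = i./2.*2.+1 by rewrite -[LHS]odd_double_half oi.
  rewrite iE eE // (hW (Ordinal ih)).
  by move/forallP: hw => /(_ (Ordinal ih)) /implyP; apply; rewrite /=; lia.
have iE : i = i./2.*2 by rewrite -[LHS]odd_double_half (negbTE oi).
rewrite iE eO // (hV (Ordinal ih)).
by move/forallP: hv => /(_ (Ordinal ih)) /implyP; apply; rewrite /=; lia.
Qed.

End InterleavedHistory.

Lemma ukey_eq (X Y Z : finType) u (t t' : src X Y Z) :
  (ukey u t == ukey u t') = if u then sx t == sx t' else sz t == sz t'.
Proof. by case: u; apply/eqP/eqP => [[]|E] //; rewrite /ukey E. Qed.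

Section RegionToProtocol.
Variables (R : realType) (X Y Z Xh Zh : finType).
Variables (pxy : X -> Y -> R) (pzx : X -> Z -> R).
Variables (dx : X -> Xh -> R) (dz : Z -> Zh -> R) (K : nat).
Hypothesis hp : is_source pxy pzx.

Lemma in_RK_NF (Dx Dz Rx Ry Rz : R) :
  in_RK pxy pzx dx dz K Dx Dz Rx Ry Rz -> NF pxy pzx dx dz K Dx Dz Rx Ry Rz.
Proof.
case=> Om [P [Xr [Yr [Zr [TU [U [TV [TW [V [W [Xhr [Zhr]]]]]]]]]]]].
case=> -[[P0 P1] law0] mkU [mkV mkW] [[fX fZ] [DX DZ]] [hRy hRz hRx].
have [w0 _] : exists w : Om, true.
  case: (pickP (fun _ : Om => true)) => [w _|no]; first by exists w.
  by exfalso; move: P1; rewrite big_pred0 // => /eqP; rewrite eq_sym oner_eq0.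
pose Tm w : src X Y Z := (Xr w, Yr w, Zr w).
pose eV k : rel Om := if insub k is Some k' then evr (V k') else fun _ _ => true.
pose eW k : rel Om := if insub k is Some k' then evr (W k') else fun _ _ => true.
pose er j : rel Om := if j is j'.+1 then (if odd j' then eW j'./2 else eV j'./2) else evr U.
have eVE (k : 'I_K) : eV k = evr (V k) by rewrite /eV valK.
have eWE (k : 'I_K) : eW k = evr (W k) by rewrite /eW valK.
have erO k : er k.*2.+1 = eV k by rewrite /= odd_double doubleK.
have erE k : er k.*2.+2 = eW k by rewrite /= odd_double /= uphalf_double.
have tt_equiv : equivalence_rel (fun _ _ : Om => true) by [].
have er_equiv j : equivalence_rel (er j).
  case: j => [|j]; first exact: evr_equiv.
  by rewrite /er /eW /eV; case: (odd j); case: insubP => * //; exact: evr_equiv.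
have HI m n w w' : (n <= m <= n.+1)%N -> (m <= K)%N ->
    hist er (m + n).+1 w w' = [&& evr U w w', histr V m w w' & histr W n w w'].
  by move=> mn mK; apply: (@hist_interleave Om K er TU U TV TW V W eV eW).
have HIo k w w' : (k <= K)%N -> hist er k.*2.+1 w w' = [&& evr U w w', histr V k w w' & histr W k w w'].
  by move=> kK; rewrite -addnn HI // leqnn leqnSn.
have HIe k w w' : (k < K)%N -> hist er k.*2.+2 w w' = [&& evr U w w', histr V k.+1 w w' & histr W k w w'].
  by move=> kK; rewrite -addnn -addSn HI // leqnSn leqnn.
have lawT t : PrE P (fun w => Tm w == t) = psrc pxy pzx t.
  by case: t => [[x y] z]; rewrite /psrc /= -law0; apply: eq_PrE => w; rewrite /Tm !xpair_eqE andbA.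
have histr_equiv (D : 'I_K -> finType) (F : forall k, Om -> D k) m : equivalence_rel (histr F m).
  move=> a b c; split; first by apply/forallP => k; rewrite eqxx implybT.
  by move/forallP => h; apply: eq_forallb => k; case: (boolP (k < m)%N) (h k) => //= _ /eqP ->.
(* The chain U - Y - (X,Z) is first joined with its middle term, since the realization needs it
   against the full source letter. *)
have mk0 : markov P (er 0) (evr (@sy X Y Z \o Tm)) (evr Tm).
  apply: eq_markov (markov_joint (evr_equiv Yr) mkU) => // w w'.
  by rewrite /andr /evr /Tm !xpair_eqE; case: (Xr w == _); case: (Yr w == _).
have mkSx (k : 'I_K) : markov P (er k.*2.+2) (andr (evr (@key X Y Z k.*2.+2 \o Tm)) (hist er k.*2.+2))
    (evr (@sxz X Y Z \o Tm)).
  have fBE : andr (evr (@key X Y Z k.*2.+2 \o Tm)) (hist er k.*2.+2)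
      =2 andr (andr (andr (evr Xr) (evr U)) (histr V k.+1)) (histr W k).
    move=> w w'; rewrite {1}/andr HIe // /andr -!andbA; congr (_ && _).
    by rewrite /evr [LHS]ukey_eq /= odd_double.
  have eB : equivalence_rel (andr (andr (andr (evr Xr) (evr U)) (histr V k.+1)) (histr W k)).
    by do 2!(apply: andr_equiv => //); apply: andr_equiv; apply: evr_equiv.
  rewrite erE eWE.
  apply: (@markov_coarsen R Om P _ _ (andr (andr (andr (andr (evr Xr) (evr U)) (histr V k.+1)) (histr W k))
    (andr (evr Zr) (evr Yr)))).
  - by apply: andr_equiv => //; apply: andr_equiv; apply: evr_equiv.
  - exact: evr_equiv.
  - move=> w w' /andP[/andP[/andP[/andP[/eqP e1 _] _] _] /andP[/eqP e2 _]].
    by rewrite /evr /Tm /sxz /sx /sz /= e1 e2.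
  - by apply: eq_markov (markov_joint eB (mkW k)) => // w w'; rewrite -fBE.
have mkSz (k : 'I_K) : markov P (er k.*2.+1) (andr (evr (@key X Y Z k.*2.+1 \o Tm)) (hist er k.*2.+1))
    (evr (@sxz X Y Z \o Tm)).
  have fBE : andr (evr (@key X Y Z k.*2.+1 \o Tm)) (hist er k.*2.+1)
      =2 andr (andr (andr (evr Zr) (evr U)) (histr V k)) (histr W k).
    move=> w w'; rewrite {1}/andr HIo ?(ltnW (ltn_ord k)) // /andr -!andbA; congr (_ && _).
    by rewrite /evr [LHS]ukey_eq /= odd_double.
  have eB : equivalence_rel (andr (andr (andr (evr Zr) (evr U)) (histr V k)) (histr W k)).
    by do 2!(apply: andr_equiv => //); apply: andr_equiv; apply: evr_equiv.
  rewrite erO eVE.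
  apply: (@markov_coarsen R Om P _ _ (andr (andr (andr (andr (evr Zr) (evr U)) (histr V k)) (histr W k))
      (andr (evr Xr) (evr Yr)))).
  - by apply: andr_equiv => //; apply: andr_equiv; apply: evr_equiv.
  - exact: evr_equiv.
  - move=> w w' /andP[/andP[/andP[/andP[/eqP e1 _] _] _] /andP[/eqP e2 _]].
    by rewrite /evr /Tm /sxz /sx /sz /= e1 e2.
  - by apply: eq_markov (markov_joint eB (mkV k)) => // w w'; rewrite -fBE.
have mkS j : (0 < j < K.*2.+1)%N ->
    markov P (er j) (andr (evr (@key X Y Z j \o Tm)) (hist er j)) (evr (@sxz X Y Z \o Tm)).
  move=> /andP[j0 jK]; have jh : (j.-1./2 < K)%N by lia.
  case: (boolP (odd j)) => oj.
    have -> : j = (Ordinal jh).*2.+1 by rewrite /=; lia.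
    exact: mkSz.
  have -> : j = (Ordinal jh).*2.+2 by rewrite /=; lia.
  exact: mkSx.
pose Q := rQ Tm er P1.
have vQ : valid Q by apply: valid_rQ.
exists (Xhr w0), (Zhr w0), Om, Q; split=> //.
have H1 (B : finType) (f : src X Y Z -> B) j : (j <= 1)%N -> lent (@key X Y Z) Q (psrc pxy pzx) f j
     = Ent P (andr (evr (f \o Tm)) (hist er j)) by apply: lent_rQ1.
have Hj (B : finType) (f : src X Y Z -> B) g j : f =1 g \o (@sxz X Y Z) -> (0 < j <= K.*2.+1)%N ->
    lent (@key X Y Z) Q (psrc pxy pzx) f j = Ent P (andr (evr (f \o Tm)) (hist er j)).
  exact: lent_rQ.
have hist0 w w' : hist er 0 w w' by apply/forallP => -[].
have hist1 w w' : hist er 1 w w' = evr U w w'.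
  by apply/forallP/idP => [/(_ ord0)//|h [[|]]].
split.
- apply: le_trans hRy; rewrite /CMI !H1 //.
  have E (B : finType) (f : Om -> B) : Ent P (andr (evr f) (hist er 0)) = Ent P (evr f).
    by apply: eq_Ent => w w'; rewrite /andr hist0 andbT.
  rewrite !E.
  rewrite (@eq_Ent _ _ P (andr (evr U) (evr Zr)) (andr (evr (@sz X Y Z \o Tm)) (hist er 1))); last first.
    by move=> w w'; rewrite /andr hist1 andbC.
  rewrite (@eq_Ent _ _ P (andr (evr Yr) (evr Zr)) (evr (@syz X Y Z \o Tm))); last first.
    by move=> w w'; rewrite /andr /evr /Tm /syz /sy /sz /= xpair_eqE.
  rewrite (@eq_Ent _ _ P (andr (andr (evr U) (evr Yr)) (evr Zr)) (andr (evr (@syz X Y Z \o Tm)) (hist er 1))); last first.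
    move=> w w'; rewrite /andr hist1 /evr /Tm /syz /sy /sz /= xpair_eqE.
    by case: (U w == _); rewrite ?andbT ?andbF.
  rewrite -[Ent P (evr Zr)]/(Ent P (evr (@sz X Y Z \o Tm))).
  by rewrite le_eqVlt; apply/orP; left; apply/eqP; ring.
- apply: le_trans hRz; rewrite -(telescope_z hp vQ); apply: ler_sum => k _.
  have kK := ltn_ord k; rewrite /CMI.
  rewrite (Hj _ (@sxz X Y Z) id) ?(Hj _ (@sx X Y Z) fst) ?(Hj _ (@sxz X Y Z) id) ?(Hj _ (@sx X Y Z) fst) //; try lia.
  set C := andr (andr (andr (evr Xr) (evr U)) (histr V k)) (histr W k).
  have CE w w' : C w w' = evr Xr w w' && hist er k.*2.+1 w w'.
    by rewrite HIo ?(ltnW kK) // /C /andr -!andbA.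
  have hS w w' : hist er k.*2.+2 w w' = evr (V k) w w' && hist er k.*2.+1 w w'.
    have := HIe k w w' kK; rewrite HIo ?(ltnW kK) // => ->.
    have -> : histr V k.+1 w w' = evr (V k) w w' && histr V k w w'.
      apply/forallP/andP => [h|[h1 /forallP h2] i].
        split; first by have := h k; rewrite ltnSn.
        by apply/forallP => i; apply/implyP => ik; have := h i; rewrite ltnS (ltnW ik).
      apply/implyP; rewrite ltnS leq_eqVlt => /orP[/eqP ik|ik]; last by have := h2 i; rewrite ik.
      by rewrite (val_inj ik).
    by case: (evr (V k) w w'); rewrite /= ?andbF ?andbT.
  rewrite (@eq_Ent _ _ P (andr (evr Zr) C) (andr (evr (@sxz X Y Z \o Tm)) (hist er k.*2.+1))); last first.
    by move=> w w'; rewrite /andr CE /evr /Tm /sxz /= xpair_eqE; case: (Xr w == _); case: (Zr w == _).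
  rewrite (@eq_Ent _ _ P (andr (evr (V k)) C) (andr (evr (@sx X Y Z \o Tm)) (hist er k.*2.+2))); last first.
    by move=> w w'; rewrite /andr CE hS /evr /=; case: (V k w == _); case: (Xr w == _).
  rewrite (@eq_Ent _ _ P (andr (andr (evr Zr) (evr (V k))) C) (andr (evr (@sxz X Y Z \o Tm)) (hist er k.*2.+2))); last first.
    move=> w w'; rewrite /andr CE hS /evr /Tm /sxz /sx /sz /= xpair_eqE.
    by case: (V k w == _); case: (Xr w == _); case: (Zr w == _).
  rewrite (@eq_Ent _ _ P C (andr (evr (@sx X Y Z \o Tm)) (hist er k.*2.+1))) //.
  by rewrite le_eqVlt; apply/orP; left; apply/eqP; ring.
- apply: le_trans hRx; rewrite -(telescope_x hp vQ); apply: ler_sum => k _.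
  have kK := ltn_ord k; rewrite /CMI.
  rewrite (Hj _ (@sxz X Y Z) id) ?(Hj _ (@sz X Y Z) snd) ?(Hj _ (@sxz X Y Z) id) ?(Hj _ (@sz X Y Z) snd) //; try lia.
  set C := andr (andr (andr (evr Zr) (evr U)) (histr V k.+1)) (histr W k).
  have CE w w' : C w w' = evr Zr w w' && hist er k.*2.+2 w w'.
    by rewrite HIe // /C /andr -!andbA.
  have hS w w' : hist er k.*2.+3 w w' = evr (W k) w w' && hist er k.*2.+2 w w'.
    have := HIo k.+1 w w' kK; rewrite HIe // doubleS => ->.
    have -> : histr W k.+1 w w' = evr (W k) w w' && histr W k w w'.
      apply/forallP/andP => [h|[h1 /forallP h2] i].
        split; first by have := h k; rewrite ltnSn.
        by apply/forallP => i; apply/implyP => ik; have := h i; rewrite ltnS (ltnW ik).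
      apply/implyP; rewrite ltnS leq_eqVlt => /orP[/eqP ik|ik]; last by have := h2 i; rewrite ik.
      by rewrite (val_inj ik).
    by case: (evr (W k) w w'); rewrite /= ?andbF ?andbT.
  rewrite (@eq_Ent _ _ P (andr (evr Xr) C) (andr (evr (@sxz X Y Z \o Tm)) (hist er k.*2.+2))); last first.
    by move=> w w'; rewrite /andr CE /evr /Tm /sxz /= xpair_eqE; case: (Xr w == _); case: (Zr w == _).
  rewrite (@eq_Ent _ _ P (andr (evr (W k)) C) (andr (evr (@sz X Y Z \o Tm)) (hist er k.*2.+3))); last first.
    by move=> w w'; rewrite /andr CE hS /evr /=; case: (W k w == _); case: (Zr w == _).
  rewrite (@eq_Ent _ _ P (andr (andr (evr Xr) (evr (W k))) C) (andr (evr (@sxz X Y Z \o Tm)) (hist er k.*2.+3))); last first.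
    move=> w w'; rewrite /andr CE hS /evr /Tm /sxz /sx /sz /= xpair_eqE.
    by case: (W k w == _); case: (Xr w == _); case: (Zr w == _).
  rewrite (@eq_Ent _ _ P C (andr (evr (@sz X Y Z \o Tm)) (hist er k.*2.+2))) //.
  by rewrite le_eqVlt; apply/orP; left; apply/eqP; ring.
- apply: le_trans DX; apply: (@psi_rQ R X Y Z pxy pzx Om P Tm er K.*2.+1 P0 P1 lawT er_equiv mk0 mkS _ _ _
    (@sz X Y Z) (fun t => dx (sx t)) snd (fun b => dx b.1)) => // w1 C.
  (* The estimate depends only on data fixed on the class, so it is constant there and the exchange
     identity of [psi_rQ] is immediate. *)
  have cst w : w \in C -> Xhr w = Xhr w1.
    rewrite inE HIo // => /andP[/and3P[/eqP eU _ /forallP eWW] /eqP z1].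
    by apply: fX => // k; have := eWW k; rewrite ltn_ord /= => /eqP.
  rewrite mulrC /PrE mulr_suml; apply: eq_bigr => w Cw; congr (_ * _).
  by apply: eq_bigr => v Cv; rewrite !cst.
- apply: le_trans DZ; apply: (@psi_rQ R X Y Z pxy pzx Om P Tm er K.*2.+1 P0 P1 lawT er_equiv mk0 mkS _ _ _
    (@sx X Y Z) (fun t => dz (sz t)) fst (fun b => dz b.2)) => // w1 C.
  have cst w : w \in C -> Zhr w = Zhr w1.
    rewrite inE HIo // => /andP[/and3P[/eqP eU /forallP eVV _] /eqP x1].
    by apply: fZ => // k; have := eVV k; rewrite ltn_ord /= => /eqP.
  rewrite mulrC /PrE mulr_suml; apply: eq_bigr => w Cw; congr (_ * _).
  by apply: eq_bigr => v Cv; rewrite !cst.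
Qed.

End RegionToProtocol.

Lemma minf_arg (R : realType) (I : finType) (i0 : I) (F : I -> R) :
  minf i0 F = F [arg min_(i < i0) F i]%O.
Proof.
apply/le_anti; rewrite minf_le /=; apply: minf_ge => i.
by case: arg_minP => // j _; apply.
Qed.

Section Psi.
Variables (R : realType) (X Y Z A : finType).
Notation T := (src X Y Z).
Variables (Q : seq A -> skey X Y Z -> A -> R) (m : T -> R).
Hypotheses (vQ : valid Q) (m0 : forall t, 0 <= m t).
Variables (B I : finType) (i0 : I) (f : T -> B) (c : T -> I -> R).
Notation M := (mu (@key X Y Z) 0 Q m).

Definition best (h : seq A) (b : B) : I :=
  [arg min_(i < i0) (\sum_(t | f t == b) M h t * c t i)]%O.

Lemma psi_best h : psi i0 f c (M h) = \sum_t M h t * c t (best h (f t)).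
Proof.
rewrite [RHS](partition_big f xpredT) //=; apply: eq_bigr => b _.
by rewrite minf_arg -/(best h b); apply: eq_bigr => t /eqP ->.
Qed.

Lemma psi_best_path N (a0 : A) j : (j <= N)%N ->
  \sum_(w : tpath T A N) ppath (@key X Y Z) Q m w * c w.1 (best (pre (lpath a0) j w) (f w.1))
  = lsum j (fun h => psi i0 f c (M h)).
Proof.
move=> jN; rewrite (sum_ppath (@key X Y Z) m a0 vQ (fun t h => c t (best h (f t))) jN).
by apply: eq_lsum => h _; rewrite psi_best.
Qed.

(** A letter spoken by the decoder's own terminal is useless to it: for each value of [f] the kernel
    is a nonnegative factor that comes out of the minimum, and these factors sum to 1. *)
Lemma psi_stage j (g : B -> skey X Y Z) : (forall t, key j t = g (f t)) ->
  lsum j.+1 (fun h => psi i0 f c (M h)) = lsum j (fun h => psi i0 f c (M h)).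
Proof.
move=> kg; rewrite lsum_rcons; apply: eq_lsum => h sh.
rewrite /psi exchange_big; apply: eq_bigr => b _.
rewrite -[RHS]mul1r -(vQ.2 h (g b)) mulr_suml; apply: eq_bigr => a _.
rewrite -minfZ ?vQ.1 //; apply: eq_minf => i; rewrite mulr_sumr; apply: eq_bigr => t /eqP <-.
by rewrite mu_rcons sh add0n kg; ring.
Qed.

End Psi.

Section ProtocolToRegion.
Variables (R : realType) (X Y Z Xh Zh : finType).
Variables (pxy : X -> Y -> R) (pzx : X -> Z -> R).
Variables (dx : X -> Xh -> R) (dz : Z -> Zh -> R) (K : nat).
Hypotheses (hK : (1 <= K)%N) (hp : is_source pxy pzx).

Lemma NF_in_RK (Dx Dz Rx Ry Rz : R) :
  NF pxy pzx dx dz K Dx Dz Rx Ry Rz -> in_RK pxy pzx dx dz K Dx Dz Rx Ry Rz.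
Proof.
case=> x0 [z0 [A [Q [vQ [hRy hRz hRx hDx hDz]]]]].
pose T := src X Y Z; pose N := K.*2.+1; pose p := psrc pxy pzx.
have p0 : forall t, 0 <= p t by apply: psrc_ge0.
have p1 : \sum_t p t = 1 by apply: psrc1.
have [t0 _] : exists t : T, true.
  case: (pickP (fun _ : T => true)) => [t _|no]; first by exists t.
  by exfalso; move: p1; rewrite big_pred0 // => /eqP; rewrite eq_sym oner_eq0.
have [a0 _] : exists a : A, true.
  case: (pickP (fun _ : A => true)) => [a _|no]; first by exists a.
  by exfalso; move: (vQ.2 [::] (key 0 t0)); rewrite big_pred0 // => /eqP; rewrite eq_sym oner_eq0.
pose Om : finType := tpath T A N.
pose P : Om -> R := ppath (@key X Y Z) Q p.
pose pr j : Om -> seq A := pre (lpath a0) j.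
(* A prefix of length at most N, encoded in one finite type. *)
pose cut j (w : Om) : {ffun 'I_N -> option A} :=
  [ffun i : 'I_N => if (i < j)%N then Some (tnth w.2 i) else None].
have prS j w w' : (pr j.+1 w == pr j.+1 w') = (pr j w == pr j w') && (lpath a0 j w == lpath a0 j w').
  by rewrite /pr !pre_rcons eqseq_rcons.
have prW j i w w' : (i <= j)%N -> pr j w == pr j w' -> pr i w == pr i w'.
  by move=> /subnKC <-; elim: (j - i)%N => [|d IH]; rewrite ?addn0 // addnS prS => /andP[/IH].
have prP j w w' : reflect (forall i, (i < j)%N -> lpath a0 i w = lpath a0 i w') (pr j w == pr j w').
  apply: (iffP eqP) => [E i ij|E].
    by have := congr1 (nth a0 ^~ i) E; rewrite /pr /pre !nth_mkseq.
  apply: (@eq_from_nth _ a0); rewrite !size_mkseq // => i ij.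
  by rewrite !nth_mkseq // E.
have cutE j w w' : (j <= N)%N -> (cut j w == cut j w') = (pr j w == pr j w').
  move=> jN; apply/eqP/prP => [E i ij|E].
    have iN := leq_trans ij jN.
    have /ffunP/(_ (Ordinal iN)) := E; rewrite !ffunE /= ij => -[].
    by rewrite !(tnth_nth a0).
  apply/ffunP => i; rewrite !ffunE; case: ifP => // ij.
  by have := E _ ij; rewrite /lpath !(tnth_nth a0) => ->.
pose U (w : Om) : A := lpath a0 0 w.
(* V_k and W_k carry the whole prefix, not just their own letter. The estimate of Z may use only U,
   V^K and X, while the best decoder also needs the earlier letters of user X, which are random even
   given X. The chains allow this, since the past is in the condition. *)
pose V (k : 'I_K) (w : Om) := cut k.*2.+2 w.
pose W (k : 'I_K) (w : Om) := cut k.*2.+3 w.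
have evV k w w' : evr (V k) w w' = evr (pr k.*2.+2) w w'.
  by rewrite /evr /V cutE // /N; have := ltn_ord k; lia.
have evW k w w' : evr (W k) w w' = evr (pr k.*2.+3) w w'.
  by rewrite /evr /W cutE // /N; have := ltn_ord k; lia.
have evU w w' : evr U w w' = evr (pr 1) w w' by rewrite /evr prS (_ : pr 0 w == pr 0 w') //.
have hV n w w' : (n <= K)%N -> histr V n w w' = (n == 0)%N || evr (pr n.*2) w w'.
  case: n => [|n] nK; first by apply/forallP.
  apply/forallP/idP => [/(_ (Ordinal nK))/implyP/(_ (ltnSn n))|h k].
    by rewrite -/(evr (V (Ordinal nK)) w w') evV doubleS.
  by apply/implyP => kn; rewrite -/(evr (V k) w w') evV; apply: prW h; lia.
have hW n w w' : (n <= K)%N -> histr W n w w' = (n == 0)%N || evr (pr n.*2.+1) w w'.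
  case: n => [|n] nK; first by apply/forallP.
  apply/forallP/idP => [/(_ (Ordinal nK))/implyP/(_ (ltnSn n))|h k].
    by rewrite -/(evr (W (Ordinal nK)) w w') evW doubleS.
  by apply/implyP => kn; rewrite -/(evr (W k) w w') evW; apply: prW h; lia.
have ctxV k (e : rel Om) w w' : (k <= K)%N ->
    andr (andr (andr e (evr U)) (histr V k)) (histr W k) w w' = andr e (evr (pr k.*2.+1)) w w'.
  move=> kK; rewrite /andr -!andbA; congr (_ && _); rewrite hV // hW // evU.
  case: k kK => [|k] kK; first by rewrite double0 eqxx !orTb !andbT.
  rewrite (_ : (k.+1 == 0)%N = false) // !orFb.
  case: (boolP (evr (pr k.+1.*2.+1) w w')) => h; rewrite ?andbF // andbT.
  by apply/andP; split; apply: prW h; lia.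
have ctxW k (e : rel Om) w w' : (k < K)%N ->
    andr (andr (andr e (evr U)) (histr V k.+1)) (histr W k) w w' = andr e (evr (pr k.*2.+2)) w w'.
  move=> kK; rewrite /andr -!andbA; congr (_ && _); rewrite hV // hW ?(ltnW kK) // evU.
  rewrite (_ : (k.+1 == 0)%N = false) // orFb doubleS.
  case: (boolP (evr (pr k.*2.+2) w w')) => h; rewrite ?andbF // andTb.
  apply/andP; split; first by apply: prW h; lia.
  by case: k kK h => [|k] kK h; rewrite ?eqxx //; apply/orP; right; apply: prW h; lia.
have P0 w : 0 <= P w by apply: ppath_ge0.
have mkj j : (j < N)%N -> markov P (evr (pr j.+1)) (andr (evr (fun w => key j w.1)) (evr (pr j)))
    (evr (fun w => w.1)) by move=> jN; apply: markov_ppath.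
have LE (B : finType) (f : T -> B) j : (j <= N)%N ->
    lent (@key X Y Z) Q p f j = Ent P (andr (evr (fun w => f w.1)) (evr (pr j))).
  by move=> jN; rewrite /P /pr Ent_ppath.
exists Om, P, (fun w => sx w.1), (fun w => sy w.1), (fun w => sz w.1), A, U, _, _, V, W.
exists (fun w => best Q p x0 (@sz X Y Z) (fun t => dx (sx t)) (pr N w) (sz w.1)).
(* The prefix stops before the last letter, which V^K does not contain. User X draws that letter
   itself, so by [psi_stage] nothing is lost. *)
exists (fun w => best Q p z0 (@sx X Y Z) (fun t => dz (sz t)) (pr K.*2 w) (sx w.1)).
split.
- split; first by split=> //; apply: ppath1.
  move=> x y z; have := @law_ppath R T _ A (@key X Y Z) N Q p a0 vQ [::] (x, y, z) (leq0n _).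
  rewrite /= /p /psrc /= => <-; apply: eq_PrE => w; rewrite andbT.
  by case: w => [[[x' y'] z'] h]; rewrite !xpair_eqE andbA.
- apply: (@markov_coarsen R Om P _ _ (evr (fun w => w.1))); first exact: evr_equiv.
  + by apply: andr_equiv; apply: evr_equiv.
  + by move=> w w' /eqP E; rewrite /andr /evr E !eqxx.
  apply: (@eq_markov _ _ P _ _ _ _ _ _ _ _ _ (mkj 0%N isT)) => [w w'|w w'|//]; first exact: esym (evU w w').
  by rewrite /andr /evr /= /pr /pre /= andbT; apply/eqP/eqP => [[]|->].
- split=> k; have kK := ltn_ord k.
    apply: (@markov_coarsen R Om P _ _ (evr (fun w => w.1))); first exact: evr_equiv.
    + by apply: andr_equiv; apply: evr_equiv.
    + by move=> w w' /eqP E; rewrite /andr /evr E !eqxx.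
    have kN : (k.*2.+1 < N)%N by rewrite /N; lia.
    apply: (@eq_markov _ _ P _ _ _ _ _ _ _ _ _ (mkj _ kN)) => [w w'|w w'|//]; first exact: esym (evV k w w').
    by rewrite ctxV ?(ltnW kK) // /andr; congr (_ && _); rewrite /evr [LHS]ukey_eq odd_double.
  apply: (@markov_coarsen R Om P _ _ (evr (fun w => w.1))); first exact: evr_equiv.
  + by apply: andr_equiv; apply: evr_equiv.
  + by move=> w w' /eqP E; rewrite /andr /evr E !eqxx.
  have kN : (k.*2.+2 < N)%N by rewrite /N; lia.
  apply: (@eq_markov _ _ P _ _ _ _ _ _ _ _ _ (mkj _ kN)) => [w w'|w w'|//]; first exact: esym (evW k w w').
  by rewrite ctxW // /andr; congr (_ && _); rewrite /evr [LHS]ukey_eq /= odd_double.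
(* Here K >= 1 is used: the last V and the last W exist and contain the prefixes that the decoders
   read. *)
- have kl : (K.-1 < K)%N by lia.
  split; split.
  + move=> w w' _ hWW zz; rewrite zz; congr best; apply/eqP.
    have := hWW (Ordinal kl); move/eqP; rewrite -/(evr (W (Ordinal kl)) w w') evW /evr /=.
    by congr (pr _ _ == pr _ _); rewrite /N; lia.
  + move=> w w' _ hVV xx; rewrite xx; congr best; apply/eqP.
    have := hVV (Ordinal kl); move/eqP; rewrite -/(evr (V (Ordinal kl)) w w') evV /evr /=.
    by congr (pr _ _ == pr _ _); rewrite /N; lia.
  + by rewrite (psi_best_path p vQ x0 (@sz X Y Z) (fun t => dx (sx t)) a0 (leqnn N)).
  + rewrite (psi_best_path p vQ z0 (@sx X Y Z) (fun t => dz (sz t)) a0 (leqnSn _)).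
    rewrite -(psi_stage p vQ z0 (fun t => dz (sz t)) (g := fun x => inr x) (j := K.*2)) //.
    by move=> t; rewrite /key; have -> : K.*2 = K.-1.*2.+2 by [lia]; rewrite /= odd_double.
- split.
  + apply: le_trans hRy; rewrite !LE // /CMI.
    have E (B : finType) (f : Om -> B) : Ent P (andr (evr f) (evr (pr 0))) = Ent P (evr f).
      by apply: eq_Ent => w w'; rewrite /andr /evr /pr /pre /= andbT.
    rewrite !E (@eq_Ent _ _ P (andr (evr U) (evr (fun w => sz w.1))) (andr (evr (fun w => sz w.1)) (evr (pr 1)))); last first.
      by move=> w w'; rewrite /andr evU andbC.
    rewrite (@eq_Ent _ _ P (andr (evr (fun w => sy w.1)) (evr (fun w => sz w.1))) (evr (fun w => syz w.1))); last first.
      by move=> w w'; rewrite /andr /evr /syz xpair_eqE.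
    rewrite (@eq_Ent _ _ P (andr (andr (evr U) _) _) (andr (evr (fun w => syz w.1)) (evr (pr 1)))); last first.
      move=> w w'; rewrite /andr evU /evr /syz xpair_eqE.
      by case: (pr 1 w == _); rewrite ?andbT ?andbF.
    by rewrite le_eqVlt; apply/orP; left; apply/eqP; ring.
  + apply: le_trans hRz; rewrite -(telescope_z hp vQ); apply: ler_sum => k _.
    have kK := ltn_ord k; rewrite !LE ?/N; try lia.
    set C := andr _ _.
    have CE w w' : C w w' = evr (fun w => sx w.1) w w' && evr (pr k.*2.+1) w w'.
      by rewrite /C ctxV ?(ltnW kK).
    have hS w w' : evr (pr k.*2.+2) w w' -> evr (pr k.*2.+1) w w' by apply: prW.
    rewrite /CMI.
    rewrite (@eq_Ent _ _ P (andr _ C) (andr (evr (fun w => sxz w.1)) (evr (pr k.*2.+1)))); last first.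
      by move=> w w'; rewrite /andr CE /evr /sxz /= xpair_eqE; case: (sx _ == _); case: (sz _ == _).
    rewrite (@eq_Ent _ _ P (andr (evr (V k)) C) (andr (evr (fun w => sx w.1)) (evr (pr k.*2.+2)))); last first.
      move=> w w'; rewrite /andr CE evV; case: (boolP (evr (pr k.*2.+2) w w')) => [/hS ->|_]; by rewrite ?andbT ?andbF.
    rewrite (@eq_Ent _ _ P (andr (andr _ (evr (V k))) C) (andr (evr (fun w => sxz w.1)) (evr (pr k.*2.+2)))); last first.
      move=> w w'; rewrite /andr CE evV /evr /sxz xpair_eqE -!/(evr _ _ _).
      case: (boolP (evr (pr k.*2.+2) w w')) => [/hS ->|_]; rewrite ?andbT ?andbF //=.
      by rewrite andbC.
    rewrite (@eq_Ent _ _ P C (andr (evr (fun w => sx w.1)) (evr (pr k.*2.+1)))) //.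
    by rewrite le_eqVlt; apply/orP; left; apply/eqP; ring.
  + apply: le_trans hRx; rewrite -(telescope_x hp vQ); apply: ler_sum => k _.
    have kK := ltn_ord k; rewrite !LE ?/N; try lia.
    set C := andr _ _.
    have CE w w' : C w w' = evr (fun w => sz w.1) w w' && evr (pr k.*2.+2) w w'.
      by rewrite /C ctxW.
    have hS w w' : evr (pr k.*2.+3) w w' -> evr (pr k.*2.+2) w w' by apply: prW.
    rewrite /CMI.
    rewrite (@eq_Ent _ _ P (andr _ C) (andr (evr (fun w => sxz w.1)) (evr (pr k.*2.+2)))); last first.
      by move=> w w'; rewrite /andr CE /evr /sxz /= xpair_eqE; case: (sx _ == _); case: (sz _ == _).
    rewrite (@eq_Ent _ _ P (andr (evr (W k)) C) (andr (evr (fun w => sz w.1)) (evr (pr k.*2.+3)))); last first.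
      move=> w w'; rewrite /andr CE evW; case: (boolP (evr (pr k.*2.+3) w w')) => [/hS ->|_]; by rewrite ?andbT ?andbF.
    rewrite (@eq_Ent _ _ P (andr (andr _ (evr (W k))) C) (andr (evr (fun w => sxz w.1)) (evr (pr k.*2.+3)))); last first.
      move=> w w'; rewrite /andr CE evW /evr /sxz xpair_eqE -!/(evr _ _ _).
      by case: (boolP (evr (pr k.*2.+3) w w')) => [/hS ->|_]; rewrite ?andbT ?andbF //=.
    rewrite (@eq_Ent _ _ P C (andr (evr (fun w => sz w.1)) (evr (pr k.*2.+2)))) //.
    by rewrite le_eqVlt; apply/orP; left; apply/eqP; ring.
Qed.

End ProtocolToRegion.

(** * Bounded alphabets and closedness *)

Section Caratheodory.
Variables (R : realType) (A D : finType) (v : A -> D -> R).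

Lemma linear_dependence (B : {set A}) : (#|D| < #|B|)%N ->
  exists c : A -> R, [/\ forall a, a \notin B -> c a = 0, exists a, 0 < c a &
    forall x, \sum_a c a * v a x = 0].
Proof.
move=> DB; pose M := \matrix_(k < #|B|, x < #|D|) v (enum_val k) (enum_val x).
have : kermx M != 0.
  rewrite kermx_eq0 /row_free; apply: contraTneq DB => rk.
  by rewrite -leqNgt -rk rank_leq_col.
case/rowV0Pn => u /sub_kermxP uM u0.
pose c a := \sum_k u 0 k * (enum_val k == a)%:R.
have cB a : a \notin B -> c a = 0.
  move=> aB; apply: big1 => k _; case: eqP => [ka|]; rewrite ?mulr0 //.
  by move: aB; rewrite -ka enum_valP.
have ck k : c (enum_val k) = u 0 k.
  rewrite /c (bigD1 k) //= eqxx mulr1 big1 ?addr0 // => l lk.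
  by rewrite (inj_eq enum_val_inj) (negbTE lk) mulr0.
have cv x : \sum_a c a * v a x = 0.
  transitivity (\sum_k u 0 k * v (enum_val k) x).
    under eq_bigr do rewrite mulr_suml.
    rewrite exchange_big; apply: eq_bigr => k _.
    rewrite (bigD1 (enum_val k)) //= eqxx mulr1 big1 ?addr0 // => a ak.
    by rewrite eq_sym (negbTE ak) mulr0 mul0r.
  have := congr1 (fun N : 'rV_#|D| => N 0 (enum_rank x)) uM; rewrite !mxE => uE.
  by rewrite -[RHS]uE; apply: eq_bigr => k _; rewrite mxE enum_rankK.
have [k uk] : exists k, u 0 k != 0.
  by apply/existsP; apply: contra_neqT u0 => /existsPn h; apply/rowP => k; rewrite mxE; apply/eqP; rewrite -[_ == _]negbK.
case: (ltrgt0P (u 0 k)) => [pk|nk|/eqP]; last by rewrite (negbTE uk).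
  by exists c; split=> //; exists (enum_val k); rewrite ck.
exists (fun a => - c a); split.
- by move=> a /cB ->; rewrite oppr0.
- by exists (enum_val k); rewrite ck oppr_gt0.
- by move=> x; under eq_bigr do rewrite mulNr; rewrite sumrN cv oppr0.
Qed.

Definition fsupp (la : A -> R) : {set A} := [set a | la a != 0].

(** While the support exceeds [#|D|], the weights move along a linear dependence as far as
    nonnegativity permits; the smallest ratio [la a / c a] decides, and that letter leaves the
    support. *)
Lemma conic_caratheodory : exists la : A -> R,
  [/\ forall a, 0 <= la a, (#|fsupp la| <= #|D|)%N &
      forall x, \sum_a la a * v a x = \sum_a v a x].
Proof.
suff H n (la : A -> R) : (forall a, 0 <= la a) -> (#|fsupp la| <= #|D| + n)%N ->
    exists la' : A -> R, [/\ forall a, 0 <= la' a, (#|fsupp la'| <= #|D|)%N &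
      forall x, \sum_a la' a * v a x = \sum_a la a * v a x].
  have [la [l0 lD lE]] := H #|A| (fun=> 1) (fun=> ler01) (leq_trans (max_card _) (leq_addl _ _)).
  by exists la; split=> // x; rewrite lE; apply: eq_bigr => a _; rewrite mul1r.
elim: n la => [|n IH] la l0; first by rewrite addn0 => lD; exists la.
move=> lDn; have [lD|Dl] := leqP #|fsupp la| #|D|; first by exists la.
have [c [cB [a0 ca0] cv]] := linear_dependence Dl.
have [a1 ca1 amin] : exists2 a1, 0 < c a1 & forall a, 0 < c a -> la a1 / c a1 <= la a / c a.
  by case: (@arg_minP _ _ _ a0 (fun a => 0 < c a) (fun a => la a / c a) ca0) => a1 ? ?; exists a1.
pose tau := la a1 / c a1; pose la' a := la a - tau * c a.
have tau0 : 0 <= tau by rewrite divr_ge0 // ltW.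
have [||la'' [l0'' lD'' lE'']] := IH la'.
- move=> a; rewrite subr_ge0; case: (ltP 0 (c a)) => ca; first by rewrite -ler_pdivlMr // amin.
  by rewrite (le_trans _ (l0 a)) // mulr_ge0_le0.
- have a1B : a1 \in fsupp la by apply: contraTT ca1 => /cB ->; rewrite ltxx.
  have sub : fsupp la' \subset fsupp la :\ a1.
    apply/fintype.subsetP => a; rewrite !inE => la'a; apply/andP; split.
      by apply: contraNneq la'a => ->; rewrite /la' /tau divfK ?subrr // gt_eqF.
    apply: contraNneq la'a => laa; have : a \notin fsupp la by rewrite inE negbK laa.
    by rewrite /la' => /cB ->; rewrite laa mulr0 subr0.
  rewrite (leq_trans (subset_leq_card sub)) //.
  by rewrite (cardsD1 a1) a1B add1n addnS ltnS in lDn.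
- exists la''; split=> // x; rewrite lE''.
  under eq_bigr do rewrite mulrBl -mulrA.
  by rewrite sumrB -mulr_sumr cv mulr0 subr0.
Qed.

End Caratheodory.

Section Reduction.
Variables (R : realType) (T S I : finType) (key : nat -> T -> S) (s0 : S).
Variable psi : I -> nat -> (T -> R) -> R.
Hypothesis homog : forall i j (c : R) (m : T -> R), 0 <= c -> (forall t, 0 <= m t) ->
  psi i j (fun t => c * m t) = c * psi i j m.

(** Functional [i] summed over all nodes down to depth [d]. Its dependence on the stage lets it
    count at selected depths only. *)
Fixpoint tot (A : finType) (d j : nat) (Q : seq A -> S -> A -> R) (m : T -> R) (i : I) : R :=
  psi i j m +
  if d is d'.+1 then
    \sum_a tot d' j.+1 (fun h => Q (a :: h)) (fun t => m t * Q [::] (key j t) a) i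
  else 0.

Lemma totE (A : finType) d j (Q : seq A -> S -> A -> R) m i :
  tot d j Q m i = \sum_(e < d.+1) lsum e (fun h => psi i (j + e) (mu key j Q m h)).
Proof.
elim: d j Q m => [|d IH] j Q m; first by rewrite big_ord1 /= addn0 addr0.
rewrite big_ord_recl /= addn0; congr (_ + _).
under eq_bigr do rewrite IH.
by rewrite exchange_big; apply: eq_bigr => e _; apply: eq_bigr => a _; rewrite addSnnS.
Qed.

Lemma totZ (A : finType) d j (Q : seq A -> S -> A -> R) m i c : valid Q -> 0 <= c ->
  (forall t, 0 <= m t) -> tot d j Q (fun t => c * m t) i = c * tot d j Q m i.
Proof.
move=> vQ c0; elim: d j Q vQ m => [|d IH] j Q vQ m m0 /=; first by rewrite homog // !addr0.
rewrite homog // mulrDr mulr_sumr; congr (_ + _); apply: eq_bigr => a _.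
rewrite -IH; last by move=> t; rewrite mulr_ge0 ?vQ.1.
  by congr tot; apply/funext => t; rewrite mulrA.
exact: valid_shift.
Qed.

Let D := #|{: S + I}|.

(** The subtrees are reduced first, then the letters at the root are thinned. The coordinates to
    preserve are the [S] normalizations of the kernel and the [I] totals of the subtrees;
    reweighting a letter scales its subtree's totals by homogeneity. The extra letter in ['I_D.+1]
    keeps the alphabet inhabited, and the bound is the same at every stage and for every [A]. *)
Lemma alphabet_reduction (A : finType) d j (Q : seq A -> S -> A -> R) m :
  valid Q -> (forall t, 0 <= m t) ->
  exists Q' : seq 'I_D.+1 -> S -> 'I_D.+1 -> R,
    valid Q' /\ forall i, tot d j Q' m i = tot d j Q m i.
Proof.
elim: d j Q m => [|d IH] j Q m vQ m0.
  exists (fun _ _ a => (a == ord0)%:R); split; last by [].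
  by split=> [h s a|h s]; rewrite ?ler0n // (bigD1 ord0) //= big1 ?addr0 // => a /negbTE ->.
have [a0 _] : exists a : A, true.
  case: (pickP (fun _ : A => true)) => [a _|no]; first by exists a.
  by exfalso; move: (vQ.2 [::] s0); rewrite big_pred0 // => /eqP; rewrite eq_sym oner_eq0.
pose ma a t := m t * Q [::] (key j t) a.
have ma0 a t : 0 <= ma a t by rewrite mulr_ge0 ?vQ.1.
have /choice[Qc QcP] a := IH j.+1 (fun h => Q (a :: h)) (ma a) (valid_shift a vQ) (ma0 a).
pose v a (x : S + I) := match x with inl s => Q [::] s a | inr i => tot d j.+1 (fun h => Q (a :: h)) (ma a) i end.
have [la [la0 laD laE]] := conic_caratheodory v.
pose s := enum (fsupp la); have sD : (size s <= D)%N by rewrite -cardE.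
have enumE (G : A -> R) : \sum_(i < D.+1) (if (i < size s)%N then la (nth a0 s i) * G (nth a0 s i) else 0)
    = \sum_a la a * G a.
  rewrite -big_mkcond /= -(big_ord_widen D.+1 (fun i => la (nth a0 s i) * G (nth a0 s i))) ?leqW //.
  rewrite -(big_mkord xpredT (fun i => la (nth a0 s i) * G (nth a0 s i))).
  rewrite -(big_nth a0 xpredT (fun a => la a * G a)) big_enum /= big_mkcond.
  by apply: eq_bigr => a _; rewrite inE; case: eqP => [->|//]; rewrite mul0r.
pose Q' (h : seq 'I_D.+1) (u : S) (a : 'I_D.+1) : R :=
  if h is b :: h' then Qc (nth a0 s b) h' u a
  else if (a < size s)%N then la (nth a0 s a) * Q [::] u (nth a0 s a) else 0.
exists Q'; split.
  split=> [[|b h] u a|[|b h] u] /=.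
  - by case: ifP => // _; rewrite mulr_ge0 ?vQ.1.
  - exact: (QcP _).1.1.
  - rewrite (enumE (Q [::] u)); have /= -> := laE (inl u); exact: vQ.2.
  - exact: (QcP _).1.2.
move=> i /=; congr (_ + _); have /= <- := laE (inr i).
rewrite -(enumE (fun a => tot d j.+1 (fun h => Q (a :: h)) (ma a) i)); apply: eq_bigr => a _.
case: ifP => _.
  rewrite -(QcP _).2 -totZ //; last exact: (QcP _).1.
  by congr tot; apply/funext => t; rewrite /ma; ring.
rewrite -[RHS](mul0r (tot d j.+1 (Qc (nth a0 s a)) m i)) -totZ //; last exact: (QcP _).1.
by congr tot; apply/funext => t; rewrite mulr0 mul0r.
Qed.

End Reduction.

(** * Continuity of the functionals and compactness of the set of kernels *)

Section Continuity.
Variables (R : realType) (E : topologicalType).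

Lemma continuous_add (f g : E -> R) : continuous f -> continuous g ->
  continuous (fun e => f e + g e).
Proof. by move=> cf cg e; apply: continuousD; [exact: cf | exact: cg]. Qed.

Lemma continuous_opp (f : E -> R) : continuous f -> continuous (fun e => - f e).
Proof. by move=> cf e; apply: continuousN; exact: cf. Qed.

Lemma continuous_mul (f g : E -> R) : continuous f -> continuous g ->
  continuous (fun e => f e * g e).
Proof. by move=> cf cg e; apply: continuousM; [exact: cf | exact: cg]. Qed.

Lemma continuous_bigsum (J : Type) (r : seq J) (F : J -> E -> R) :
  (forall i, continuous (F i)) -> continuous (fun e => \sum_(i <- r) F i e).
Proof.
move=> cF; elim: r => [|i r IH].
  rewrite (_ : (fun _ => _) = fun=> 0); first exact: cst_continuous.
  by apply/funext => e; rewrite big_nil.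
rewrite (_ : (fun _ => _) = fun e => F i e + \sum_(i <- r) F i e).
  by move=> e; apply: continuousD; [exact: cF | exact: IH].
by apply/funext => e; rewrite big_cons.
Qed.

Lemma continuous_minf (J : finType) (i0 : J) (F : J -> E -> R) :
  (forall i, continuous (F i)) -> continuous (fun e => minf i0 (F ^~ e)).
Proof.
move=> cF; rewrite /minf; elim: (index_enum J) => [|i r IH].
  rewrite (_ : (fun _ => _) = F i0); first exact: cF.
  by apply/funext => e; rewrite big_nil.
rewrite (_ : (fun _ => _) = F i \min (fun e => \big[Num.min/F i0 e]_(i <- r) F i e)).
  by move=> e; apply: continuous_min; [exact: cF | exact: IH].
by apply/funext => e; rewrite big_cons.
Qed.

(** With s the square root of y, y ln y = 2 s^2 ln s, and -ln s <= 1/s. *)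
Lemma xlnx_small (y : R) : 0 < y -> y < 1 -> `|xlnx y| <= 2 * Num.sqrt y.
Proof.
move=> y0 y1; set s := Num.sqrt y.
have s0 : 0 < s by rewrite sqrtr_gt0.
have yE : y = s * s by rewrite -expr2 sqr_sqrtr // ltW.
have l0 : ln y < 0 by rewrite ln_lt0 ?y0.
rewrite /xlnx normrM (gtr0_norm y0) (ltr0_norm l0).
rewrite [in ln y]yE lnM ?posrE // yE.
have : - ln s <= s^-1 by rewrite -lnV ?posrE // ltW // ln_sublinear // invr_gt0.
have ss : s * s^-1 = 1 by rewrite divff // gt_eqF.
move: (ln s) (s^-1) ss => u v ss uv.
have : s * - u <= 1 by rewrite -ss ler_wpM2l // ltW.
nra.
Qed.

Lemma xlnx_continuous : continuous (@xlnx R).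
Proof.
move=> x; case: (ltrgt0P x) => [x0|x0|->].
- by apply: continuousM; [exact: cvg_id | exact: continuous_ln].
- apply: (@near_cst_continuous R R 0); near=> y; rewrite /xlnx ln0 ?mulr0 // ltW //.
  by near: y; exact: lt_nbhsl.
- apply/cvgrPdist_lt => eps eps0 /=; rewrite [xlnx 0]mul0r.
  have d0 : 0 < Num.min 1 (eps ^+ 2 / 4 : R) by rewrite lt_min ltr01 divr_gt0 ?exprn_gt0.
  near=> y; rewrite sub0r normrN.
  have : `|y| < Num.min 1 (eps ^+ 2 / 4).
    by near: y; have := @nbhs0_lt R R _ d0; apply.
  rewrite lt_min => /andP[y1 y2]; case: (leP y 0) => y0.
    by rewrite /xlnx ln0 // mulr0 normr0.
  rewrite gtr0_norm // in y1 y2; apply: le_lt_trans (xlnx_small y0 y1) _.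
  have s0 := sqrtr_ge0 y; have yE : y = Num.sqrt y ^+ 2 by rewrite sqr_sqrtr // ltW.
  rewrite yE in y2; move: (Num.sqrt y) s0 y2 => u u0 y2.
  rewrite ltNge; apply/negP => h; nra.
Unshelve. all: by end_near.
Qed.

End Continuity.

Section Compactness.
Variables (R : realType) (T S I A : finType) (key : nat -> T -> S).
Variable psi : I -> nat -> (T -> R) -> R.
Hypothesis psiC : forall i j (E : topologicalType) (m : E -> T -> R),
  (forall t, continuous (m ^~ t)) -> continuous (fun e => psi i j (m e)).

Lemma tot_continuous (E : topologicalType) d j (Q : E -> seq A -> S -> A -> R) (m : E -> T -> R) i :
  (forall h s a, continuous (fun e => Q e h s a)) -> (forall t, continuous (m ^~ t)) ->
  continuous (fun e => tot key psi d j (Q e) (m e) i).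
Proof.
elim: d j Q m => [|d IH] j Q m cQ cm /= e.
  by apply: continuousD; [exact: psiC | exact: cst_continuous].
apply: continuousD; first exact: psiC.
apply: continuous_bigsum => a; apply: IH => // t.
by move=> e'; apply: continuousM; [exact: cm | exact: cQ].
Qed.

Let J := (seq A * S * A)%type.
Let K : J -> topologicalType := fun=> R.
Let E : topologicalType := prod_topology K.

Lemma coordinate_continuous (x : J) : continuous (fun f : E => (f x : R)).
Proof. exact: (@proj_continuous J K x). Qed.

(** Tychonoff handles the infinitely many histories; each normalization is a closed condition on
    finitely many coordinates. *)
Lemma protocols_compact : compact
  [set f : E | (forall x, 0 <= (f x : R) <= 1) /\ forall h s, \sum_a (f (h, s, a) : R) = 1]%classic.
Proof.
have c1 : compact [set f : E | forall x, (`[0 : R, 1])%classic (f x)]%classic.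
  by apply: (@tychonoff J K (fun=> `[0 : R, 1]%classic)) => x; exact: segment_compact.
have c2 : closed (\bigcap_(hs in [set: seq A * S])
    ((fun f : E => \sum_a (f (hs, a) : R)) @^-1` [set x | x = 1]))%classic.
  apply: closed_bigI => hs _; apply: preimage_closed; last exact: closed_eq.
  by move=> f _; apply: continuous_bigsum => a; exact: coordinate_continuous.
have := compact_closedI c1 c2; congr (compact _).
apply/seteqP; split=> f /= [f01 f1]; split.
- by move=> x; have := f01 x; rewrite /= in_itv.
- by move=> h s; exact: (f1 (h, s)).
- by move=> x; rewrite /= in_itv /=.
- by move=> [h s] _ /=.
Qed.

(** The total excess over the bounds is continuous, has infimum 0, and attains it. *)
Lemma compact_attained N (m : T -> R) (b : I -> R) :
  (forall eps, 0 < eps -> exists Q : seq A -> S -> A -> R,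
     valid Q /\ forall i, tot key psi N 0 Q m i <= b i + eps) ->
  exists Q : seq A -> S -> A -> R, valid Q /\ forall i, tot key psi N 0 Q m i <= b i.
Proof.
move=> H.
pose Qf (f : E) h s a : R := f (h, s, a).
pose G (f : E) : R := \sum_i Num.max 0 (tot key psi N 0 (Qf f) m i - b i).
pose C := [set f : E | (forall x, 0 <= (f x : R) <= 1) /\ forall h s, \sum_a (f (h, s, a) : R) = 1]%classic.
have toC Q : valid Q -> C (fun x => Q x.1.1 x.1.2 x.2).
  case=> Q0 Q1; split=> [[[h s] a] /=|//]; rewrite Q0 -(Q1 h s) (bigD1 a) //= lerDl.
  exact: sumr_ge0.
have C0 : (C !=set0)%classic.
  by have [Q [/toC vQ _]] := H 1 ltr01; eexists; exact: vQ.
have cG : continuous G.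
  apply: continuous_bigsum => i e.
  apply: (@continuous_max _ _ (fun=> 0) (fun f => tot key psi N 0 (Qf f) m i - b i)); first exact: cst_continuous.
  apply: continuousB; last exact: cst_continuous.
  apply: (@tot_continuous E N 0 Qf (fun=> m)) => [h s a|t]; first exact: coordinate_continuous.
  exact: cst_continuous.
have [f] := compact_EVT_min C0 protocols_compact (continuous_subspaceT cG).
rewrite inE => -[f01 f1] fmin.
exists (Qf f); split; first by split=> [h s a|//]; case/andP: (f01 (h, s, a)).
have Gf : G f <= 0.
  apply/ler_addgt0Pl => e e0; rewrite addr0.
  (* Each functional receives an equal share of [e]; the successor avoids a zero denominator. *)
  have e'0 : 0 < e / #|I|.+1%:R by rewrite divr_gt0.
  have [Q [vQ Qb]] := H _ e'0.
  apply: le_trans (fmin _ (mem_set (toC _ vQ))) _; rewrite /G.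
  apply: le_trans (_ : \sum_(i : I) e / #|I|.+1%:R <= _).
    apply: ler_sum => i _; rewrite ge_max (ltW e'0) /= lerBlDl; exact: Qb.
  rewrite sumr_const -[_ *+ _]mulr_natr -mulrA ger_pMr // mulrC ler_pdivrMr // mul1r ler_nat.
  by rewrite leqnSn.
move=> i; rewrite -subr_le0 (le_trans _ Gf) // (le_trans _ (_ : Num.max 0 (tot key psi N 0 (Qf f) m i - b i) <= _)) //.
  by rewrite le_max lexx orbT.
by rewrite /G (bigD1 i) //= lerDl sumr_ge0 // => k _; rewrite le_max lexx.
Qed.

End Compactness.

Section Closedness.
Variables (R : realType) (X Y Z Xh Zh : finType).
Variables (pxy : X -> Y -> R) (pzx : X -> Z -> R).
Variables (dx : X -> Xh -> R) (dz : Z -> Zh -> R) (K : nat).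
Hypothesis (hp : is_source pxy pzx).
Notation T := (src X Y Z).
Notation p := (psrc pxy pzx).
Notation N := (K.*2.+1).

Definition chent (B C : finType) (f : T -> B) (g : T -> C) (m : T -> R) : R := hent f m - hent g m.

Lemma chentZ (B C : finType) (f : T -> B) (g : T -> C) c (m : T -> R) : 0 <= c ->
  (forall t, 0 <= m t) -> chent f g (fun t => c * m t) = c * chent f g m.
Proof. by move=> c0 m0; rewrite /chent !hentZ //; ring. Qed.

Lemma psiZ (B I : finType) (i0 : I) (f : T -> B) (co : T -> I -> R) c (m : T -> R) : 0 <= c ->
  psi i0 f co (fun t => c * m t) = c * psi i0 f co m.
Proof.
move=> c0; rewrite /psi mulr_sumr; apply: eq_bigr => b _; rewrite -minfZ //.
apply: eq_minf => i; rewrite mulr_sumr; apply: eq_bigr => t _; by rewrite mulrA.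
Qed.

Lemma hent_continuous (B : finType) (f : T -> B) (E : topologicalType) (m : E -> T -> R) :
  (forall t, continuous (m ^~ t)) -> continuous (fun e => hent f (m e)).
Proof.
move=> cm e; apply: continuousN; apply: continuous_bigsum => b {}e.
apply: (@continuous_comp _ _ _ (fun e => marg f (m e) b) (@xlnx R)); last exact: xlnx_continuous.
rewrite (_ : (fun _ => _) = fun e => \sum_t (if f t == b then m e t else 0)); last first.
  by apply/funext => e'; rewrite /marg big_mkcond.
by apply: continuous_bigsum => t; case: (f t == b); [exact: cm | exact: cst_continuous].
Qed.

Lemma chent_continuous (B C : finType) (f : T -> B) (g : T -> C) (E : topologicalType) (m : E -> T -> R) :
  (forall t, continuous (m ^~ t)) -> continuous (fun e => chent f g (m e)).
Proof. by move=> cm; apply: continuous_add; [|apply: continuous_opp]; apply: hent_continuous. Qed.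

Lemma psi_continuous (B I : finType) (i0 : I) (f : T -> B) (co : T -> I -> R)
    (E : topologicalType) (m : E -> T -> R) :
  (forall t, continuous (m ^~ t)) -> continuous (fun e => psi i0 f co (m e)).
Proof.
move=> cm; apply: continuous_bigsum => b; apply: continuous_minf => i.
rewrite (_ : (fun _ => _) = fun e => \sum_t (if f t == b then m e t * co t i else 0)); last first.
  by apply/funext => e'; rewrite big_mkcond.
apply: continuous_bigsum => t; case: (f t == b); last exact: cst_continuous.
by apply: continuous_mul; [exact: cm | exact: cst_continuous].
Qed.

Variables (x0 : Xh) (z0 : Zh).

(** Indices 0 to 4 stand for Ry, Rz, Rx, Dx, Dz. [F1] collects what is evaluated after the first
    letter and [FN] what is evaluated after the last. *)
Definition F1 (i : 'I_5) : (T -> R) -> R :=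
  nth (fun=> 0) [:: (fun m => - chent (@syz X Y Z) (@sz X Y Z) m);
    chent (@sxz X Y Z) (@sx X Y Z); chent (@sxz X Y Z) (@sz X Y Z)] i.
Definition FN (i : 'I_5) : (T -> R) -> R :=
  nth (fun=> 0) [:: fun=> 0; (fun m => - chent (@sxz X Y Z) (@sx X Y Z) m);
    (fun m => - chent (@sxz X Y Z) (@sz X Y Z) m); psi_x dx x0; psi_z dz z0] i.
Definition Fj (i : 'I_5) (j : nat) (m : T -> R) : R := (j == 1)%:R * F1 i m + (j == N)%:R * FN i m.

(** The term H(Y|Z) of the helper's rate involves no letter, so it moves to the bound. *)
Definition bounds (Dx Dz Rx Ry Rz : R) (i : 'I_5) : R :=
  nth 0 [:: Ry - chent (@syz X Y Z) (@sz X Y Z) p; Rz; Rx; Dx; Dz] i.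

Lemma F1Z i c m : 0 <= c -> (forall t, 0 <= m t) -> F1 i (fun t => c * m t) = c * F1 i m.
Proof.
move=> c0 m0; case: i => -[|[|[|[|[|]]]]] //= ilt; rewrite /F1 /= ?chentZ //; by rewrite ?mulr0 ?mulrN.
Qed.

Lemma FNZ i c m : 0 <= c -> (forall t, 0 <= m t) -> FN i (fun t => c * m t) = c * FN i m.
Proof.
move=> c0 m0; case: i => -[|[|[|[|[|]]]]] //= ilt; rewrite /FN /= ?chentZ ?mulr0 ?mulrN //; exact: psiZ.
Qed.

Lemma F1C i (E : topologicalType) (m : E -> T -> R) :
  (forall t, continuous (m ^~ t)) -> continuous (fun e => F1 i (m e)).
Proof.
move=> cm; case: i => -[|[|[|[|[|]]]]] //= ilt; rewrite /F1 /=; try exact: cst_continuous; try exact: chent_continuous.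
by apply: continuous_opp; exact: chent_continuous.
Qed.

Lemma FNC i (E : topologicalType) (m : E -> T -> R) :
  (forall t, continuous (m ^~ t)) -> continuous (fun e => FN i (m e)).
Proof.
move=> cm; case: i => -[|[|[|[|[|]]]]] //= ilt; rewrite /FN /=; try exact: cst_continuous; try exact: psi_continuous.
  by apply: continuous_opp; exact: chent_continuous.
by apply: continuous_opp; exact: chent_continuous.
Qed.

Lemma tot_Fj (A : finType) (Q : seq A -> skey X Y Z -> A -> R) i :
  tot (@key X Y Z) Fj N 0 Q p i
  = lsum 1 (fun h => F1 i (mu (@key X Y Z) 0 Q p h)) + lsum N (fun h => FN i (mu (@key X Y Z) 0 Q p h)).
Proof.
rewrite totE /Fj; under eq_bigr do rewrite lsumD !lsumZ add0n.
have pick (k : nat) (G : nat -> R) : (k < N.+1)%N -> \sum_(e < N.+1) (val e == k)%:R * G e = G k.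
  move=> kN; rewrite (bigD1 (Ordinal kN)) //= eqxx mul1r big1 ?addr0 // => e.
  by rewrite -val_eqE /= => /negbTE ->; rewrite mul0r.
rewrite big_split /= (pick 1 (fun e => lsum e _)) // (pick N (fun e => lsum e _)) //.
Qed.

Lemma regionE (A : finType) (Q : seq A -> skey X Y Z -> A -> R) Dx Dz Rx Ry Rz :
  region pxy pzx dx dz K x0 z0 Q Dx Dz Rx Ry Rz <->
  forall i, tot (@key X Y Z) Fj N 0 Q p i <= bounds Dx Dz Rx Ry Rz i.
Proof.
have L (B C : finType) (f : T -> B) (g : T -> C) j :
    lsum j (fun h => chent f g (mu (@key X Y Z) 0 Q p h))
    = lent (@key X Y Z) Q p f j - lent (@key X Y Z) Q p g j by rewrite lsumB.
have z j : lsum j (fun _ : seq A => 0 : R) = 0 by exact: lsum0.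
pose M := mu (@key X Y Z) 0 Q p.
have E1 : (lsum 1 (fun h => - chent (@syz X Y Z) (@sz X Y Z) (M h)) + lsum N (fun _ : seq A => 0 : R)
     <= Ry - chent (@syz X Y Z) (@sz X Y Z) p) =
   (lent (@key X Y Z) Q p (@syz X Y Z) 0 - lent (@key X Y Z) Q p (@sz X Y Z) 0
    - (lent (@key X Y Z) Q p (@syz X Y Z) 1 - lent (@key X Y Z) Q p (@sz X Y Z) 1) <= Ry).
  by rewrite z lsumN L addr0 lerBrDr addrC.
have E2 (B : finType) (f : T -> B) (r : R) :
   (lsum 1 (fun h => chent (@sxz X Y Z) f (M h)) + lsum N (fun h => - chent (@sxz X Y Z) f (M h)) <= r) =
   (lent (@key X Y Z) Q p (@sxz X Y Z) 1 - lent (@key X Y Z) Q p f 1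
    - (lent (@key X Y Z) Q p (@sxz X Y Z) N - lent (@key X Y Z) Q p f N) <= r).
  by rewrite lsumN !L.
have E3 (G : (T -> R) -> R) (r : R) :
   (lsum 1 (fun _ : seq A => 0) + lsum N (fun h => G (M h)) <= r) = (lsum N (fun h => G (M h)) <= r).
  by rewrite z add0r.
split=> [[h1 h2 h3 h4 h5] i|H].
  rewrite tot_Fj; case: i => -[|[|[|[|[|//]]]]] ilt.
  - by rewrite -E1 in h1.
  - by rewrite -E2 in h2.
  - by rewrite -E2 in h3.
  - by rewrite -E3 in h4.
  - by rewrite -E3 in h5.
have Hi k (kl : (k < 5)%N) := H (Ordinal kl); split.
- by rewrite -E1; have := Hi 0%N isT; rewrite tot_Fj.
- by rewrite -E2; have := Hi 1%N isT; rewrite tot_Fj.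
- by rewrite -E2; have := Hi 2%N isT; rewrite tot_Fj.
- by rewrite -E3; have := Hi 3%N isT; rewrite tot_Fj.
- by rewrite -E3; have := Hi 4%N isT; rewrite tot_Fj.
Qed.

End Closedness.

Section NFClosed.
Variables (R : realType) (X Y Z Xh Zh : finType).
Variables (pxy : X -> Y -> R) (pzx : X -> Z -> R).
Variables (dx : X -> Xh -> R) (dz : Z -> Zh -> R) (K : nat).
Hypothesis (hp : is_source pxy pzx).

Lemma minf_default (I : finType) (i0 i1 : I) (F : I -> R) : minf i0 F = minf i1 F.
Proof. by apply/le_anti/andP; split; apply: minf_ge => i; apply: minf_le. Qed.

Lemma NF_closed (Dx Dz Rx Ry Rz : R) :
  (forall eps, 0 < eps -> NF pxy pzx dx dz K (Dx + eps) (Dz + eps) (Rx + eps) (Ry + eps) (Rz + eps)) ->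
  NF pxy pzx dx dz K Dx Dz Rx Ry Rz.
Proof.
move=> H; have [x0 [z0 _]] := H 1 ltr01.
have [t0 _] : exists t : src X Y Z, true.
  case: (pickP (fun _ : src X Y Z => true)) => [t _|no]; first by exists t.
  by exfalso; move: (psrc1 hp); rewrite big_pred0 // => /eqP; rewrite eq_sym oner_eq0.
have homog i j c (m : src X Y Z -> R) : 0 <= c -> (forall t, 0 <= m t) ->
    Fj dx dz K x0 z0 i j (fun t => c * m t) = c * Fj dx dz K x0 z0 i j m.
  by move=> c0 m0; rewrite /Fj F1Z // FNZ //; ring.
have FC i j (E : topologicalType) (m : E -> src X Y Z -> R) :
    (forall t, continuous (m ^~ t)) -> continuous (fun e => Fj dx dz K x0 z0 i j (m e)).
  move=> cm; apply: continuous_add; apply: continuous_mul; try exact: cst_continuous.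
    exact: F1C.
  exact: FNC.
have [|Q [vQ QP]] := compact_attained (A := 'I_#|{: skey X Y Z + 'I_5}|.+1) (key := @key X Y Z) FC (N := K.*2.+1)
  (m := psrc pxy pzx) (b := bounds pxy pzx Dx Dz Rx Ry Rz); last first.
  by exists x0, z0, _, Q; split=> //; apply/regionE.
move=> eps eps0; have [x1 [z1 [A [Q [vQ /regionE hQ]]]]] := H _ eps0.
have [Q' [vQ' QE]] := alphabet_reduction (@key X Y Z) (key 0 t0) homog K.*2.+1 0 vQ (psrc_ge0 hp).
exists Q'; split=> // i; rewrite QE.
(* The witnesses of inhabited reconstruction alphabets may vary with [eps]; [minf] does not depend
   on them. *)
have -> : tot (@key X Y Z) (Fj dx dz K x0 z0) K.*2.+1 0 Q (psrc pxy pzx) i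
   = tot (@key X Y Z) (Fj dx dz K x1 z1) K.*2.+1 0 Q (psrc pxy pzx) i.
  rewrite !tot_Fj; congr (_ + _); case: i => -[|[|[|[|[|//]]]]] ilt //; apply: eq_lsum => h _.
    by apply: eq_bigr => b _; exact: minf_default.
  by apply: eq_bigr => b _; exact: minf_default.
have := hQ i; move/le_trans; apply; case: i => -[|[|[|[|[|//]]]]] ilt; rewrite /bounds /=; lra.
Qed.

End NFClosed.

(** * Converse *)

Section ConditioningReduces.
Variables (R : realType) (Om : finType) (P : Om -> R).
Hypotheses (P0 : forall w, 0 <= P w) (P1 : \sum_w P w = 1).

Lemma Ent_cond_le (e big small : rel Om) :
  equivalence_rel e -> equivalence_rel big -> equivalence_rel small ->
  (forall w w', big w w' -> small w w') ->
  Ent P (andr e big) + Ent P small <= Ent P (andr e small) + Ent P big.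
Proof.
move=> ee eb es bs; have := Ent_submod P0 ee eb es.
rewrite (@eq_Ent _ _ P (andr (andr e big) small) (andr e big)); last first.
  by move=> w w'; rewrite /andr; case: (boolP (big w w')) => [/bs ->|]; rewrite ?andbT ?andbF.
rewrite (@eq_Ent _ _ P (andr big small) big) // => w w'.
by rewrite /andr; case: (boolP (big w w')) => [/bs ->|]; rewrite ?andbT ?andbF.
Qed.

Lemma Ent_true : Ent P (fun _ _ => true) = 0.
Proof. by rewrite /Ent; under eq_bigr do rewrite /PrE P1 ln1 mulr0; rewrite big1 ?oppr0. Qed.

Lemma Ent_subadd (e f : rel Om) : equivalence_rel e -> equivalence_rel f ->
  Ent P (andr e f) <= Ent P e + Ent P f.
Proof.
move=> ee ef; have := @Ent_cond_le e f (fun _ _ => true) ee ef.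
rewrite Ent_true addr0 (@eq_Ent _ _ P (andr e (fun _ _ => true)) e); last by move=> w w'; rewrite /andr andbT.
by apply.
Qed.

End ConditioningReduces.

(** * Entropy inequalities from block messages to single letters *)

Section SingleLetterization.
Variables (R : realType) (X Y Z : finType) (n : nat).
Notation T := (src X Y Z).
Variable p : T -> R.
Hypotheses (p0 : forall t, 0 <= p t) (p1 : \sum_t p t = 1).

Definition sub (a b c : bool) : rel T := fun t t' =>
  [&& a ==> (sx t == sx t'), b ==> (sy t == sy t') & c ==> (sz t == sz t')].

Lemma sub_equiv a b c : equivalence_rel (sub a b c).
Proof.
move=> x y z; rewrite /sub; split; first by rewrite !eqxx !implybT.
by case/and3P; case: a => /= [/eqP->|_]; case: b => /= [/eqP->|_]; case: c => /= [/eqP->|_].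
Qed.

Lemma sub_or a b c a' b' c' t t' :
  sub a b c t t' && sub a' b' c' t t' = sub (a || a') (b || b') (c || c') t t'.
Proof.
rewrite /sub; case: (_ == _); case: (_ == _); case: (_ == _); by case: a; case: a'; case: b; case: b'; case: c; case: c'.
Qed.

Notation h a b c := (Ent p (sub a b c)).

Hypothesis hM : h true true true + h true false false = h true true false + h true false true.

Implicit Types (a b c : nat -> bool).
Notation Om := (n.-tuple T).
Notation P := (prodm (n := n) p).

(* Agreement of two source blocks on the coordinates of X, Y, Z selected by [a], [b], [c]. *)
Definition agree (a b c : nat -> bool) : rel Om :=
  crel (fun j : 'I_n => sub (a j) (b j) (c j)).

Lemma agree_equiv a b c : equivalence_rel (agree a b c).
Proof. by apply: crel_equiv => i; apply: sub_equiv. Qed.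

Lemma agree_or a b c a' b' c' w w' :
  agree a b c w w' && agree a' b' c' w w'
  = agree (fun j => a j || a' j) (fun j => b j || b' j) (fun j => c j || c' j) w w'.
Proof.
have := andr_crel (fun j : 'I_n => sub (a j) (b j) (c j)) (fun j : 'I_n => sub (a' j) (b' j) (c' j)) w w'.
rewrite /agree {1}/andr => ->; apply: eq_forallb => j; exact: sub_or.
Qed.

Lemma eq_agree a b c a' b' c' : (forall j, (j < n)%N -> [/\ a j = a' j, b j = b' j & c j = c' j]) ->
  agree a b c =2 agree a' b' c'.
Proof. by move=> E w w'; apply: eq_forallb => j; have [-> -> ->] := E j (ltn_ord j). Qed.

Lemma agree_sub a b c a' b' c' w w' :
  (forall j, (j < n)%N -> [/\ a' j -> a j, b' j -> b j & c' j -> c j]) ->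
  agree a b c w w' -> agree a' b' c' w w'.
Proof.
move=> E /forallP H; apply/forallP => j; have [Ea Eb Ec] := E j (ltn_ord j).
have /and3P[/implyP ha /implyP hb /implyP hc] := H j.
by apply/and3P; split; apply/implyP => k; [apply: ha; apply: Ea|apply: hb; apply: Eb|apply: hc; apply: Ec].
Qed.

Lemma Ent_agree a b c : Ent P (agree a b c) = \sum_(j < n) h (a j) (b j) (c j).
Proof. by rewrite /agree Ent_crel // => i x; apply: eqrel_refl; apply: sub_equiv. Qed.

Let P0 w : 0 <= P w. Proof. exact: prodm_ge0. Qed.
Let P1 : \sum_w P w = 1. Proof. exact: sum_prodm. Qed.

Variables (D1 D2 D3 D4 : eqType) (ty : Om -> D1) (tr : Om -> D2) (tz : Om -> D3) (tx : Om -> D4).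

Notation all := (fun _ : nat => true).
Notation none := (fun _ : nat => false).
Hypothesis ty_Y : forall w w', agree none all none w w' -> ty w = ty w'.
Hypothesis tr_z : forall w w', tz w = tz w' -> ty w = ty w' -> agree all none none w w' -> tr w = tr w'.
Hypothesis tr_x : forall w w', tx w = tx w' -> ty w = ty w' -> agree none none all w w' -> tr w = tr w'.

Definition eT a b c : R := Ent P (andr (evr ty) (agree a b c)).
Definition eM a b c : R := Ent P (andr (andr (evr ty) (evr tr)) (agree a b c)).

Let ety : equivalence_rel (evr ty) := @evr_equiv _ _ ty.
Let etm : equivalence_rel (andr (evr ty) (evr tr)) := andr_equiv ety (@evr_equiv _ _ tr).

(** Conditioning reduces entropy: both sides are conditional entropies of the coordinates [a b c],
    and the condition on the left determines the one on the right. *)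
Lemma cond_agree (q q' : rel Om) a b c a1 b1 c1 a2 b2 c2 :
  equivalence_rel q -> equivalence_rel q' ->
  (forall w w', q w w' -> agree a1 b1 c1 w w' -> q' w w') ->
  (forall j, (j < n)%N -> [/\ a2 j -> a1 j, b2 j -> b1 j & c2 j -> c1 j]) ->
  Ent P (andr q (agree (fun j => a j || a1 j) (fun j => b j || b1 j) (fun j => c j || c1 j)))
    - Ent P (andr q (agree a1 b1 c1))
  <= Ent P (andr q' (agree (fun j => a j || a2 j) (fun j => b j || b2 j) (fun j => c j || c2 j)))
    - Ent P (andr q' (agree a2 b2 c2)).
Proof.
move=> eq eq' qq' E.
have H (r : rel Om) a3 b3 c3 : Ent P (andr r (agree (fun j => a j || a3 j) (fun j => b j || b3 j) (fun j => c j || c3 j)))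
   = Ent P (andr (agree a b c) (andr r (agree a3 b3 c3))).
  by apply: eq_Ent => w w'; rewrite /andr -agree_or; case: (r w w'); rewrite ?andbF.
rewrite !H lerBlDr addrAC lerBrDr; apply: Ent_cond_le => //.
- exact: agree_equiv.
- by apply: andr_equiv => //; apply: agree_equiv.
- by apply: andr_equiv => //; apply: agree_equiv.
- move=> w w' /andP[qw aw]; apply/andP; split; first exact: qq' qw aw.
  exact: agree_sub E aw.
Qed.

Lemma eq_eT a b c a' b' c' : (forall j, (j < n)%N -> [/\ a j = a' j, b j = b' j & c j = c' j]) ->
  eT a b c = eT a' b' c'.
Proof. by move=> /eq_agree E; apply: eq_Ent => w w'; rewrite /andr E. Qed.

Lemma eq_eM a b c a' b' c' : (forall j, (j < n)%N -> [/\ a j = a' j, b j = b' j & c j = c' j]) ->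
  eM a b c = eM a' b' c'.
Proof. by move=> /eq_agree E; apply: eq_Ent => w w'; rewrite /andr E. Qed.

Let ff (q : Prop) : false -> q. Proof. by []. Qed.
Let q1 : rel Om := fun _ _ => true.
Let eq1 : equivalence_rel q1. Proof. by []. Qed.

Lemma Ent_q1 a b c : Ent P (andr q1 (agree a b c)) = \sum_(j < n) h (a j) (b j) (c j).
Proof. by rewrite -Ent_agree; apply: eq_Ent. Qed.

(** The target is H(Y^n | T_y, Z^n) >= nH(Y|Z) - H(T_y). In its chain rule the term of Y_i has the
    condition (T_y, Y^{i-1}, Z^n). Given this, X^{i-1} is independent of Y_i by memorylessness, so
    X^{i-1} may be added at no cost; then Y^{i-1} and Z^{i-1} are dropped. *)
Lemma single_letter_y :
  \sum_(i < n) ((h false true true - h false false true)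
     - (eT (fun j => j < i)%N (fun j => j == i)%N (fun j => i <= j)%N
        - eT (fun j => j < i)%N none (fun j => i <= j)%N)) <= Ent P (evr ty).
Proof.
have step (i : 'I_n) : eT none (fun j => j < i.+1)%N all - eT none (fun j => j < i)%N all
    <= eT (fun j => j < i)%N (fun j => j == i)%N (fun j => i <= j)%N
        - eT (fun j => j < i)%N none (fun j => i <= j)%N.
  have s1 := @cond_agree (evr ty) (evr ty) none (fun j => j == i)%N none (fun j => j < i)%N (fun j => j < i)%N all
    (fun j => j < i)%N none (fun j => i <= j)%N ety ety (fun _ _ q _ => q) (fun _ _ => And3 id (ff _) (fun _ => isT)).
  (* [s2], [s3] and [e1] sandwich H(X^{i-1} | T_y, Y^i, Z^n) and its analogue with Y^{i-1}: the
     value given all of Y^n, Z^n equals the value given only Y^{i-1}, Z^n. *)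
  have s2 := @cond_agree q1 (evr ty) (fun j => j < i)%N none none none all all
    none (fun j => j < i.+1)%N all eq1 ety (fun w w' _ ag => introT eqP (ty_Y (agree_sub (fun _ _ => And3 id id (fun _ => isT)) ag)))
    (fun _ _ => And3 id (fun _ => isT) id).
  have s3 := @cond_agree (evr ty) q1 (fun j => j < i)%N none none none (fun j => j < i)%N all
    none (fun j => j < i)%N all ety eq1 (fun _ _ _ _ => isT) (fun _ _ => And3 id id id).
  rewrite !Ent_q1 -!/(eT _ _ _) -!sumrB in s1 s2 s3.
  have e1 : \sum_(j < n) (h ((j < i)%N || false) (false || true) (false || true) - h false true true)
     = \sum_(j < n) (h ((j < i)%N || false) (false || (j < i)%N) (false || true) - h false (j < i)%N true).
    by apply: eq_bigr => j _; case: (j < i)%N => //=; ring.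
  rewrite (@eq_eT _ _ _ (fun j => j < i)%N (fun j => j < i.+1)%N (all)%N) in s1; last first.
    by move=> j _; split=> //=; lia.
  rewrite [X in _ <= X - _](@eq_eT _ _ _ (fun j => j < i)%N (fun j => j == i)%N (fun j => i <= j)%N) in s1; last first.
    by move=> j _; split=> //=; rewrite orbF.
  rewrite [X in _ <= X - _](@eq_eT _ _ _ (fun j => j < i)%N (fun j => j < i.+1)%N (all)%N) in s2; last first.
    by move=> j _; split=> //=; rewrite orbF.
  rewrite [X in X - _ <= _](@eq_eT _ _ _ (fun j => j < i)%N (fun j => j < i)%N (all)%N) in s3; last first.
    by move=> j _; split=> //=; rewrite orbF.
  lra.
apply: le_trans (_ : \sum_(i < n) ((h false true true - h false false true)
     - (eT none (fun j => j < i.+1)%N all - eT none (fun j => j < i)%N all)) <= _).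
  by apply: ler_sum => i _; rewrite lerD2l lerN2.
rewrite sumrB -(big_mkord xpredT (fun i => eT none (fun j => j < i.+1)%N all - eT none (fun j => j < i)%N all)).
rewrite telescope_sumr //.
have eN : eT none (fun j => j < n)%N all = \sum_(j < n) h false true true.
  rewrite -(Ent_agree none all all); apply: eq_Ent => w w'; rewrite /andr.
  rewrite (@eq_agree none (fun j => j < n)%N all none all all); last by move=> j ->.
  case: (boolP (agree none all all w w')) => [a|_]; rewrite ?andbF // andbT; apply/eqP; apply: ty_Y.
  by apply: agree_sub a => j _; split.
have e0 : eT none (fun j => j < 0)%N all <= Ent P (evr ty) + \sum_(j < n) h false false true.
  rewrite -(Ent_agree none none all).
  rewrite (@eq_eT _ _ _ none none all); last by move=> j _; split.
  by apply: Ent_subadd => //; apply: agree_equiv.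
by rewrite eN sumrB; lra.
Qed.

(** The i-th term is at most H(Z|X) - H(Z_i | T_y, transcript, X^n, Z_{i+1}^n), and these telescope.
    By the chain Y - X - Z, nH(Z|X) is H(Z^n | X^n, Y^n), hence at most H(Z^n | T_y, X^n). What
    remains is I(Z^n; transcript | T_y, X^n), and given T_y and X^n the messages of user Z determine
    the transcript. *)
Lemma single_letter_z :
  \sum_(i < n) ((eT (fun j => j <= i)%N none (fun j => i <= j)%N - eT (fun j => j <= i)%N none (fun j => i < j)%N)
     - (eM (fun j => j <= i)%N none (fun j => i <= j)%N - eM (fun j => j <= i)%N none (fun j => i < j)%N))
  <= Ent P (evr tz).
Proof.
have step (i : 'I_n) : (eT (fun j => j <= i)%N none (fun j => i <= j)%N - eT (fun j => j <= i)%N none (fun j => i < j)%N)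
     - (eM (fun j => j <= i)%N none (fun j => i <= j)%N - eM (fun j => j <= i)%N none (fun j => i < j)%N)
   <= (h true false true - h true false false) - (eM all none (fun j => i <= j)%N - eM all none (fun j => i < j)%N).
  have s1 := @cond_agree (evr ty) q1 none none (fun j => j == i)%N (fun j => j <= i)%N none (fun j => i < j)%N
    (fun j => j == i)%N none none ety eq1 (fun _ _ _ _ => isT).
  have {}s1 := s1 (fun j _ => And3 (fun e : (j == i)%N => eq_leq (elimT eqP e)) id (ff _)).
  have s2 := @cond_agree (andr (evr ty) (evr tr)) (andr (evr ty) (evr tr)) none none (fun j => j == i)%N all none (fun j => i < j)%N
    (fun j => j <= i)%N none (fun j => i < j)%N etm etm (fun _ _ q _ => q) (fun _ _ => And3 (fun _ => isT) id id).
  rewrite !Ent_q1 -!/(eT _ _ _) -!sumrB in s1.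
  rewrite -!/(eM _ _ _) in s2.
  have e1 : \sum_(j < n) (h (false || (j == i :> nat)) (false || false) ((j == i :> nat) || false) - h (j == i :> nat) false false)
     = h true false true - h true false false.
    rewrite (bigD1 i) //= eqxx big1 ?addr0 // => j ji.
    by rewrite val_eqE (negbTE ji) subrr.
  rewrite e1 in s1.
  have dis j : (j == i :> nat) || (i < j)%N = (i <= j)%N by lia.
  rewrite (@eq_eT _ _ _ (fun j => j <= i)%N (none)%N (fun j => i <= j)%N) in s1; last first.
    by move=> j _; split=> //=.
  rewrite (@eq_eM _ _ _ (all)%N (none)%N (fun j => i <= j)%N) in s2; last first.
    by move=> j _; split=> //=.
  rewrite [X in _ <= X - _](@eq_eM _ _ _ (fun j => j <= i)%N (none)%N (fun j => i <= j)%N) in s2; last first.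
    by move=> j _; split=> //=.
  lra.
apply: le_trans (ler_sum _ (fun i _ => step i)) _.
rewrite sumrB -(big_mkord xpredT (fun i => eM all none (fun j => i <= j)%N - eM all none (fun j => i < j)%N)).
have tele : \sum_(0 <= i < n) (eM all none (fun j => i <= j)%N - eM all none (fun j => i < j)%N)
   = eM all none all - eM all none none.
  rewrite -[LHS]opprK -sumrN; under eq_bigr do rewrite opprB.
  rewrite (telescope_sumr (fun i => eM all none (fun j => i <= j)%N)) // opprB.
  congr (_ - _); apply: eq_eM => j jn; split=> //; by rewrite leqNgt jn.
rewrite tele sumr_const card_ord.
have m1 : eT all none all <= eM all none all.
  apply: (Ent_le P0) => [w|w w' /andP[/andP[q _] a]]; last by rewrite /andr q.
  by apply: eqrel_refl; apply: andr_equiv => //; apply: agree_equiv.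
have m2 : eM all none none <= Ent P (evr tz) + eT all none none.
  apply: le_trans (_ : Ent P (andr (evr tz) (andr (evr ty) (agree all none none))) <= _); last first.
    by apply: Ent_subadd => //; [apply: evr_equiv|apply: andr_equiv => //; apply: agree_equiv].
  apply: (Ent_le P0) => [w|w w' /andP[/eqP z /andP[/eqP y a]]].
    by apply: eqrel_refl; apply: andr_equiv; [apply: evr_equiv|apply: andr_equiv => //; apply: agree_equiv].
  by rewrite /andr a /evr y (tr_z z y a) !eqxx.
have s3 := @cond_agree q1 (evr ty) none none all all all none all none none eq1 ety
  (fun w w' _ ag => introT eqP (ty_Y (agree_sub (fun _ _ => And3 (ff _) id id) ag)))
  (fun _ _ => And3 id (ff _) id).
rewrite !Ent_q1 -!/(eT _ _ _) !sumr_const card_ord in s3.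
have e3 : (h (false || true) (false || true) (true || false)) *+ n - (h true true false) *+ n
    = (h true false true - h true false false) *+ n.
  by rewrite -mulrnBl; congr (_ *+ n); move: hM => /=; lra.
rewrite e3 (@eq_eT _ _ _ (all)%N (none)%N (all)%N) in s3; last by [].
lra.
Qed.

(** Given (T_y, X^{i-1}, Z_i^n), the past Z^{i-1} is independent of X_i, because Z^{i-1} depends on
    everything else only through X^{i-1}. So Z^{i-1} may be added to the condition of the first
    entropy for free, and to that of the second by conditioning. Both sums then telescope with the
    condition Z^n. *)
Lemma single_letter_x :
  \sum_(i < n) ((eT (fun j => j <= i)%N none (fun j => i <= j)%N - eT (fun j => j < i)%N none (fun j => i <= j)%N)
     - (eM (fun j => j <= i)%N none (fun j => i <= j)%N - eM (fun j => j < i)%N none (fun j => i <= j)%N))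
  <= Ent P (evr tx).
Proof.
have step (i : 'I_n) : (eT (fun j => j <= i)%N none (fun j => i <= j)%N - eT (fun j => j < i)%N none (fun j => i <= j)%N)
     - (eM (fun j => j <= i)%N none (fun j => i <= j)%N - eM (fun j => j < i)%N none (fun j => i <= j)%N)
   <= (eT (fun j => j < i.+1)%N none all - eT (fun j => j < i)%N none all)
    - (eM (fun j => j < i.+1)%N none all - eM (fun j => j < i)%N none all).
  have s1 := @cond_agree (evr ty) q1 none none (fun j => j < i)%N (fun j => j < i)%N none (fun j => i <= j)%N
    (fun j => j < i)%N none none ety eq1 (fun _ _ _ _ => isT) (fun _ _ => And3 id id (ff _)).
  have s2 := @cond_agree q1 (evr ty) none none (fun j => j < i)%N all all (fun j => i <= j)%N
    (fun j => j <= i)%N none (fun j => i <= j)%N eq1 ety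
    (fun w w' _ ag => introT eqP (ty_Y (agree_sub (fun _ _ => And3 (ff _) id (ff _)) ag)))
    (fun _ _ => And3 (fun _ => isT) (ff _) id).
  have s3 := @cond_agree (andr (evr ty) (evr tr)) (andr (evr ty) (evr tr)) (fun j => j == i)%N none none (fun j => j < i)%N none all
    (fun j => j < i)%N none (fun j => i <= j)%N etm etm (fun _ _ q _ => q) (fun _ _ => And3 id id (fun _ => isT)).
  rewrite !Ent_q1 -!/(eT _ _ _) -!sumrB in s1 s2; rewrite -!/(eM _ _ _) in s3.
  have e1 : \sum_(j < n) (h (false || (j < i)%N) (false || false) ((j < i)%N || false) - h (j < i)%N false false)
    = \sum_(j < n) (h (false || true) (false || true) ((j < i)%N || (i <= j)%N) - h true true (i <= j)%N).
    by apply: eq_bigr => j _; case: ltnP => //= _; rewrite ?subrr //; move: hM; lra.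
  have dis j : (j < i)%N || (i <= j)%N by case: ltnP.
  have dis2 j : (j == i :> nat) || (j < i)%N = (j <= i)%N by lia.
  rewrite (@eq_eT _ _ _ (fun j => j < i)%N (none)%N (all)%N) in s1; last first.
    by move=> j _; split=> //=; rewrite dis.
  rewrite [X in _ <= X - _](@eq_eT _ _ _ (fun j => j < i.+1)%N (none)%N (all)%N) in s2; last first.
    by move=> j _; split=> //=; rewrite dis.
  rewrite [X in X - _ <= _](@eq_eM _ _ _ (fun j => j < i.+1)%N (none)%N (all)%N) in s3; last first.
    by move=> j _; split=> //=; rewrite dis2.
  rewrite [X in _ <= X - _](@eq_eM _ _ _ (fun j => j <= i)%N (none)%N (fun j => i <= j)%N) in s3; last first.
    by move=> j _; split=> //=; rewrite dis2.
  lra.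
apply: le_trans (ler_sum _ (fun i _ => step i)) _.
rewrite sumrB -(big_mkord xpredT (fun i => eT (fun j => j < i.+1)%N none all - eT (fun j => j < i)%N none all)).
rewrite -(big_mkord xpredT (fun i => eM (fun j => j < i.+1)%N none all - eM (fun j => j < i)%N none all)).
rewrite !telescope_sumr //.
rewrite (@eq_eT (fun j => j < n)%N none all all none all) => [|j ->//].
rewrite (@eq_eM (fun j => j < n)%N none all all none all) => [|j ->//].
rewrite (@eq_eT (fun j => j < 0)%N none all none none all) => [|j _//].
rewrite (@eq_eM (fun j => j < 0)%N none all none none all) => [|j _//].
have m1 : eT all none all <= eM all none all.
  apply: (Ent_le P0) => [w|w w' /andP[/andP[q _] a]]; last by rewrite /andr q.
  by apply: eqrel_refl; apply: andr_equiv => //; apply: agree_equiv.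
have m2 : eM none none all <= Ent P (evr tx) + eT none none all.
  apply: le_trans (_ : Ent P (andr (evr tx) (andr (evr ty) (agree none none all))) <= _); last first.
    by apply: Ent_subadd => //; [apply: evr_equiv|apply: andr_equiv => //; apply: agree_equiv].
  apply: (Ent_le P0) => [w|w w' /andP[/eqP z /andP[/eqP y a]]].
    by apply: eqrel_refl; apply: andr_equiv; [apply: evr_equiv|apply: andr_equiv => //; apply: agree_equiv].
  by rewrite /andr a /evr y (tr_x z y a) !eqxx.
lra.
Qed.

End SingleLetterization.

(** * Exchanging the Z-parts of two blocks *)

Section Blocks.
Variables (R : realType) (X Y Z : finType) (n : nat).
Notation T := (src X Y Z).
Implicit Type w : n.-tuple T.

Definition xs w : n.-tuple X := map_tuple (@sx X Y Z) w.
Definition ys w : n.-tuple Y := map_tuple (@sy X Y Z) w.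
Definition zs w : n.-tuple Z := map_tuple (@sz X Y Z) w.

Lemma sum_blocks (F : n.-tuple X -> n.-tuple Y -> n.-tuple Z -> R) :
  \sum_xn \sum_yn \sum_zn F xn yn zn = \sum_w F (xs w) (ys w) (zs w).
Proof.
rewrite pair_big pair_big /= (reindex (fun w => (xs w, ys w, zs w))) //.
exists (fun q : n.-tuple X * n.-tuple Y * n.-tuple Z =>
  [tuple (tnth q.1.1 i, tnth q.1.2 i, tnth q.2 i) | i < n]) => [w _|[[xn yn] zn] _] /=.
  apply: eq_from_tnth => i; rewrite tnth_mktuple !tnth_map /sx /sy /sz.
  by case: (tnth w i) => [[]].
by congr (_, _, _); apply: eq_from_tnth => i; rewrite tnth_map tnth_mktuple.
Qed.

Lemma ptuple_prodm (pxy : X -> Y -> R) (pzx : X -> Z -> R) w :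
  ptuple pxy pzx (xs w) (ys w) (zs w) = prodm (psrc pxy pzx) w.
Proof. by apply: eq_bigr => i _; rewrite !tnth_map. Qed.

Definition mix w w' : n.-tuple T :=
  [tuple (sx (tnth w j), sy (tnth w j), sz (tnth w' j)) | j < n].

Lemma xs_mix w w' : xs (mix w w') = xs w.
Proof. by apply: eq_from_tnth => j; rewrite tnth_map tnth_mktuple tnth_map. Qed.

Lemma ys_mix w w' : ys (mix w w') = ys w.
Proof. by apply: eq_from_tnth => j; rewrite tnth_map tnth_mktuple tnth_map. Qed.

Lemma zs_mix w w' : zs (mix w w') = zs w'.
Proof. by apply: eq_from_tnth => j; rewrite tnth_map tnth_mktuple tnth_map. Qed.

Lemma mixK w w' : mix (mix w w') (mix w' w) = w.
Proof.
apply: eq_from_tnth => j; rewrite !tnth_mktuple /sx /sy /sz /=.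
by case: (tnth w j) => [[]].
Qed.

Definition compat w w' := forall j,
  sx (tnth w j) = sx (tnth w' j) \/ sz (tnth w j) = sz (tnth w' j).

Variables (pxy : X -> Y -> R) (pzx : X -> Z -> R).
Notation P := (prodm (n := n) (psrc pxy pzx)).

(** At a coordinate with equal Z nothing changes; with equal X the two factors p(z|x) trade
    places. *)
Lemma prodm_mix w w' : compat w w' -> P (mix w w') * P (mix w' w) = P w * P w'.
Proof.
move=> cp; rewrite /prodm -!big_split /=; apply: eq_bigr => j _.
rewrite !tnth_mktuple /psrc /=; case: (cp j) => ->; ring.
Qed.

Variable C : pred (n.-tuple T).
Hypothesis C_compat : forall w w', C w -> C w' -> compat w w'.
Hypothesis C_mix : forall w w', C w -> C w' -> C (mix w w').

(* Exchanging the Z-blocks of two independent copies of the source preserves the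
   product measure on [C * C]; this replaces the conditional independence of the two
   users' remaining data given the transcript. *)
Lemma sum_mix (G : n.-tuple T -> n.-tuple T -> R) :
  \sum_(w | C w) \sum_(w' | C w') P w * P w' * G w w'
  = \sum_(w | C w) \sum_(w' | C w') P w * P w' * G (mix w w') (mix w' w).
Proof.
rewrite !pair_big /= (reindex (fun q => (mix q.1 q.2, mix q.2 q.1))) /=; last first.
  by exists (fun q => (mix q.1 q.2, mix q.2 q.1)) => -[w w'] _ /=; rewrite !mixK.
apply: eq_big => [[w w']|[w w']] /=.
  apply/andP/andP => -[c1 c2]; last by split; apply: C_mix.
  by have := C_mix c1 c2; have := C_mix c2 c1; rewrite !mixK.
case/andP => c1 c2; rewrite prodm_mix //.
by have := C_compat (C_mix c1 c2) (C_mix c2 c1); rewrite !mixK.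
Qed.

(** After the exchange the summand depends on one block only, and the other contributes the mass of
    [C]. *)
Lemma mix_diag (g : n.-tuple T -> n.-tuple T -> R) :
  (forall w w', C w -> C w' -> g (mix w w') (mix w' w) = g w w)
  \/ (forall w w', C w -> C w' -> g (mix w w') (mix w' w) = g w' w') ->
  (\sum_(w | C w) P w * g w w) * PrE P C = \sum_(w | C w) \sum_(w' | C w') P w * P w' * g w w'.
Proof.
rewrite sum_mix; case=> gg.
  rewrite mulr_suml; apply: eq_bigr => w Cw; rewrite /PrE mulr_sumr; apply: eq_bigr => w' Cw'.
  by rewrite gg //; ring.
rewrite [RHS]exchange_big mulr_suml; apply: eq_bigr => w' Cw'.
rewrite /PrE mulr_sumr; apply: eq_bigr => w Cw; by rewrite gg //; ring.
Qed.

Lemma mix_indep (a c : pred (n.-tuple T)) :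
  (forall w w', C w -> C w' -> c (mix w w') && a (mix w' w) = c w && a w)
  \/ (forall w w', C w -> C w' -> c (mix w w') && a (mix w' w) = c w' && a w') ->
  PrE P (fun w => [&& a w, C w & c w]) * PrE P C
  = PrE P (fun w => a w && C w) * PrE P (fun w => C w && c w).
Proof.
move=> H; have := @mix_diag (fun w w' => (c w && a w')%:R).
have E1 : \sum_(w | C w) P w * (c w && a w)%:R = PrE P (fun w => [&& a w, C w & c w]).
  rewrite /PrE big_mkcond [RHS]big_mkcond; apply: eq_bigr => w _.
  by case: (C w); case: (a w); case: (c w); rewrite /= ?mulr1 ?mulr0.
have E2 : \sum_(w | C w) \sum_(w' | C w') P w * P w' * (c w && a w')%:R
   = PrE P (fun w => a w && C w) * PrE P (fun w => C w && c w).
  rewrite mulrC /PrE [X in _ = X * _]big_mkcond mulr_suml [LHS]big_mkcond; apply: eq_bigr => w _.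
  case: (C w); rewrite ?mul0r //= mulr_sumr [RHS]big_mkcond [LHS]big_mkcond; apply: eq_bigr => w' _.
  by case: (C w'); case: (a w'); case: (c w); rewrite /= ?mulr1 ?mulr0 ?mul0r.
rewrite E1 E2 => ->//; case: H => H; [left|right] => w w' Cw Cw'; by rewrite H.
Qed.

End Blocks.

Section SwapCoordinate.
Variables (R : realType) (T : finType) (n : nat) (p : T -> R).
Hypothesis p1 : \sum_x p x = 1.

Definition setc (i : 'I_n) (w w' : n.-tuple T) : n.-tuple T :=
  [tuple if j == i then tnth w' j else tnth w j | j < n].

Lemma setcK i w w' : setc i (setc i w w') (setc i w' w) = w.
Proof. by apply: eq_from_tnth => j; rewrite !tnth_mktuple; case: eqP. Qed.

Lemma prodm_setc i w w' : prodm p (setc i w w') * prodm p (setc i w' w) = prodm p w * prodm p w'.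
Proof.
rewrite /prodm -!big_split /=; apply: eq_bigr => j _; rewrite !tnth_mktuple.
by case: eqP => _ //; rewrite mulrC.
Qed.

(** Conditional independence given [f] at coordinate [i]: two independent blocks swap that
    coordinate, which preserves their joint weight, and preserves [E] when the [f]-values agree. *)
Lemma indep_coord (i : 'I_n) (D : finType) (f : T -> D) (E : pred (n.-tuple T)) (d : D) (t : T) :
  f t = d ->
  (forall w w', f (tnth w i) = f (tnth w' i) -> E (setc i w w') = E w) ->
  PrE (prodm (n := n) p) (fun w => E w && (tnth w i == t)) * marg f p d
  = PrE (prodm (n := n) p) (fun w => E w && (f (tnth w i) == d)) * p t.
Proof.
move=> ft HE.
have m1 : marg f p d = PrE (prodm (n := n) p) (fun w => f (tnth w i) == d).
  rewrite /marg /PrE big_mkcond [RHS]big_mkcond /=.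
  have := sum_prodm_coord p1 i (fun x => (f x == d)%:R) => E1.
  transitivity (\sum_x p x * (f x == d)%:R).
    by apply: eq_bigr => x _; case: eqP; rewrite ?mulr1 ?mulr0.
  by rewrite -E1; apply: eq_bigr => w _; case: eqP; rewrite ?mulr1 ?mulr0.
have m2 : p t = PrE (prodm (n := n) p) (fun w => tnth w i == t).
  transitivity (\sum_x p x * (x == t)%:R).
    by rewrite (bigD1 t) //= eqxx mulr1 big1 ?addr0 // => x /negbTE ->; rewrite mulr0.
  rewrite -(sum_prodm_coord p1 i (fun x => (x == t)%:R)) /PrE [RHS]big_mkcond.
  by apply: eq_bigr => w _; case: eqP; rewrite ?mulr1 ?mulr0.
rewrite m1 m2 /PrE.
have D2 (C1 C2 : pred (n.-tuple T)) : (\sum_(w | C1 w) prodm p w) * (\sum_(w | C2 w) prodm p w)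
   = \sum_q (if C1 q.1 && C2 q.2 then prodm p q.1 * prodm p q.2 else 0).
  rewrite -[RHS](pair_big xpredT xpredT (fun w w' => if C1 w && C2 w' then prodm p w * prodm p w' else 0)) /=.
  rewrite big_mkcond mulr_suml; apply: eq_bigr => w _; rewrite big_mkcond mulr_sumr; apply: eq_bigr => w' _.
  by case: (C1 w); case: (C2 w'); rewrite /= ?mul0r ?mulr0.
rewrite !D2 (reindex (fun q => (setc i q.1 q.2, setc i q.2 q.1))) /=; last first.
  by exists (fun q => (setc i q.1 q.2, setc i q.2 q.1)) => -[w w'] _ /=; rewrite !setcK.
apply: eq_bigr => -[w w'] _ /=; rewrite prodm_setc !tnth_mktuple eqxx.
case: (tnth w' i =P t) => [tw|_]; rewrite ?andbF // !andbT.
case: (f (tnth w i) =P d) => [fd|_]; rewrite ?andbF // !andbT.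
by rewrite HE // fd tw.
Qed.

End SwapCoordinate.

Section OneLetter.
Variables (R : realType) (X Y Z : finType).
Variables (pxy : X -> Y -> R) (pzx : X -> Z -> R).
Hypothesis hp : is_source pxy pzx.
Notation T := (src X Y Z).
Notation p := (psrc pxy pzx).

Lemma Ent_evr (D : finType) (f : T -> D) : Ent p (evr f) = hent f p.
Proof.
rewrite hentE; congr (- _); apply: eq_bigr => t _; congr (_ * ln _).
by apply: eq_bigl => u; rewrite /evr eq_sym.
Qed.

Lemma Ent_markov_source :
  Ent p (@sub X Y Z true true true) + Ent p (@sub X Y Z true false false)
  = Ent p (@sub X Y Z true true false) + Ent p (@sub X Y Z true false true).
Proof.
have [q0 [_ [r0 r1]]] := hp.
pose px x := \sum_y pxy x y.
have E111 t : PrE p (@sub X Y Z true true true t) = pxy (sx t) (sy t) * pzx (sx t) (sz t).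
  rewrite /PrE (big_pred1 t) // => u; rewrite /sub /= eq_sym.
  by case: t => [[a b] c]; case: u => [[a' b'] c']; rewrite !xpair_eqE /sx /sy /sz /= andbA eq_sym [b' == _]eq_sym [c' == _]eq_sym.
have S3 (F : X -> Y -> Z -> R) : \sum_(t : T) F (sx t) (sy t) (sz t) = \sum_x \sum_y \sum_z F x y z.
  by rewrite pair_big pair_big.
have PE (D : rel T) t : PrE p (D t) = \sum_x \sum_y \sum_z (if D t (x, y, z) then pxy x y * pzx x z else 0).
  by rewrite -S3 /PrE big_mkcond; apply: eq_bigr => -[[]].
have E110 t : PrE p (@sub X Y Z true true false t) = pxy (sx t) (sy t).
  rewrite PE (bigD1 (sx t)) //= (bigD1 (sy t)) //= [X in _ + X + _]big1 ?[X in _ + X]big1 ?addr0.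
  - under eq_bigr do rewrite /sub /= !eqxx /=.
    by rewrite -mulr_sumr r1 mulr1.
  - move=> x xn; apply: big1 => y _; apply: big1 => z _.
    by rewrite /sub /= /sx /= eq_sym (negbTE xn).
  - by move=> y yn; apply: big1 => z _; rewrite /sub /= /sy /= [sy t == y]eq_sym (negbTE yn) andbF.
have E101 t : PrE p (@sub X Y Z true false true t) = px (sx t) * pzx (sx t) (sz t).
  rewrite PE (bigD1 (sx t)) //= [X in _ + X]big1 ?addr0 => [|x xn].
    rewrite /px mulr_suml; apply: eq_bigr => y _; rewrite (bigD1 (sz t)) //= /sub /= !eqxx /= big1 ?addr0 // => z zn.
    by rewrite /sz /= [sz t == z]eq_sym (negbTE zn).
  apply: big1 => y _; apply: big1 => z _; by rewrite /sub /= /sx /= eq_sym (negbTE xn).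
have E100 t : PrE p (@sub X Y Z true false false t) = px (sx t).
  rewrite PE (bigD1 (sx t)) //= [X in _ + X]big1 ?addr0 => [|x xn].
    apply: eq_bigr => y _; under eq_bigr do rewrite /sub /= !eqxx /=.
    by rewrite -mulr_sumr r1 mulr1.
  apply: big1 => y _; apply: big1 => z _; by rewrite /sub /= /sx /= eq_sym (negbTE xn).
rewrite /Ent -!opprD -!big_split /=; congr (- _); apply: eq_bigr => t _.
rewrite E111 E110 E101 E100 -!mulrDr.
have := psrc_ge0 hp t; rewrite le0r => /orP[/eqP->|pt]; first by rewrite !mul0r.
congr (_ * _); rewrite /psrc in pt.
have a0 : 0 < pxy (sx t) (sy t).
  by rewrite lt0r q0 andbT; apply: contraTneq pt => ->; rewrite mul0r ltxx.
have b0 : 0 < pzx (sx t) (sz t).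
  by rewrite lt0r r0 andbT; apply: contraTneq pt => ->; rewrite mulr0 ltxx.
have c0 : 0 < px (sx t) by rewrite /px (bigD1 (sy t)) //= ltr_wpDr // sumr_ge0.
by rewrite !lnM ?posrE //; ring.
Qed.

End OneLetter.

Lemma histS (Om : finType) (e : nat -> rel Om) j w w' :
  hist e j.+1 w w' = hist e j w w' && e j w w'.
Proof.
apply/forallP/andP => [h|[/forallP h1 h2] i].
  by split; [apply/forallP => i; apply: (h (widen_ord (leqnSn j) i)) | apply: (h ord_max)].
have := ltn_ord i; rewrite ltnS leq_eqVlt => /orP[/eqP->//|ij].
exact: (h1 (Ordinal ij)).
Qed.

Lemma sum_pair (R : realType) (A B : finType) (F : A * B -> R) :
  \sum_v F v = \sum_a \sum_b F (a, b).
Proof. by rewrite pair_bigA; apply: eq_bigr => -[]. Qed.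

(** * A uniformly chosen coordinate *)

Section TimeSharing.
Variables (R : realType) (Om : finType) (P : Om -> R) (n : nat).
Hypotheses (n0 : (0 < n)%N) (P0 : forall w, 0 <= P w) (P1 : \sum_w P w = 1).

Definition tsm (v : 'I_n * Om) : R := n%:R^-1 * P v.2.

Lemma tsm_ge0 v : 0 <= tsm v. Proof. by rewrite mulr_ge0 // invr_ge0. Qed.

Lemma sum_tsm (F : 'I_n * Om -> R) : \sum_v tsm v * F v = n%:R^-1 * \sum_i \sum_w P w * F (i, w).
Proof.
rewrite mulr_sumr sum_pair.
by apply: eq_bigr => i _; rewrite mulr_sumr; apply: eq_bigr => w _; rewrite /tsm mulrA.
Qed.

Let nn0 : (n%:R : R) != 0. Proof. by rewrite pnatr_eq0 -lt0n. Qed.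

Lemma tsm1 : \sum_v tsm v = 1.
Proof.
transitivity (\sum_v tsm v * 1); first by apply: eq_bigr => v _; rewrite mulr1.
rewrite sum_tsm; under eq_bigr => i _ do under eq_bigr do rewrite mulr1.
under eq_bigr do rewrite P1.
by rewrite sumr_const card_ord mulVf.
Qed.

Lemma sum_slice (i : 'I_n) (E : pred ('I_n * Om)) (F : 'I_n * Om -> R) :
  (forall v, E v -> v.1 == i) -> \sum_(v | E v) F v = \sum_(w | E (i, w)) F (i, w).
Proof.
move=> Ei; rewrite big_mkcond sum_pair.
rewrite (bigD1 i) //= [X in _ + X]big1 ?addr0 -?big_mkcond // => k ki.
by apply: big1 => w _; case: ifP => // /Ei /=; rewrite (negbTE ki).
Qed.

Lemma PrE_slice (i : 'I_n) (E : pred ('I_n * Om)) :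
  (forall v, E v -> v.1 == i) -> PrE tsm E = n%:R^-1 * PrE P (fun w => E (i, w)).
Proof. by move=> Ei; rewrite /PrE (sum_slice _ Ei) mulr_sumr. Qed.

Definition tsr (e : 'I_n -> rel Om) : rel ('I_n * Om) :=
  fun v v' => (v.1 == v'.1) && e v.1 v.2 v'.2.

Lemma tsr_equiv e : (forall i, equivalence_rel (e i)) -> equivalence_rel (tsr e).
Proof.
move=> ee v v' u; split; first by rewrite /tsr eqxx (eqrel_refl (ee _)).
by case/andP=> /eqP E h; rewrite /tsr -E (eqrel_left _ (ee _) h).
Qed.

(** The term [ln n%:R] is the entropy of the index; it cancels in every rate, a difference of such
    entropies. *)
Lemma Ent_tsr (e : 'I_n -> rel Om) : (forall i w, e i w w) ->
  Ent tsm (tsr e) = ln n%:R + n%:R^-1 * \sum_i Ent P (e i).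
Proof.
move=> cer; suff key : \sum_v tsm v * ln (PrE tsm (tsr e v))
    = n%:R^-1 * (\sum_i \sum_w P w * ln (PrE P (e i w))) - ln n%:R.
  by rewrite /Ent key sumrN mulrN opprB.
have lnE : ln n%:R = n%:R^-1 * \sum_(i < n) (ln n%:R : R).
  by rewrite sumr_const card_ord -[X in _ * X]mulr_natl mulKf.
rewrite sum_tsm [X in _ - X]lnE -mulrBr -sumrB; congr (_ * _); apply: eq_bigr => i _.
have -> : ln n%:R = \sum_w P w * ln n%:R :> R by rewrite -mulr_suml P1 mul1r.
rewrite -sumrB; apply: eq_bigr => w _.
rewrite (@PrE_slice i) => [|v /andP[/eqP/= -> _]//].
rewrite (@eq_PrE _ _ P _ (e i w)); last by move=> w'; rewrite /tsr /= eqxx.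
have := P0 w; rewrite le0r => /orP[/eqP->|Pw]; first by rewrite !mul0r subrr.
rewrite lnM ?posrE ?invr_gt0 ?ltr0n //; last exact: PrE_gt0 (cer i w) Pw.
by rewrite lnV ?posrE ?ltr0n //; ring.
Qed.

End TimeSharing.

(** * The variables of a block code and their Markov chains *)

Section Converse.
Variables (R : realType) (X Y Z Xh Zh : finType).
Variables (pxy : X -> Y -> R) (pzx : X -> Z -> R).
Variables (dx : X -> Xh -> R) (dz : Z -> Zh -> R) (K n : nat).
Hypotheses (hK : (1 <= K)%N) (hp : is_source pxy pzx) (n0 : (0 < n)%N).
Notation T := (src X Y Z).
Notation p := (psrc pxy pzx).
Notation Om := (n.-tuple T).
Notation P := (prodm (n := n) p).

Variables (fy : n.-tuple Y -> nat)
  (fz : nat -> n.-tuple Z -> nat -> seq nat -> nat)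
  (fx : nat -> n.-tuple X -> nat -> seq nat -> nat)
  (gx : n.-tuple X -> nat -> seq nat -> n.-tuple Zh)
  (gz : n.-tuple Z -> nat -> seq nat -> n.-tuple Xh).

Definition cty (w : Om) : nat := fy (ys w).
Definition ms (k : nat) (w : Om) : seq nat * seq nat := msgs fz fx (xs w) (zs w) (cty w) k.
Definition zmsg (k : nat) (w : Om) : nat := fz k (zs w) (cty w) (ms k w).1.
Definition xmsg (k : nat) (w : Om) : nat := fx k (xs w) (cty w) (rcons (ms k w).2 (zmsg k w)).

Lemma msS k w : ms k.+1 w = (rcons (ms k w).1 (xmsg k w), rcons (ms k w).2 (zmsg k w)).
Proof. by rewrite /xmsg /zmsg /ms /=; case: msgs. Qed.

Lemma msS_eq k w w' : (ms k.+1 w == ms k.+1 w')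
  = [&& ms k w == ms k w', zmsg k w == zmsg k w' & xmsg k w == xmsg k w'].
Proof.
rewrite !msS xpair_eqE !eqseq_rcons.
case: (ms k w) (ms k w') => [a b] [a' b'] /=; rewrite xpair_eqE.
by case: (a == a'); case: (b == b'); case: (xmsg k w == _); case: (zmsg k w == _).
Qed.

(** Rectangle property of interaction: each message sees only one user's block, T_y and earlier
    messages, so blocks with a common T_y and transcript can be recombined. *)
Lemma ms_mix k w w' : cty w = cty w' -> ms k w = ms k w' -> ms k (mix w w') = ms k w.
Proof.
move=> tt; have tm : cty (mix w w') = cty w by rewrite /cty ys_mix.
elim: k => [//|k IH] /eqP; rewrite msS_eq => /and3P[/eqP mk /eqP zk /eqP xk].
have mm := IH mk.
have zz : zmsg k (mix w w') = zmsg k w by rewrite zk /zmsg zs_mix tm tt mm mk.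
by rewrite !msS mm zz {1}/xmsg xs_mix tm mm zz.
Qed.

Lemma zmsg_mix k w w' : cty w = cty w' -> ms k w = ms k w' -> zmsg k (mix w w') = zmsg k w'.
Proof. by move=> tt mk; rewrite /zmsg zs_mix (ms_mix tt mk) mk /cty ys_mix -/(cty w) tt. Qed.

Lemma xmsg_mix k w w' : cty w = cty w' -> ms k w = ms k w' -> zmsg k w = zmsg k w' ->
  xmsg k (mix w w') = xmsg k w.
Proof.
by move=> tt mk zk; rewrite /xmsg xs_mix (zmsg_mix tt mk) (ms_mix tt mk) zk /cty ys_mix.
Qed.

(** Fixing the past of X and the future of Z makes two blocks compatible at every coordinate except
    [i], where the observation of a user completes [compat]. *)
Definition eU (i : 'I_n) : rel Om :=
  andr (evr cty) (agree (fun j => j < i)%N (fun=> false) (fun j => i < j)%N).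

Lemma eU_equiv i : equivalence_rel (eU i).
Proof. by apply: andr_equiv; [apply: evr_equiv | apply: agree_equiv]. Qed.

Lemma eUP (i : 'I_n) w w' : reflect [/\ cty w = cty w', forall j : 'I_n, (j < i)%N -> sx (tnth w j) = sx (tnth w' j)
   & forall j : 'I_n, (i < j)%N -> sz (tnth w j) = sz (tnth w' j)] (eU i w w').
Proof.
apply: (iffP andP) => [[/eqP tt /forallP ag]|[tt hx hz]].
  split=> // j ji; have /and3P[/implyP h1 _ /implyP h3] := ag j; first by apply/eqP; apply: h1.
  by apply/eqP; apply: h3.
split; first exact/eqP.
by apply/forallP => j; apply/and3P; split=> //; apply/implyP => ji; apply/eqP; [apply: hx | apply: hz].
Qed.

Lemma eU_mix i w0 w w' : eU i w0 w -> eU i w0 w' -> eU i w0 (mix w w').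
Proof.
move=> /eUP[t1 x1 z1] /eUP[t2 x2 z2]; apply/eUP; split.
- by rewrite t1 /cty ys_mix.
- by move=> j ji; rewrite tnth_mktuple x1.
- by move=> j ji; rewrite tnth_mktuple z2.
Qed.

Lemma eU_compat i w0 w w' : eU i w0 w -> eU i w0 w' ->
  sx (tnth w i) = sx (tnth w' i) \/ sz (tnth w i) = sz (tnth w' i) -> compat w w'.
Proof.
move=> /eUP[t1 x1 z1] /eUP[t2 x2 z2] ci j.
case: (ltngtP j i) => ji; last by rewrite (val_inj ji).
  by left; rewrite -x1 // x2.
by right; rewrite -z1 // z2.
Qed.

Definition cer (j : nat) : rel ('I_n * Om) :=
  if j is j'.+1 then (fun v v' => if odd j' then xmsg j'./2 v.2 == xmsg j'./2 v'.2
                                  else zmsg j'./2 v.2 == zmsg j'./2 v'.2)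
  else tsr eU.

Lemma er_equiv j : equivalence_rel (cer j).
Proof.
case: j => [|j]; first by apply: tsr_equiv; apply: eU_equiv.
by rewrite /cer; case: (odd j); [apply: (evr_equiv (fun v : 'I_n * Om => xmsg j./2 v.2))
  | apply: (evr_equiv (fun v : 'I_n * Om => zmsg j./2 v.2))].
Qed.

Lemma hist_o k v v' : hist cer k.*2.+1 v v' = tsr eU v v' && (ms k v.2 == ms k v'.2).
Proof.
elim: k => [|k IH]; first by rewrite double0 histS andbT (_ : hist cer 0 v v') //; apply/forallP => -[].
rewrite doubleS histS histS IH msS_eq /cer /= odd_double /= doubleK uphalf_double.
by rewrite -!andbA.
Qed.

Lemma hist_e k v v' : hist cer k.*2.+2 v v'
  = [&& tsr eU v v', ms k v.2 == ms k v'.2 & zmsg k v.2 == zmsg k v'.2].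
Proof. by rewrite histS hist_o /cer /= odd_double doubleK -andbA. Qed.

Let Tm (v : 'I_n * Om) : T := tnth v.2 v.1.
Let P0 w : 0 <= P w. Proof. by apply: prodm_ge0 => t; apply: psrc_ge0. Qed.
Let P1 : \sum_w P w = 1. Proof. by apply: sum_prodm; apply: psrc1. Qed.
Notation P' := (tsm (n := n) P).
Let P0' v : 0 <= P' v. Proof. exact: tsm_ge0. Qed.
Let P1' : \sum_v P' v = 1. Proof. exact: tsm1. Qed.
Let nn0 : (n%:R : R) != 0. Proof. by rewrite pnatr_eq0 -lt0n. Qed.

Lemma lawTm (E : pred T) : PrE P' (fun v => E (Tm v)) = \sum_(t | E t) p t.
Proof.
transitivity (\sum_v P' v * (E (Tm v))%:R).
  by rewrite /PrE big_mkcond; apply: eq_bigr => v _; case: (E _); rewrite ?mulr1 ?mulr0.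
rewrite sum_tsm /Tm /=.
under eq_bigr => i _ do rewrite (sum_prodm_coord (psrc1 hp) i (fun t => (E t)%:R)).
rewrite sumr_const card_ord -[X in _ * X]mulr_natl mulKf // [RHS]big_mkcond.
by apply: eq_bigr => t _; case: (E t); rewrite ?mulr1 ?mulr0.
Qed.

Lemma ys_setc i (w w' : Om) : sy (tnth w i) = sy (tnth w' i) -> ys (setc i w w') = ys w :> n.-tuple Y.
Proof.
move=> yE; apply: eq_from_tnth => j; rewrite tnth_map tnth_mktuple tnth_map.
by case: eqP => // ->; rewrite yE.
Qed.

Lemma converse_mk0 : markov P' (cer 0) (evr (@sy X Y Z \o Tm)) (evr Tm).
Proof.
move=> [i w1] [i2 w2] /eqP; set t := Tm (i2, w2) => ytE.
have yt : sy t = sy (tnth w1 i) by [].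
have E0 v : cer 0 (i, w1) v -> v.1 == i by case/andP => /eqP /= ->.
rewrite (@PrE_slice _ _ P n i); last by move=> v /andP[/E0].
rewrite (@PrE_slice _ _ P n i (fun v => cer 0 (i, w1) v && _)); last by move=> v /andP[/E0].
have -> : PrE P' (evr (@sy X Y Z \o Tm) (i, w1)) = marg (@sy X Y Z) p (sy t).
  rewrite (lawTm (fun u => sy (Tm (i, w1)) == sy u)); apply: eq_bigl => u; by rewrite eq_sym yt.
have -> : PrE P' (fun v => evr (@sy X Y Z \o Tm) (i, w1) v && evr Tm (i2, w2) v) = p t.
  rewrite (lawTm (fun u => (sy (Tm (i, w1)) == sy u) && (t == u))) (big_pred1 t) // => u.
  rewrite [RHS]/= [RHS]eq_sym; case: (t =P u) => [<-|]; rewrite ?andbF // andbT.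
  by apply/eqP; exact: esym yt.
rewrite -!mulrA; congr (_ * _).
have := @indep_coord R T n p (psrc1 hp) i Y (@sy X Y Z) (eU i w1) (sy t) t erefl.
have -> : PrE P (fun w => eU i w1 w && (tnth w i == t)) = PrE P (fun w =>
   [&& cer 0 (i, w1) (i, w), evr (@sy X Y Z \o Tm) (i, w1) (i, w) & evr Tm (i2, w2) (i, w)]).
  apply: eq_PrE => w; rewrite /cer /tsr eqxx /= /evr /= -/t [_ == t]eq_sym.
  by case: (t =P tnth w i) => [E|]; rewrite ?andbF // /Tm /= -E yt eqxx andbT.
have -> : PrE P (fun w => eU i w1 w && (sy (tnth w i) == sy t)) = PrE P (fun w =>
   cer 0 (i, w1) (i, w) && evr (@sy X Y Z \o Tm) (i, w1) (i, w)).
  by apply: eq_PrE => w; rewrite /cer /tsr eqxx /= /evr /= eq_sym yt.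
move=> ->// w w' yE; apply/eUP/eUP => -[tE hx hz].
- split.
  + by rewrite tE /cty ys_setc.
  + by move=> j ji; rewrite hx // tnth_mktuple; case: eqP ji => // ->; rewrite ltnn.
  + by move=> j ji; rewrite hz // tnth_mktuple; case: eqP ji => // ->; rewrite ltnn.
- split.
  + by rewrite tE /cty ys_setc.
  + by move=> j ji; rewrite hx // tnth_mktuple; case: eqP ji => // ->; rewrite ltnn.
  + by move=> j ji; rewrite hz // tnth_mktuple; case: eqP ji => // ->; rewrite ltnn.
Qed.

(** The condition fixes the index, so each side carries the factor 1/n twice and the chain reduces
    to one coordinate. *)
Lemma slice_markov (i : 'I_n) (C a c : pred Om) (eA eB eC : rel ('I_n * Om)) w1 v2 :
  (forall v, eB (i, w1) v -> v.1 == i) ->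
  (forall w, eB (i, w1) (i, w) = C w) -> (forall w, eA (i, w1) (i, w) = a w) ->
  (forall w, C w -> eC v2 (i, w) = c w) ->
  PrE P (fun w => [&& a w, C w & c w]) * PrE P C
    = PrE P (fun w => a w && C w) * PrE P (fun w => C w && c w) ->
  PrE P' (fun v => [&& eA (i, w1) v, eB (i, w1) v & eC v2 v]) * PrE P' (eB (i, w1))
  = PrE P' (fun v => eA (i, w1) v && eB (i, w1) v) * PrE P' (fun v => eB (i, w1) v && eC v2 v).
Proof.
move=> Bi HB HA HC E.
rewrite !(@PrE_slice _ _ P n i) ?(eq_PrE P HB) //; last first.
- by move=> v /and3P[_ /Bi].
- by move=> v /andP[_ /Bi].
- by move=> v /andP[/Bi].
rewrite (@eq_PrE _ _ P _ (fun w => [&& a w, C w & c w])); last first.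
  by move=> w; rewrite HA HB; case: (boolP (C w)) => [/HC ->|_]; rewrite ?andbF.
rewrite (@eq_PrE _ _ P (fun w => eA (i, w1) (i, w) && _) (fun w => a w && C w)); last by move=> w; rewrite HA HB.
rewrite (@eq_PrE _ _ P (fun w => eB (i, w1) (i, w) && _) (fun w => C w && c w)); last first.
  by move=> w; rewrite HB; case: (boolP (C w)) => [/HC ->|_].
by rewrite mulrACA E mulrACA.
Qed.

Definition CZ (i : 'I_n) k w1 : pred Om := fun w =>
  [&& eU i w1 w, ms k w1 == ms k w & sz (tnth w1 i) == sz (tnth w i)].
Definition CX (i : 'I_n) k w1 : pred Om := fun w =>
  [&& eU i w1 w, ms k w1 == ms k w & sx (tnth w1 i) == sx (tnth w i)].

Lemma eU_ty i w1 w w' : eU i w1 w -> eU i w1 w' -> cty w = cty w'.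
Proof. by move=> /eUP[<- _ _] /eUP[<- _ _]. Qed.

Lemma CZ_compat i k w1 w w' : CZ i k w1 w -> CZ i k w1 w' -> compat w w'.
Proof.
by move=> /and3P[u _ /eqP z] /and3P[u' _ /eqP z']; apply: (eU_compat u u'); right; rewrite -z -z'.
Qed.

Lemma CX_compat i k w1 w w' : CX i k w1 w -> CX i k w1 w' -> compat w w'.
Proof.
by move=> /and3P[u _ /eqP z] /and3P[u' _ /eqP z']; apply: (eU_compat u u'); left; rewrite -z -z'.
Qed.

Lemma CZ_mix i k w1 w w' : CZ i k w1 w -> CZ i k w1 w' -> CZ i k w1 (mix w w').
Proof.
move=> /and3P[u /eqP m z] /and3P[u' /eqP m' z']; apply/and3P; split; first exact: eU_mix.
  by rewrite ms_mix -?m // ?(eU_ty u u') -?m'.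
by rewrite tnth_mktuple.
Qed.

Lemma CX_mix i k w1 w w' : CX i k w1 w -> CX i k w1 w' -> CX i k w1 (mix w w').
Proof.
move=> /and3P[u /eqP m z] /and3P[u' /eqP m' z']; apply/and3P; split; first exact: eU_mix.
  by rewrite ms_mix -?m // ?(eU_ty u u') -?m'.
by rewrite tnth_mktuple.
Qed.

Lemma converse_mkZ k : markov P' (cer k.*2.+1) (andr (evr (@key X Y Z k.*2.+1 \o Tm)) (hist cer k.*2.+1))
  (evr (@sxz X Y Z \o Tm)).
Proof.
move=> [i w1] v2 B12.
pose a : pred Om := fun w => zmsg k w1 == zmsg k w.
pose c : pred Om := fun w => sxz (Tm v2) == sxz (tnth w i).
have HB v : andr (evr (@key X Y Z k.*2.+1 \o Tm)) (hist cer k.*2.+1) (i, w1) v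
   = (i == v.1) && CZ i k w1 v.2 && (sz (tnth w1 i) == sz (tnth v.2 v.1)).
  rewrite {1}/andr hist_o /evr /= ukey_eq odd_double /Tm /tsr /CZ /=.
  case: v => k' w /=; case: (i =P k') => [<-|]; rewrite ?andbF //=.
  by case: (sz (tnth w1 i) == _); rewrite ?andbF ?andbT.
apply: (@slice_markov i (CZ i k w1) a c).
- by move=> v; rewrite HB eq_sym => /andP[/andP[]].
- by move=> w; rewrite HB /= eqxx /= /CZ; case: (sz _ == _); rewrite ?andbF ?andbT.
- by move=> w; rewrite /cer /= odd_double doubleK.
- by [].
(* [mix w w'] has the X-part of [w] and [mix w' w] its Z-part. The message and the letter at [i]
   become those of [w], because the Z-letter at [i] is constant on [CZ]. *)
apply: mix_indep; [exact: CZ_compat | exact: CZ_mix | left => w w' Cw Cw'].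
move: (Cw) (Cw') => /and3P[u /eqP m /eqP z] /and3P[u' /eqP m' /eqP z'].
rewrite /a /c zmsg_mix -?m -?m' // ?(eU_ty u' u) // tnth_mktuple /sxz /sx /sz /=.
by rewrite -/(sz (tnth w' i)) -z' z.
Qed.

(** Y stays with X in an exchange, so the chain is obtained against (X_i, Z_i): the later X-letters
    may depend on Y_i through T_y. *)
Lemma converse_mkX k : markov P' (cer k.*2.+2) (andr (evr (@key X Y Z k.*2.+2 \o Tm)) (hist cer k.*2.+2))
  (evr (@sxz X Y Z \o Tm)).
Proof.
move=> [i w1] v2 B12.
pose a : pred Om := fun w => xmsg k w1 == xmsg k w.
pose c : pred Om := fun w => sxz (Tm v2) == sxz (tnth w i).
pose C : pred Om := fun w => CX i k w1 w && (zmsg k w1 == zmsg k w).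
have HB v : andr (evr (@key X Y Z k.*2.+2 \o Tm)) (hist cer k.*2.+2) (i, w1) v
   = (i == v.1) && C v.2 && (sx (tnth w1 i) == sx (tnth v.2 v.1)).
  rewrite {1}/andr hist_e /evr /= ukey_eq /= odd_double /Tm /tsr /C /CX /=.
  case: v => k' w /=; case: (i =P k') => [<-|]; rewrite ?andbF //=.
  by case: (sx (tnth w1 i) == _); rewrite ?andbF ?andbT -?andbA.
apply: (@slice_markov i C a c).
- by move=> v; rewrite HB eq_sym => /andP[/andP[]].
- by move=> w; rewrite HB /= eqxx /= /C /CX; case: (sx _ == _); rewrite ?andbF ?andbT.
- by move=> w; rewrite /cer /= odd_double uphalf_double.
- by [].
apply: mix_indep.
- by move=> w w' /andP[Cw _] /andP[Cw' _]; apply: CX_compat Cw Cw'.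
- move=> w w' /andP[Cw zw] /andP[Cw' /eqP zw']; apply/andP; split; first exact: CX_mix.
  move: (Cw) (Cw') => /and3P[u /eqP m _] /and3P[u' /eqP m' _].
  by rewrite zmsg_mix -?m -?m' // ?(eU_ty u u') // -zw'.
- right=> w w' /andP[Cw /eqP zw] /andP[Cw' /eqP zw'].
  move: (Cw) (Cw') => /and3P[u /eqP m /eqP x] /and3P[u' /eqP m' /eqP x'].
  rewrite /a /c xmsg_mix -?m -?m' -?zw -?zw' // ?(eU_ty u' u) // tnth_mktuple /sxz /sx /sz /=.
  by rewrite -/(sx (tnth w i)) -x x'.
Qed.

Lemma converse_mkS j : (0 < j < K.*2.+1)%N ->
  markov P' (cer j) (andr (evr (@key X Y Z j \o Tm)) (hist cer j)) (evr (@sxz X Y Z \o Tm)).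
Proof.
move=> /andP[j0 jK]; case: (boolP (odd j)) => oj.
  have -> : j = (j.-1./2).*2.+1 by lia.
  exact: converse_mkZ.
have -> : j = (j.-1./2).*2.+2 by lia.
exact: converse_mkX.
Qed.

(** Supplies the hypothesis of [psi_rQ] for a block decoder, which reads a whole block while the
    single-letter decoder sees one letter of it. *)
Lemma dist_swap (D : finType) (f : T -> D) (I : finType) (c : T -> I -> R) (g : 'I_n -> Om -> I)
    (C : 'I_n -> Om -> pred Om) :
  (forall i w1 w, [&& eU i w1 w, ms K w1 == ms K w & f (tnth w1 i) == f (tnth w i)] = C i w1 w) ->
  (forall i w1 w w', C i w1 w -> C i w1 w' -> compat w w') ->
  (forall i w1 w w', C i w1 w -> C i w1 w' -> C i w1 (mix w w')) ->
  (forall i w1, (forall w w', C i w1 w -> C i w1 w' ->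
      c (tnth (mix w w') i) (g i (mix w' w)) = c (tnth w i) (g i w))
    \/ (forall w w', C i w1 w -> C i w1 w' ->
      c (tnth (mix w w') i) (g i (mix w' w)) = c (tnth w' i) (g i w'))) ->
  forall v0, let CC := [pred v | hist cer K.*2.+1 v0 v && (f (Tm v) == f (Tm v0))] in
    (\sum_(v in CC) P' v * c (Tm v) (g v.1 v.2)) * PrE P' CC
    = \sum_(v' in CC) P' v' * \sum_(v in CC) P' v * c (Tm v) (g v'.1 v'.2).
Proof.
move=> CE Cc Cm sw [i w1] CC.
have CCi v : CC v -> v.1 == i by rewrite /CC /= hist_o /tsr /= => /andP[/andP[/andP[]]]; rewrite eq_sym.
have CCw w : CC (i, w) = C i w1 w.
  by rewrite -CE /CC /= hist_o /tsr /Tm /= eqxx /= -andbA [f (tnth w i) == _]eq_sym.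
have S (F : 'I_n * Om -> R) : \sum_(v in CC) F v = \sum_(w | C i w1 w) F (i, w).
  by rewrite (sum_slice _ CCi); apply: eq_bigl => w; rewrite -CCw.
rewrite (PrE_slice _ CCi) !S (eq_PrE P CCw) /=.
transitivity (n%:R^-1 * n%:R^-1 * ((\sum_(w | C i w1 w) P w * c (tnth w i) (g i w)) * PrE P (C i w1))).
  have -> : \sum_(w | C i w1 w) P' (i, w) * c (Tm (i, w)) (g i w)
      = n%:R^-1 * \sum_(w | C i w1 w) P w * c (tnth w i) (g i w).
    by rewrite mulr_sumr; apply: eq_bigr => w _; rewrite /tsm /Tm /= mulrA.
  by ring.
have md := @mix_diag R X Y Z n pxy pzx (C i w1) (Cc i w1) (Cm i w1)
  (fun w w' => c (tnth w i) (g i w')) (sw i w1).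
rewrite md.
rewrite exchange_big mulr_sumr; apply: eq_bigr => w' _; rewrite S mulr_sumr mulr_sumr.
by apply: eq_bigr => w _; rewrite /tsm /Tm /=; ring.
Qed.

End Converse.

Section CodeToProtocol.
Variables (R : realType) (X Y Z Xh Zh : finType).
Variables (pxy : X -> Y -> R) (pzx : X -> Z -> R).
Variables (dx : X -> Xh -> R) (dz : Z -> Zh -> R) (K n : nat).
Hypotheses (hK : (1 <= K)%N) (hp : is_source pxy pzx) (n0 : (0 < n)%N).
Notation T := (src X Y Z).
Notation p := (psrc pxy pzx).
Notation Om := (n.-tuple T).
Notation P := (prodm (n := n) p).

Let p0 := psrc_ge0 hp.
Let p1 := psrc1 hp.
Let P0 (w : Om) : 0 <= P w. Proof. exact: prodm_ge0. Qed.
Let P1 : \sum_(w : Om) P w = 1. Proof. exact: sum_prodm. Qed.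

Lemma coord_agree (B : finType) (f : T -> B) a b c (i : 'I_n) (w w' : Om) :
  (forall t t', (f t == f t') = sub a b c t t') ->
  (f (tnth w i) == f (tnth w' i))
  = agree (fun j => a && (j == i)%N) (fun j => b && (j == i)%N) (fun j => c && (j == i)%N) w w'.
Proof.
move=> hf; rewrite hf; apply/idP/forallP => [h j|/(_ i)]; last by rewrite eqxx !andbT.
by case: (j =P i) => [->|/eqP ji]; rewrite ?eqxx ?andbT // val_eqE (negbTE ji) !andbF.
Qed.

Lemma eq_or_ltn i j : ((j == i) || (j < i) = (j <= i))%N.
Proof. by rewrite [RHS]leq_eqVlt. Qed.

Lemma eq_or_gtn i j : ((j == i) || (i < j) = (i <= j))%N.
Proof. by rewrite eq_sym [RHS]leq_eqVlt. Qed.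

Lemma agree_xs (w w' : Om) : agree (fun=> true) (fun=> false) (fun=> false) w w' -> xs w = xs w'.
Proof.
move/forallP => h; apply: eq_from_tnth => j; rewrite !tnth_map.
by have /and3P[/eqP] := h j.
Qed.

Lemma agree_ys (w w' : Om) : agree (fun=> false) (fun=> true) (fun=> false) w w' -> ys w = ys w'.
Proof.
move/forallP => h; apply: eq_from_tnth => j; rewrite !tnth_map.
by have /and3P[_ /eqP] := h j.
Qed.

Lemma agree_zs (w w' : Om) : agree (fun=> false) (fun=> false) (fun=> true) w w' -> zs w = zs w'.
Proof.
move/forallP => h; apply: eq_from_tnth => j; rewrite !tnth_map.
by have /and3P[_ _ /eqP] := h j.
Qed.

Lemma code_NF Dx' Dz' rx ry rz : code_exists pxy pzx dx dz K n rx ry rz Dx' Dz' ->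
  NF pxy pzx dx dz K Dx' Dz' rx ry rz.
Proof.
case=> My [Mx [Mz [fy [fz [fx [gx [gz]]]]]]] [fyM fzM fxM [hry hrx hrz] [hdx hdz]].
have [t0 _] : exists t : T, true.
  case: (pickP (fun _ : T => true)) => [t _|no]; first by exists t.
  by exfalso; move: p1; rewrite big_pred0 // => /eqP; rewrite eq_sym oner_eq0.
pose w0 : Om := [tuple t0 | _ < n].
pose i0 := Ordinal n0.
pose x0 := tnth (gz (zs w0) 0%N [::]) i0; pose z0 := tnth (gx (xs w0) 0%N [::]) i0.
pose P' : 'I_n * Om -> R := tsm P (n:=n).
have P0' v : 0 <= P' v by apply: tsm_ge0.
have P1' : \sum_v P' v = 1 by apply: tsm1.
pose Tm (v : 'I_n * Om) : T := tnth v.2 v.1.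
pose er := @cer X Y Z n fy fz fx.
have lawT t : PrE P' (fun v => Tm v == t) = p t.
  by rewrite (lawTm hp n0 (fun u => u == t)) (big_pred1 t).
have eqv j : equivalence_rel (er j) by apply: er_equiv.
have mk0 : markov P' (er 0) (evr (@sy X Y Z \o Tm)) (evr Tm) by apply: converse_mk0.
have mkS j : (0 < j < K.*2.+1)%N ->
    markov P' (er j) (andr (evr (@key X Y Z j \o Tm)) (hist er j)) (evr (@sxz X Y Z \o Tm)).
  exact: converse_mkS.
pose Q := rQ Tm er P1'.
have vQ : valid Q by apply: valid_rQ.
pose ty := @cty X Y Z n fy; pose tr := ms fy fz fx K.
pose tz w := (tr w).2; pose tx w := (tr w).1.
have E1 (B : finType) (f : T -> B) a b c : (forall t t', (f t == f t') = sub a b c t t') ->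
    lent (@key X Y Z) Q p f 1 = ln n%:R + n%:R^-1 * \sum_(i < n)
      eT p ty (fun j => (a && (j == i)%N) || (j < i)%N) (fun j => b && (j == i)%N)
        (fun j => (c && (j == i)%N) || (i < j)%N).
  move=> hf; rewrite (lent_rQ1 P0' P1' lawT eqv mk0) //.
  rewrite (@eq_Ent _ _ P' _ (tsr (fun i => andr (evr ty)
     (agree (fun j => (a && (j == i)%N) || (j < i)%N) (fun j => b && (j == i)%N)
        (fun j => (c && (j == i)%N) || (i < j)%N))))).
    by rewrite Ent_tsr // => i w; apply: eqrel_refl; apply: andr_equiv; [apply: evr_equiv|apply: agree_equiv].
  move=> [i w] [i' w']; rewrite /andr /evr /= /Tm /= histS (_ : hist er 0 _ _); last by apply/forallP => -[].
  rewrite /er /= /tsr /= /eU /andr /evr; case: (i =P i') => [<-|] //=; rewrite ?andbF //.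
  rewrite (coord_agree _ _ _ hf) andbCA; congr (_ && _); rewrite agree_or; apply: eq_agree => j _.
  by rewrite orbF.
have EN (B : finType) (f : T -> B) (g : X * Z -> B) a c : f =1 g \o (@sxz X Y Z) ->
    (forall t t', (f t == f t') = sub a false c t t') ->
    lent (@key X Y Z) Q p f K.*2.+1 = ln n%:R + n%:R^-1 * \sum_(i < n)
      eM p ty tr (fun j => (a && (j == i)%N) || (j < i)%N) (fun=> false)
        (fun j => (c && (j == i)%N) || (i < j)%N).
  move=> fg hf; rewrite (lent_rQ P0' P1' lawT eqv mk0 mkS fg) ?leqnn //.
  rewrite (@eq_Ent _ _ P' _ (tsr (fun i => andr (andr (evr ty) (evr tr))
     (agree (fun j => (a && (j == i)%N) || (j < i)%N) (fun=> false)
        (fun j => (c && (j == i)%N) || (i < j)%N))))).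
    rewrite Ent_tsr // => i w; apply: eqrel_refl; apply: andr_equiv; last exact: agree_equiv.
    by apply: andr_equiv; apply: evr_equiv.
  move=> [i w] [i' w']; rewrite /andr /evr /= /Tm /= hist_o /=.
  rewrite /tsr /= /eU /andr /evr; case: (i =P i') => [<-|] //=; rewrite ?andbF //.
  rewrite (coord_agree _ _ _ hf) -/(ty w) -/(ty w') -/(tr w) -/(tr w').
  have -> : agree (fun j => (a && (j == i)%N) || (j < i)%N) (fun=> false) (fun j => (c && (j == i)%N) || (i < j)%N) w w'
     = agree (fun j => a && (j == i)%N) (fun j => false && (j == i)%N) (fun j => c && (j == i)%N) w w'
       && agree (fun j => j < i)%N (fun=> false) (fun j => i < j)%N w w'.
    by rewrite agree_or; apply: eq_agree => j _; rewrite orbF.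
  by case: (ty w == ty w'); case: (tr w == tr w'); rewrite ?andbF ?andbT.
have Xf t t' : (sx t == sx t') = @sub X Y Z true false false t t' by rewrite /sub /= andbT.
have Zf t t' : (sz t == sz t') = @sub X Y Z false false true t t' by [].
have XZf t t' : (sxz t == sxz t') = @sub X Y Z true false true t t' by rewrite /sub /sxz xpair_eqE.
have YZf t t' : (syz t == syz t') = @sub X Y Z false true true t t' by rewrite /sub /syz xpair_eqE.
have hM := Ent_markov_source hp.
have tyY w w' : agree (fun=> false) (fun=> true) (fun=> false) w w' -> ty w = ty w'.
  by move/agree_ys => E; rewrite /ty /cty E.
(* User X can replay the whole transcript from its own block, T_y and the messages it receives. *)
have msz k w w' : (ms fy fz fx k w).2 = (ms fy fz fx k w').2 -> ty w = ty w' -> xs w = xs w' ->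
    ms fy fz fx k w = ms fy fz fx k w'.
  elim: k => [//|k IH]; rewrite !msS /= => /eqP; rewrite eqseq_rcons => /andP[/eqP m2 /eqP zE] tE xE.
  by have mE := IH m2 tE xE; rewrite mE zE {1}/xmsg -/(ty w) tE xE m2 zE.
have msx k w w' : (ms fy fz fx k w).1 = (ms fy fz fx k w').1 -> ty w = ty w' -> zs w = zs w' ->
    ms fy fz fx k w = ms fy fz fx k w'.
  elim: k => [//|k IH]; rewrite !msS /= => /eqP; rewrite eqseq_rcons => /andP[/eqP m2 /eqP xE] tE zE.
  by have mE := IH m2 tE zE; rewrite mE xE {1}/zmsg -/(ty w) tE zE m2.
have trz w w' : tz w = tz w' -> ty w = ty w' -> agree (fun=> true) (fun=> false) (fun=> false) w w' -> tr w = tr w'.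
  by move=> h1 h2 /agree_xs; apply: msz.
have trx w w' : tx w = tx w' -> ty w = ty w' -> agree (fun=> false) (fun=> false) (fun=> true) w w' -> tr w = tr w'.
  by move=> h1 h2 /agree_zs; apply: msx.
have bnd (M : nat) (F : Om -> nat) : (forall w, (F w < M)%N) -> Ent P (evr F) <= ln M%:R.
  move=> FM; have -> : Ent P (evr F) = Ent P (evr (fun w => Ordinal (FM w))) by apply: eq_Ent.
  by have := Ent_le_card P0 P1 (fun w => Ordinal (FM w)); rewrite card_ord.
have bty : Ent P (evr ty) <= ln My%:R by apply: bnd => w; apply: fyM.
have btz : Ent P (evr tz) <= \sum_(k < K) ln (Mz k)%:R.
  suff H k : (k <= K)%N -> Ent P (evr (fun w => (ms fy fz fx k w).2)) <= \sum_(j < k) ln (Mz j)%:R by apply: H.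
  elim: k => [|k IH] kK; first by rewrite big_ord0 -(Ent_true P1); apply: Ent_le.
  rewrite big_ord_recr /=; apply: le_trans (lerD (IH (ltnW kK)) (bnd (Mz k) (zmsg fy fz fx k) _)); last first.
    by move=> w; apply: fzM.
  rewrite (@eq_Ent _ _ P _ (andr (evr (fun w => (ms fy fz fx k w).2)) (evr (zmsg fy fz fx k)))).
    by apply: Ent_subadd => //; apply: evr_equiv.
  by move=> w w'; rewrite /andr /evr !msS /= eqseq_rcons.
have btx : Ent P (evr tx) <= \sum_(k < K) ln (Mx k)%:R.
  suff H k : (k <= K)%N -> Ent P (evr (fun w => (ms fy fz fx k w).1)) <= \sum_(j < k) ln (Mx j)%:R by apply: H.
  elim: k => [|k IH] kK; first by rewrite big_ord0 -(Ent_true P1); apply: Ent_le.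
  rewrite big_ord_recr /=; apply: le_trans (lerD (IH (ltnW kK)) (bnd (Mx k) (xmsg fy fz fx k) _)); last first.
    by move=> w; apply: fxM.
  rewrite (@eq_Ent _ _ P _ (andr (evr (fun w => (ms fy fz fx k w).1)) (evr (xmsg fy fz fx k)))).
    by apply: Ent_subadd => //; apply: evr_equiv.
  by move=> w w'; rewrite /andr /evr !msS /= eqseq_rcons.
have ni0 : 0 <= n%:R^-1 :> R by rewrite invr_ge0.
have nn0 : (n%:R : R) != 0 by rewrite pnatr_eq0 -lt0n.
have cv (a : R) : a = n%:R^-1 * \sum_(i < n) a by rewrite sumr_const card_ord -[X in _ * X]mulr_natl mulKf.
have eqT (a b c a' b' c' : 'I_n -> nat -> bool) : (forall i j, [/\ a i j = a' i j, b i j = b' i j & c i j = c' i j]) ->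
    \sum_i eT p ty (a i) (b i) (c i) = \sum_i eT p ty (a' i) (b' i) (c' i).
  by move=> E; apply: eq_bigr => i _; apply: eq_eT => j _; apply: E.
have eqM (a b c a' b' c' : 'I_n -> nat -> bool) : (forall i j, [/\ a i j = a' i j, b i j = b' i j & c i j = c' i j]) ->
    \sum_i eM p ty tr (a i) (b i) (c i) = \sum_i eM p ty tr (a' i) (b' i) (c' i).
  by move=> E; apply: eq_bigr => i _; apply: eq_eM => j _; apply: E.
have E1yz : lent (@key X Y Z) Q p (@syz X Y Z) 1 = ln n%:R + n%:R^-1 * \sum_(i < n) eT p ty (fun j => j < i)%N (fun j => j == i)%N (fun j => i <= j)%N.
  rewrite (E1 _ _ _ _ _ YZf); congr (_ + _ * _).
  by apply: (eqT _ _ _ (fun i => (fun j => j < i)%N) (fun i => (fun j => j == i)%N) (fun i => (fun j => i <= j)%N)) => i j; split=> //=; rewrite ?eq_or_ltn ?eq_or_gtn.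
have E1z : lent (@key X Y Z) Q p (@sz X Y Z) 1 = ln n%:R + n%:R^-1 * \sum_(i < n) eT p ty (fun j => j < i)%N (fun=> false) (fun j => i <= j)%N.
  rewrite (E1 _ _ _ _ _ Zf); congr (_ + _ * _).
  by apply: (eqT _ _ _ (fun i => (fun j => j < i)%N) (fun i => (fun=> false)) (fun i => (fun j => i <= j)%N)) => i j; split=> //=; rewrite ?eq_or_ltn ?eq_or_gtn.
have E1xz : lent (@key X Y Z) Q p (@sxz X Y Z) 1 = ln n%:R + n%:R^-1 * \sum_(i < n) eT p ty (fun j => j <= i)%N (fun=> false) (fun j => i <= j)%N.
  rewrite (E1 _ _ _ _ _ XZf); congr (_ + _ * _).
  by apply: (eqT _ _ _ (fun i => (fun j => j <= i)%N) (fun i => (fun=> false)) (fun i => (fun j => i <= j)%N)) => i j; split=> //=; rewrite ?eq_or_ltn ?eq_or_gtn.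
have E1x : lent (@key X Y Z) Q p (@sx X Y Z) 1 = ln n%:R + n%:R^-1 * \sum_(i < n) eT p ty (fun j => j <= i)%N (fun=> false) (fun j => i < j)%N.
  rewrite (E1 _ _ _ _ _ Xf); congr (_ + _ * _).
  by apply: (eqT _ _ _ (fun i => (fun j => j <= i)%N) (fun i => (fun=> false)) (fun i => (fun j => i < j)%N)) => i j; split=> //=; rewrite ?eq_or_ltn ?eq_or_gtn.
have ENxz : lent (@key X Y Z) Q p (@sxz X Y Z) K.*2.+1 = ln n%:R + n%:R^-1 * \sum_(i < n) eM p ty tr (fun j => j <= i)%N (fun=> false) (fun j => i <= j)%N.
  rewrite (EN _ _ id _ _ _ XZf) //; congr (_ + _ * _).
  by apply: (eqM _ _ _ (fun i => (fun j => j <= i)%N) (fun i => (fun=> false)) (fun i => (fun j => i <= j)%N)) => i j; split=> //=; rewrite ?eq_or_ltn ?eq_or_gtn.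
have ENx : lent (@key X Y Z) Q p (@sx X Y Z) K.*2.+1 = ln n%:R + n%:R^-1 * \sum_(i < n) eM p ty tr (fun j => j <= i)%N (fun=> false) (fun j => i < j)%N.
  rewrite (EN _ _ fst _ _ _ Xf) //; congr (_ + _ * _).
  by apply: (eqM _ _ _ (fun i => (fun j => j <= i)%N) (fun i => (fun=> false)) (fun i => (fun j => i < j)%N)) => i j; split=> //=; rewrite ?eq_or_ltn ?eq_or_gtn.
have ENz : lent (@key X Y Z) Q p (@sz X Y Z) K.*2.+1 = ln n%:R + n%:R^-1 * \sum_(i < n) eM p ty tr (fun j => j < i)%N (fun=> false) (fun j => i <= j)%N.
  rewrite (EN _ _ snd _ _ _ Zf) //; congr (_ + _ * _).
  by apply: (eqM _ _ _ (fun i => (fun j => j < i)%N) (fun i => (fun=> false)) (fun i => (fun j => i <= j)%N)) => i j; split=> //=; rewrite ?eq_or_ltn ?eq_or_gtn.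
exists x0, z0, _, Q; split=> //; split.
- apply: le_trans hry; apply: le_trans (ler_wpM2l ni0 bty).
  have Sy := @single_letter_y R X Y Z n p p0 p1 _ ty tyY.
  apply: le_trans (ler_wpM2l ni0 Sy).
  rewrite E1yz E1z.
  have -> : lent (@key X Y Z) Q p (@syz X Y Z) 0 = Ent p (sub false true true).
    by rewrite /lent /= -Ent_evr; apply: eq_Ent => t t'; rewrite /evr YZf.
  have -> : lent (@key X Y Z) Q p (@sz X Y Z) 0 = Ent p (sub false false true).
    by rewrite /lent /= -Ent_evr; apply: eq_Ent => t t'; rewrite /evr Zf.
  rewrite sumrB mulrBr -cv sumrB; set u := \sum_i _; set v := \sum_i _.
  by rewrite le_eqVlt; apply/orP; left; apply/eqP; ring.
- apply: le_trans hrz; apply: le_trans (ler_wpM2l ni0 btz).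
  have Sz := @single_letter_z R X Y Z n p p0 p1 hM _ _ _ ty tr tz tyY trz.
  apply: le_trans (ler_wpM2l ni0 Sz).
  rewrite E1xz E1x ENxz ENx.
  by rewrite !sumrB le_eqVlt; apply/orP; left; apply/eqP; ring.
- apply: le_trans hrx; apply: le_trans (ler_wpM2l ni0 btx).
  have Sx := @single_letter_x R X Y Z n p p0 p1 hM _ _ _ ty tr tx tyY trx.
  apply: le_trans (ler_wpM2l ni0 Sx).
  rewrite E1xz E1z ENxz ENz.
  by rewrite !sumrB le_eqVlt; apply/orP; left; apply/eqP; ring.
- pose D (v : 'I_n * Om) : Xh := tnth (gz (zs v.2) (ty v.2) (tr v.2).1) v.1.
  apply: le_trans (_ : \sum_v P' v * dx (sx (Tm v)) (D v) <= _); last first.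
    apply: le_trans hdx; rewrite /exp_dist_x.
    rewrite (sum_blocks (fun xn yn zn => ptuple pxy pzx xn yn zn * (n%:R^-1 * \sum_(i < n)
       dx (tnth xn i) (tnth (gz zn (fy yn) (msgs fz fx xn zn (fy yn) K).1) i)))).
    rewrite sum_tsm exchange_big mulr_sumr; apply: ler_sum => w _; rewrite ptuple_prodm.
    rewrite -mulr_sumr mulrCA; rewrite le_eqVlt; apply/orP; left; apply/eqP; congr (_ * (_ * _)).
    by apply: eq_bigr => i _; rewrite tnth_map.
  apply: (@psi_rQ R X Y Z pxy pzx _ P' Tm er K.*2.+1 P0' P1' lawT eqv mk0 mkS _ _ _
    (@sz X Y Z) (fun t => dx (sx t)) snd (fun b => dx b.1)) => //.
  apply: (@dist_swap R X Y Z pxy pzx K n fy fz fx _ (@sz X Y Z) _ (fun t => dx (sx t))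
    (fun i w => D (i, w)) (fun i w1 => CZ fy fz fx i K w1)) => //.
  + by move=> i w1 w w'; apply: CZ_compat.
  + by move=> i w1 w w'; apply: CZ_mix.
  + move=> i w1; left=> w w' /and3P[u /eqP m _] /and3P[u' /eqP m' _].
    rewrite tnth_mktuple /D /= zs_mix /tr ms_mix -?m -?m' //; last exact: eU_ty u' u.
    by rewrite {1}/ty /cty ys_mix -/(cty fy w') (eU_ty u' u).
- pose D (v : 'I_n * Om) : Zh := tnth (gx (xs v.2) (ty v.2) (tr v.2).2) v.1.
  apply: le_trans (_ : \sum_v P' v * dz (sz (Tm v)) (D v) <= _); last first.
    apply: le_trans hdz; rewrite /exp_dist_z.
    rewrite (sum_blocks (fun xn yn zn => ptuple pxy pzx xn yn zn * (n%:R^-1 * \sum_(i < n)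
       dz (tnth zn i) (tnth (gx xn (fy yn) (msgs fz fx xn zn (fy yn) K).2) i)))).
    rewrite sum_tsm exchange_big mulr_sumr; apply: ler_sum => w _; rewrite ptuple_prodm.
    rewrite -mulr_sumr mulrCA; rewrite le_eqVlt; apply/orP; left; apply/eqP; congr (_ * (_ * _)).
    by apply: eq_bigr => i _; rewrite tnth_map.
  apply: (@psi_rQ R X Y Z pxy pzx _ P' Tm er K.*2.+1 P0' P1' lawT eqv mk0 mkS _ _ _
    (@sx X Y Z) (fun t => dz (sz t)) fst (fun b => dz b.2)) => //.
  apply: (@dist_swap R X Y Z pxy pzx K n fy fz fx _ (@sx X Y Z) _ (fun t => dz (sz t))
    (fun i w => D (i, w)) (fun i w1 => CX fy fz fx i K w1)) => //.
  + by move=> i w1 w w'; apply: CX_compat.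
  + by move=> i w1 w w'; apply: CX_mix.
  + move=> i w1; right=> w w' /and3P[u /eqP m _] /and3P[u' /eqP m' _].
    rewrite tnth_mktuple /D /= xs_mix /tr ms_mix -?m -?m' //; last exact: eU_ty u' u.
    by rewrite {1}/ty /cty ys_mix.
Qed.

End CodeToProtocol.

(** * Achievability *)

Section RandomMaps.
Variables (R : realType) (A B : finType).
Hypothesis B0 : (0 < #|B|)%N.
Notation b1 := ((#|B|%:R)^-1 : R).

Definition avg (F : {ffun A -> B} -> R) : R := \sum_f (\prod_(a : A) b1) * F f.

Lemma avg_const c : avg (fun=> c) = c.
Proof.
rewrite /avg -mulr_suml; have -> : \sum_(f : {ffun A -> B}) \prod_(a : A) b1 = 1; last exact: mul1r.
rewrite -(bigA_distr_bigA (fun (a : A) (b : B) => b1)) big1 // => a _.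
by rewrite sumr_const -[X in X = _]mulr_natl divff // pnatr_eq0 -lt0n.
Qed.

Lemma avgD F G : avg (fun f => F f + G f) = avg F + avg G.
Proof. by rewrite /avg -big_split; apply: eq_bigr => f _; rewrite mulrDr. Qed.

Lemma avgZ c F : avg (fun f => c * F f) = c * avg F.
Proof. by rewrite /avg mulr_sumr; apply: eq_bigr => f _; rewrite mulrCA. Qed.

Lemma avg_sum (I : finType) (E : pred I) (F : I -> {ffun A -> B} -> R) :
  avg (fun f => \sum_(i | E i) F i f) = \sum_(i | E i) avg (F i).
Proof. by rewrite /avg exchange_big; apply: eq_bigr => f _; rewrite mulr_sumr. Qed.

Lemma ler_avg F G : (forall f, F f <= G f) -> avg F <= avg G.
Proof.
move=> FG; apply: ler_sum => f _; apply: ler_wpM2l => //.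
by apply: prodr_ge0 => a _; rewrite invr_ge0 ler0n.
Qed.

Lemma eq_avg F G : F =1 G -> avg F = avg G.
Proof. by move=> FG; apply: eq_bigr => f _; rewrite FG. Qed.

Lemma avg_exists F : exists f, F f <= avg F.
Proof.
apply: contrapT => no.
have lt f : avg F < F f by rewrite ltNge; apply/negP => ?; apply: no; exists f.
have [b _] : exists b : B, true by case/card_gt0P: B0 => b _; exists b.
have : avg F < avg F; last by rewrite ltxx.
rewrite -[X in X < _]avg_const; apply: ltr_sum => [|f _]; last first.
  by rewrite ltr_pM2l // prodr_gt0 // => a _; rewrite invr_gt0 ltr0n.
by apply/hasP; exists [ffun=> b] => //; rewrite mem_index_enum.
Qed.

Lemma avg_coord a (g : B -> R) : avg (fun f => g (f a)) = b1 * \sum_b g b.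
Proof.
have E (f : {ffun A -> B}) : (\prod_(c : A) b1) * g (f a) = \prod_c (b1 * (if c == a then g (f c) else 1)).
  rewrite big_split /=; congr (_ * _); rewrite (bigD1 a) //= eqxx big1 ?mulr1 // => c.
  by move/negbTE->.
rewrite /avg (eq_bigr _ (fun f _ => E f)).
rewrite -(bigA_distr_bigA (fun c b => b1 * (if c == a then g b else 1))) (bigD1 a) //= eqxx -mulr_sumr.
rewrite [X in _ * X]big1 ?mulr1 // => c /negbTE ->.
by rewrite -mulr_sumr sumr_const -[X in _ * X]mulr_natl mulr1 mulVf // pnatr_eq0 -lt0n.
Qed.

Lemma avg_coord2 a a' (g g' : B -> R) : a' != a ->
  avg (fun f => g (f a) * g' (f a')) = (b1 * \sum_b g b) * (b1 * \sum_b g' b).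
Proof.
move=> aa.
pose G c b := b1 * (if c == a then g b else if c == a' then g' b else 1).
have E (f : {ffun A -> B}) : (\prod_(c : A) b1) * (g (f a) * g' (f a')) = \prod_c G c (f c).
  rewrite big_split /=; congr (_ * _); rewrite (bigD1 a) //= eqxx (bigD1 a') //= eqxx (negbTE aa).
  by rewrite big1 ?mulr1 // => c /andP[/negbTE -> /negbTE ->].
rewrite /avg (eq_bigr _ (fun f _ => E f)).
rewrite -(bigA_distr_bigA G) (bigD1 a) //= (bigD1 a') //= /G eqxx (negbTE aa) eqxx -!mulr_sumr.
rewrite [X in _ * (_ * X)]big1 ?mulr1 // => c /andP[/negbTE -> /negbTE ->].
by rewrite -mulr_sumr sumr_const -[X in _ * X]mulr_natl mulr1 mulVf // pnatr_eq0 -lt0n.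
Qed.

Lemma avg_pair a a' (g : B -> B -> R) : a' != a ->
  avg (fun f => g (f a) (f a')) = b1 ^+ 2 * \sum_b \sum_b' g b b'.
Proof.
move=> aa.
have E (f : {ffun A -> B}) : g (f a) (f a') = \sum_b (b == f a)%:R * g b (f a').
  rewrite (bigD1 (f a)) //= eqxx mul1r big1 ?addr0 // => b /negbTE ->; exact: mul0r.
rewrite (eq_avg E) avg_sum mulr_sumr; apply: eq_bigr => b _.
rewrite (avg_coord2 (fun c => (b == c)%:R) (g b) aa) expr2.
rewrite (bigD1 b) //= eqxx big1 ?addr0; last by move=> c; rewrite eq_sym => /negbTE ->.
by rewrite mulr1 mulrA.
Qed.

End RandomMaps.

(** * Random binning at one node of the tree *)

Section Node.
Variables (R : realType) (T S A : finType) (a0 : A) (k : T -> S) (f : bool -> T -> S).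
Variables (nu : T -> R) (q : S -> A -> R) (r : bool -> S -> A -> R).
Variables (need : pred bool) (tau : bool -> R) (kappa sg : R) (M F : nat).
Variable w : T -> A -> bool.
Hypotheses (nu0 : forall t, 0 <= nu t) (q0 : forall s a, 0 <= q s a) (q1 : forall s, \sum_a q s a = 1).
Hypotheses (r0 : forall u s a, 0 <= r u s a) (r1 : forall u s, \sum_a r u s a <= 1).
Hypotheses (tau0 : forall u, 0 < tau u) (sg0 : 0 < sg) (kappa0 : 0 < kappa) (kF : kappa * F%:R <= sg ^+ 2).
Notation bin := ('I_M.+1 * 'I_F.+1)%type.

(** Its negation is what makes the bin search return [a] for every listener concerned: [a] is in the
    codebook, passes the threshold, and does so alone in its bin. *)
Definition nerr (be : A -> nat * nat) t a : bool :=
  ((be a).2 != 0%N) || [exists u, need u && ((r u (f u t) a < tau u)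
     || [exists a', [&& a' != a, be a' == be a & tau u <= r u (f u t) a']])].

(** The price of atypical letters. The factor 2 is the mean of 1 + [Fr * hit], a crude bound used
    where [q] exceeds [kappa]. *)
Definition nmiss s t a : R := \sum_(u | need u) (r u (f u t) a < tau u)%R%:R + 2 * (kappa < q s a)%R%:R.

(** At most 1/tau letters pass the threshold, as likelihoods sum to at most 1, and each collides
    with probability 1/((M+1)(F+1)). The term [sg] pays for the fluctuation of the weight of the
    codebook. *)
Definition nconst : R := \sum_(u | need u) (tau u * M.+1%:R * F.+1%:R)^-1 + sg.

Definition unbin (b : bin) : nat * nat := (nat_of_ord b.1, nat_of_ord b.2).

Let Eb := @avg R A bin.
Let B0 : (0 < #|{: bin}|)%N. Proof. by rewrite card_prod !card_ord. Qed.
Let Bc : (#|{: bin}|%:R : R) = M.+1%:R * F.+1%:R. Proof. by rewrite card_prod !card_ord natrM. Qed.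
Let hit (b : bin) : R := (b.2 == ord0)%:R.
Let Fr : R := F.+1%:R.

Let Fr0 : 0 < Fr. Proof. by rewrite ltr0n. Qed.
Let Mr0 : 0 < M.+1%:R :> R. Proof. by rewrite ltr0n. Qed.

Let sum_hit : \sum_b hit b = M.+1%:R.
Proof.
rewrite -(pair_bigA _ (fun _ c => (c == ord0)%:R)) /=.
have E1 : \sum_(c < F.+1) (c == ord0)%:R = 1 :> R.
  by rewrite (bigD1 ord0) //= big1 ?addr0 // => c /negbTE ->.
by rewrite (eq_bigr _ (fun _ _ => E1)) sumr_const card_ord.
Qed.

Let avg_hit a : Eb (fun be => hit (be a)) = Fr^-1.
Proof. by rewrite /Eb (avg_coord B0) sum_hit Bc invfM mulrAC mulVf ?mul1r // gt_eqF. Qed.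

Let avg_hit2 a a' : a' != a -> Eb (fun be => hit (be a) * hit (be a')) = Fr^-2.
Proof.
move=> aa; rewrite /Eb (avg_coord2 B0 _ _ aa) sum_hit Bc -/Fr.
by move: (Fr) Fr0 (M.+1%:R : R) Mr0 => x x0 y y0; field; rewrite ?lt0r_neq0.
Qed.

Let avg_collide a a' : a' != a -> Eb (fun be => hit (be a) * (be a' == be a)%:R) = Fr^-1 * (M.+1%:R * Fr)^-1.
Proof.
move=> aa; rewrite /Eb (avg_pair B0 (fun b b' => hit b * (b' == b)%:R) aa).
have -> : \sum_b \sum_b' hit b * (b' == b)%:R = \sum_b hit b :> R.
  apply: eq_bigr => b _; rewrite (bigD1 b) //= eqxx mulr1 big1 ?addr0 // => b' /negbTE ->.
  exact: mulr0.
by rewrite sum_hit [X in X^-1 ^+ 2]Bc -/Fr; move: (Fr) Fr0 (M.+1%:R : R) Mr0 => x x0 y y0; field; rewrite ?lt0r_neq0.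
Qed.

Let few u s : (\sum_(a | tau u <= r u s a) 1 : R) <= (tau u)^-1.
Proof.
rewrite -[leRHS]mul1r ler_pdivlMr //; apply: le_trans (r1 u s).
rewrite mulr_suml [leRHS](bigID (fun a => tau u <= r u s a)) /=.
apply: le_trans (_ : \sum_(a | tau u <= r u s a) r u s a <= _); first by apply: ler_sum => a; rewrite mul1r.
by rewrite lerDl; apply: sumr_ge0.
Qed.

(* Drawing the letter [a] with weight [Fr * hit (be a) * q s a] is, on average over the
   binning, drawing it from [q s]. *)
Let qb (be : {ffun A -> bin}) s a : R := Fr * hit (be a) * q s a.

Let avg_cost t : Eb (fun be => \sum_a qb be (k t) a * (w t a || nerr (unbin \o be) t a)%:R)
  <= \sum_a q (k t) a * ((w t a)%:R + \sum_(u | need u) (r u (f u t) a < tau u)%R%:R)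
     + \sum_(u | need u) (tau u * M.+1%:R * F.+1%:R)^-1.
Proof.
rewrite /Eb avg_sum.
have -> : \sum_(u | need u) (tau u * M.+1%:R * F.+1%:R)^-1
   = \sum_a q (k t) a * \sum_(u | need u) (tau u * M.+1%:R * F.+1%:R)^-1.
  by rewrite -mulr_suml q1 mul1r.
rewrite -big_split; apply: ler_sum => a _ /=; rewrite -mulrDr.
apply: le_trans (_ : avg (fun be : {ffun A -> bin} => Fr * q (k t) a * (hit (be a) *
    ((w t a)%:R + \sum_(u | need u) (r u (f u t) a < tau u)%R%:R)
    + \sum_(u | need u) \sum_(a' | (a' != a) && (tau u <= r u (f u t) a')) hit (be a) * (be a' == be a)%:R)) <= _).
  apply: ler_avg => be; rewrite /qb -!mulrA ler_pM2l // mulrCA ler_wpM2l //.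
  set X1 := \sum_(u | _) _; set X2 := \sum_(u | _) _.
  have -> : X2 = hit (be a) * \sum_(u | need u) \sum_(a' | (a' != a) && (tau u <= r u (f u t) a')) (be a' == be a)%:R.
    by rewrite mulr_sumr; apply: eq_bigr => u _; rewrite mulr_sumr.
  rewrite -mulrDr; rewrite /hit /nerr /unbin /=; case: eqP => [E0|_]; rewrite ?mul0r // !mul1r [in leLHS]E0 /=.
  have X10 : 0 <= X1 by apply: sumr_ge0.
  set X3 := \sum_(u | _) _.
  have X30 : 0 <= X3 by apply: sumr_ge0 => u _; apply: sumr_ge0.
  case: (w t a) => /=; first by rewrite mulr1n -addrA lerDl addr_ge0.
  case: existsP => [[u /andP[nu_ /orP[ru|/existsP[a' /and3P[aa' be_ ru]]]]]|_]; last 1 first.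
  - by rewrite add0r addr_ge0.
  - rewrite add0r -[leLHS]addr0 lerD // /X1 (bigD1 u) //= ru lerDl; exact: sumr_ge0.
  - rewrite add0r -[leLHS]add0r lerD // /X3 (bigD1 u) //= (bigD1 a') /=; last by rewrite aa'.
    have -> : be a' == be a.
      move/eqP: be_ => [e1 e2]; apply/eqP; rewrite [LHS]surjective_pairing [RHS]surjective_pairing.
      by congr (_, _); apply: val_inj => //; rewrite E0.
    by rewrite -addrA lerDl addr_ge0 //; apply: sumr_ge0 => // ? _; apply: sumr_ge0.
rewrite avgZ avgD mulrDr; set Y := (w t a)%:R + _.
rewrite (eq_avg (G := fun be : {ffun A -> bin} => Y * hit (be a))); last by move=> be; rewrite mulrC.
rewrite avgZ [avg _]avg_hit mulrDr; apply: lerD.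
  by rewrite le_eqVlt; apply/orP; left; apply/eqP; move: (Fr) Fr0 => x x0; field; rewrite lt0r_neq0.
rewrite [X in _ * X]avg_sum -mulrA mulrCA ler_wpM2l // mulr_sumr; apply: ler_sum => u _.
rewrite avg_sum (eq_bigr (fun=> Fr^-1 * (M.+1%:R * Fr)^-1 * 1)); last first.
  by move=> a' /andP[aa' _]; rewrite mulr1; apply: avg_collide.
rewrite -mulr_sumr !mulrA mulfV ?gt_eqF // mul1r -(mulrA (tau u)) [leRHS]invfM mulrC ler_wpM2r //.
  by rewrite invr_ge0 mulr_ge0 // ltW.
apply: le_trans (few u (f u t)); rewrite [leRHS](bigID (fun a' => a' != a)) /=.
rewrite (eq_bigl (fun a' => (tau u <= r u (f u t) a') && (a' != a))) => [|a']; last by rewrite andbC.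
by rewrite lerDl; apply: sumr_ge0.
Qed.

(** Letters with [q] at most [kappa] have total variance at most [kappa * F], hence at most
    [sg ^+ 2]; the others are bounded in absolute value. *)
Let avg_dev s : Eb (fun be => `|1 - \sum_a qb be s a|) <= \sum_a q s a * (2 * (kappa < q s a)%R%:R) + sg.
Proof.
pose g a := q s a * (q s a <= kappa)%R%:R.
pose X (be : {ffun A -> bin}) a := Fr * hit (be a) - 1.
pose D be := \sum_a g a * X be a.
have gk a : g a ^+ 2 <= kappa * g a.
  rewrite expr2 /g; case: (leP (q s a) kappa) => h; rewrite ?mulr0 ?mulr1 //; exact: ler_wpM2r.
have g0 a : 0 <= g a by rewrite mulr_ge0.
(* The variance of [Fr * hit] is Fr - 1, which is [F]; distinct letters are binned independently. *)
have aXX a a' : Eb (fun be => X be a * X be a') = if a' == a then F%:R else 0.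
  case: eqP => [->|/eqP aa].
    rewrite /Eb (@eq_avg _ _ _ _ (fun be => (Fr ^+ 2 - 2 * Fr) * hit (be a) + 1)) => [|be].
      have -> : F%:R = Fr - 1 by rewrite /Fr -natr1 addrK.
      by rewrite avgD avg_const // avgZ [avg _]avg_hit; move: (Fr) Fr0 => x x0; field; rewrite lt0r_neq0.
    by rewrite /X /hit; case: eqP => _ /=; ring.
  rewrite /Eb (@eq_avg _ _ _ _ (fun be => Fr ^+ 2 * (hit (be a) * hit (be a')) + (- Fr * hit (be a) + (- Fr * hit (be a') + 1)))) => [|be].
    rewrite !avgD avg_const // !avgZ [avg (fun f => _ * _)]avg_hit2 // !(avg_hit : forall a, avg _ = _).
    by move: (Fr) Fr0 => x x0; field; rewrite lt0r_neq0.
  by rewrite /X; ring.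
have aD : Eb (fun be => D be ^+ 2) <= sg ^+ 2.
  rewrite /Eb (@eq_avg _ _ _ _ (fun be => \sum_a \sum_a' (g a * g a') * (X be a * X be a'))) => [|be]; last first.
    rewrite /D expr2 mulr_suml; apply: eq_bigr => a _; rewrite mulr_sumr; apply: eq_bigr => a' _; ring.
  rewrite avg_sum (eq_bigr (fun a => F%:R * g a ^+ 2)) => [|a _]; last first.
    rewrite avg_sum (bigD1 a) //= avgZ [avg _]aXX eqxx big1 ?addr0 => [|a' /negbTE aa]; first by rewrite mulrC expr2.
    by rewrite avgZ [avg _]aXX aa mulr0.
  apply: le_trans kF; rewrite -mulr_sumr mulrC ler_wpM2r //.
  apply: le_trans (ler_sum _ (fun a _ => gk a)) _; rewrite -mulr_sumr -[leRHS]mulr1 ler_pM2l //.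
  rewrite -(q1 s); apply: ler_sum => a _; rewrite /g -[leRHS]mulr1 ler_wpM2l //; by case: (q s a <= kappa).
(* |D| <= sg/2 + D^2/(2 sg) replaces the absolute value by the second moment; after averaging both
   halves are at most sg/2. *)
have dom be : `|1 - \sum_a qb be s a| <= (2^-1 * sg + (2 * sg)^-1 * D be ^+ 2)
    + \sum_a (q s a * (kappa < q s a)%R%:R) * (1 + Fr * hit (be a)).
  have -> : 1 - \sum_a qb be s a = - D be + \sum_a (q s a * (kappa < q s a)%R%:R) * (1 - Fr * hit (be a)).
    rewrite -{1}(q1 s) -sumrB /D -sumrN -big_split /=; apply: eq_bigr => a _; rewrite /qb /g /X.
    by case: (leP (q s a) kappa) => _ /=; ring.
  apply: le_trans (ler_normD _ _) _; rewrite normrN; apply: lerD.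
    have h : 0 <= (2 * sg)^-1 * (`|D be| - sg) ^+ 2 by rewrite mulr_ge0 ?sqr_ge0 // invr_ge0 mulr_ge0 // ltW.
    rewrite -(real_normK (num_real (D be))) -subr_ge0.
    by apply: le_trans h _; rewrite le_eqVlt; apply/orP; left; apply/eqP; field; rewrite gt_eqF.
  apply: le_trans (ler_norm_sum _ _ _) _; apply: ler_sum => a _; rewrite normrM ger0_norm ?mulr_ge0 //.
  rewrite ler_wpM2l ?mulr_ge0 //; apply: le_trans (ler_normB _ _) _.
  by rewrite normr1 ger0_norm // mulr_ge0 // ltW.
apply: le_trans (ler_avg dom) _; rewrite !avgD avg_const // avgZ avg_sum addrC; apply: lerD.
  rewrite le_eqVlt; apply/orP; left; apply/eqP; apply: eq_bigr => a _.
  rewrite avgZ avgD avg_const // avgZ [avg _]avg_hit.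
  by move: (Fr) Fr0 => x x0; field; rewrite lt0r_neq0.
apply: le_trans (_ : 2^-1 * sg + (2 * sg)^-1 * sg ^+ 2 <= _).
  by rewrite lerD2l ler_wpM2l // invr_ge0 mulr_ge0 // ltW.
by rewrite le_eqVlt; apply/orP; left; apply/eqP; field; rewrite gt_eqF.
Qed.

(** The letter of least failure mass does no worse than the average over the codebook with weights
    [qb]. These weights sum only approximately to 1, and the defect is charged to [avg_dev]. The
    event [w] is failure later in the tree. *)
Lemma node_binning : exists (be : A -> nat * nat) (rho : S -> A),
  (forall a, ((be a).1 < M.+1)%N) /\
  \sum_t nu t * (w t (rho (k t)) || nerr be t (rho (k t)))%:R
  <= \sum_t nu t * \sum_a q (k t) a * ((w t a)%:R + nmiss (k t) t a) + nconst * \sum_t nu t.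
Proof.
pose c be t a : R := (w t a || nerr (unbin \o be) t a)%:R.
pose N (be : {ffun A -> bin}) s := \sum_a qb be s a.
pose tot (be : {ffun A -> bin}) := \sum_t nu t * (\sum_a qb be (k t) a * c be t a + `|1 - N be (k t)|).
have [be hbe] := @avg_exists R A _ B0 tot.
pose C s a := \sum_(t | k t == s) nu t * c be t a.
pose rho s := [arg min_(a < a0) C s a]%O.
exists (unbin \o be), rho; split=> [a|]; first exact: ltn_ord.
apply: le_trans (_ : tot be <= _).
  rewrite (partition_big k xpredT) //= /tot [leRHS](partition_big k xpredT) //=; apply: ler_sum => s _.
  rewrite (eq_bigr (fun t => nu t * c be t (rho s))) => [|t /eqP -> //].
  rewrite -/(C s (rho s)).
  have minC a : C s (rho s) <= C s a by rewrite /rho; case: arg_minP => // b _; apply.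
  have C0 : 0 <= C s (rho s) by apply: sumr_ge0 => t _; rewrite mulr_ge0.
  have C1 : C s (rho s) <= \sum_(t | k t == s) nu t.
    by apply: ler_sum => t _; rewrite -[leRHS]mulr1 ler_wpM2l // /c; case: (_ || _).
  rewrite (eq_bigr (fun t => \sum_a qb be s a * (nu t * c be t a) + nu t * `|1 - N be s|)) => [|t /eqP ->]; last first.
    by rewrite mulrDr mulr_sumr; congr (_ + _); apply: eq_bigr => a _; rewrite mulrCA.
  rewrite big_split /= exchange_big /= -mulr_suml.
  apply: le_trans (_ : N be s * C s (rho s) + C s (rho s) * `|1 - N be s| <= _).
    rewrite mulrC -mulrDr -[leLHS]mulr1 ler_wpM2l // -lerBlDl; exact: ler_norm.
  apply: lerD; last by rewrite ler_wpM2r.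
  rewrite /N mulr_suml; apply: ler_sum => a _; rewrite -mulr_sumr ler_wpM2l //; last exact: minC.
  by rewrite /qb mulr_ge0 // mulr_ge0 // ltW.
apply: le_trans hbe _; rewrite /tot avg_sum mulr_sumr -big_split /=; apply: ler_sum => t _.
rewrite avgZ [nconst * _]mulrC -mulrDr ler_wpM2l // avgD.
apply: le_trans (lerD (avg_cost t) (avg_dev (k t))) _.
rewrite le_eqVlt; apply/orP; left; apply/eqP; rewrite /nconst /nmiss addrACA; congr (_ + _).
by rewrite -big_split; apply: eq_bigr => a _ /=; ring.
Qed.

End Node.

(** * Binning the whole tree of histories *)

Section Tree.
Variables (R : realType) (T S A : finType) (a0 : A) (key : nat -> T -> S) (f : bool -> T -> S).
Variables (need : nat -> pred bool) (tau : nat -> bool -> R) (kappa : nat -> R) (sg : R) (M F : nat -> nat).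
Hypotheses (tau0 : forall j u, 0 < tau j u) (kappa0 : forall j, 0 < kappa j) (sg0 : 0 < sg).
Hypothesis kF : forall j, kappa j * (F j)%:R <= sg ^+ 2.
Implicit Types (Q : seq A -> S -> A -> R) (r : seq A -> bool -> S -> A -> R).
Implicit Types (leaf : seq A -> T -> bool) (m : T -> R).
Implicit Types (rho : seq A -> S -> A) (be : seq A -> A -> nat * nat).

Fixpoint tbad d j r leaf rho be t : bool :=
  if d is d'.+1 then
    let a := rho [::] (key j t) in
    tbad d' j.+1 (fun h => r (a :: h)) (fun h => leaf (a :: h)) (fun h => rho (a :: h)) (fun h => be (a :: h)) t
    || nerr f (r [::]) (need j) (tau j) (be [::]) t a
  else leaf [::] t.

Fixpoint tcost d j Q r leaf m : R :=
  if d is d'.+1 then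
    \sum_a tcost d' j.+1 (fun h => Q (a :: h)) (fun h => r (a :: h)) (fun h => leaf (a :: h))
      (fun t => m t * Q [::] (key j t) a)
    + (\sum_t \sum_a m t * Q [::] (key j t) a
        * nmiss f (Q [::]) (r [::]) (need j) (tau j) (kappa j) (key j t) t a
      + nconst (need j) (tau j) sg (M j) (F j) * \sum_t m t)
  else \sum_t m t * (leaf [::] t)%:R.

Lemma tree_binning d j Q r leaf m : valid Q -> (forall t, 0 <= m t) ->
  (forall h u s a, 0 <= r h u s a) -> (forall h u s, \sum_a r h u s a <= 1) ->
  exists rho be, (forall h a, ((be h a).1 < (M (j + size h)).+1)%N) /\
    \sum_t m t * (tbad d j r leaf rho be t)%:R <= tcost d j Q r leaf m.
Proof.
elim: d j Q r leaf m => [|d IH] j Q r leaf m vQ m0 r0 r1.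
  by exists (fun _ _ => a0), (fun _ _ => (0, 0)%N).
pose ma a t := m t * Q [::] (key j t) a.
have /choice [rb hrb] : forall a, exists rb : (seq A -> S -> A) * (seq A -> A -> nat * nat),
   (forall h b, ((rb.2 h b).1 < (M (j.+1 + size h)).+1)%N) /\
   \sum_t ma a t * (tbad d j.+1 (fun h => r (a :: h)) (fun h => leaf (a :: h)) rb.1 rb.2 t)%:R
   <= tcost d j.+1 (fun h => Q (a :: h)) (fun h => r (a :: h)) (fun h => leaf (a :: h)) (ma a).
  move=> a; have [|t|||rho [be [h1 h2]]] := IH j.+1 (fun h => Q (a :: h)) (fun h => r (a :: h)) (fun h => leaf (a :: h)) (ma a).
  - exact: valid_shift.
  - by rewrite mulr_ge0 // vQ.1.
  - by move=> h; apply: r0.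
  - by move=> h; apply: r1.
  by exists (rho, be).
pose w t a := tbad d j.+1 (fun h => r (a :: h)) (fun h => leaf (a :: h)) (rb a).1 (rb a).2 t.
have [be [rho [beM hle]]] := node_binning a0 (key j) f (need j) (M j) w m0 (vQ.1 [::]) (vQ.2 [::])
  (r0 [::]) (r1 [::]) (tau0 j) sg0 (kappa0 j) (kF j).
exists (fun h => if h is a :: h' then (rb a).1 h' else rho), (fun h => if h is a :: h' then (rb a).2 h' else be).
split=> [[|b h] a /=|].
- by rewrite addn0.
- by rewrite -addSnnS; apply: (hrb b).1.
apply: le_trans hle _; rewrite [tcost _ _ _ _ _ _]/= addrA lerD2r.
rewrite (eq_bigr (fun t => \sum_a ma a t * (w t a)%:R
   + \sum_a m t * Q [::] (key j t) a
        * nmiss f (Q [::]) (r [::]) (need j) (tau j) (kappa j) (key j t) t a)) => [|t _]; last first.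
  by rewrite mulr_sumr -big_split; apply: eq_bigr => a _ /=; rewrite /ma; ring.
rewrite big_split /= lerD2r exchange_big; apply: ler_sum => a _.
exact: (hrb a).2.
Qed.

Lemma tcostE d j Q r leaf m : valid Q ->
  tcost d j Q r leaf m = lsum d (fun h => \sum_t mu key j Q m h t * (leaf h t)%:R)
  + \sum_(i < d) (lsum i (fun h => \sum_t \sum_a mu key j Q m (rcons h a) t
        * nmiss f (Q h) (r h) (need (j + i)) (tau (j + i)) (kappa (j + i)) (key (j + i) t) t a)
      + nconst (need (j + i)) (tau (j + i)) sg (M (j + i)) (F (j + i)) * \sum_t m t).
Proof.
elim: d j Q r leaf m => [|d IH] j Q r leaf m vQ /=; first by rewrite big_ord0 addr0.
rewrite (eq_bigr _ (fun a _ => IH _ _ _ _ _ (valid_shift a vQ))) big_split /= -addrA; congr (_ + _).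
rewrite big_ord_recl /= addn0 addrC; congr (_ + _).
rewrite exchange_big /=; apply: eq_bigr => i _; rewrite big_split /= -[(j + _)%N]addSnnS; congr (_ + _).
rewrite -mulr_sumr; congr (_ * _); rewrite exchange_big; apply: eq_bigr => t _.
by rewrite -mulr_sumr vQ.2 mulr1.
Qed.

Lemma tbadP d j r leaf rho be t : ~~ tbad d j r leaf rho be t ->
  exists h, [/\ size h = d, ~~ leaf h t & forall i, (i < d)%N ->
    nth a0 h i = rho (take i h) (key (j + i) t) /\
    ~~ nerr f (r (take i h)) (need (j + i)) (tau (j + i)) (be (take i h)) t (nth a0 h i)].
Proof.
elim: d j r leaf rho be => [|d IH] j r leaf rho be /=; first by exists [::].
set a := rho _ _; rewrite negb_or => /andP[/IH [h [sh lh hh]] ne].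
exists (a :: h); split=> /=; [by rewrite sh | by [] | case=> [|i] id /=; first by rewrite addn0].
by rewrite -addSnnS; apply: hh.
Qed.

End Tree.

Lemma chebyshev_sum (R : realType) (Om : finType) (P : Om -> R) n (g : 'I_n -> Om -> R) (v dl : R) :
  (0 < n)%N -> 0 < dl -> (forall w, 0 <= P w) ->
  (forall i j, j != i -> \sum_w P w * (g i w * g j w) = 0) ->
  (forall i, \sum_w P w * (g i w * g i w) = v) ->
  \sum_w P w * (n%:R * dl <= `|\sum_i g i w|)%R%:R <= v / (n%:R * dl ^+ 2).
Proof.
move=> n0 d0 P0 orth var.
have nr : 0 < n%:R :> R by rewrite ltr0n.
have E : \sum_w P w * (\sum_i g i w) ^+ 2 = n%:R * v.
  rewrite (eq_bigr (fun w => \sum_i \sum_j P w * (g i w * g j w))) => [|w _]; last first.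
    rewrite expr2 mulr_suml mulr_sumr; apply: eq_bigr => i _.
    by rewrite mulr_sumr mulr_sumr.
  rewrite exchange_big /= (eq_bigr (fun=> v)) => [|i _]; last first.
    by rewrite exchange_big (bigD1 i) //= var big1 ?addr0 // => j ij; apply: orth.
  by rewrite sumr_const card_ord -[LHS]mulr_natl.
have -> : v / (n%:R * dl ^+ 2) = (n%:R * v) / (n%:R * dl) ^+ 2.
  by field; rewrite !lt0r_neq0.
rewrite -E mulr_suml; apply: ler_sum => w _; rewrite -mulrA ler_wpM2l //.
have nd : 0 < n%:R * dl by rewrite mulr_gt0.
case: (leP (n%:R * dl)) => h /=; last by rewrite mulr_ge0 ?sqr_ge0 // invr_ge0 sqr_ge0.
by rewrite ler_pdivlMr ?exprn_gt0 // mul1r -(real_normK (num_real (\sum_i _))) lerXn2r ?nnegrE // ltW.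
Qed.

(** * The product protocol and the law of large numbers *)

Section Product.
Variables (R : realType) (T S A : finType) (key : nat -> T -> S).
Variables (Q : seq A -> S -> A -> R) (p : T -> R).
Hypotheses (vQ : valid Q) (p0 : forall t, 0 <= p t) (p1 : \sum_t p t = 1).
Variable n : nat.

Definition coordh (B : Type) (i : 'I_n) (h : seq (n.-tuple B)) : seq B := [seq tnth a i | a <- h].

Definition Qn (h : seq (n.-tuple A)) (s : n.-tuple S) (a : n.-tuple A) : R :=
  \prod_i Q (coordh i h) (tnth s i) (tnth a i).

Definition keyn j (t : n.-tuple T) : n.-tuple S := map_tuple (key j) t.

Lemma valid_Qn : valid Qn.
Proof.
split=> [h s a|h s]; first by apply: prodr_ge0 => i _; apply: vQ.1.
by rewrite (sum_tuple_prod (fun i => Q (coordh i h) (tnth s i))) big1 // => i _; apply: vQ.2.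
Qed.

Lemma mu_Qn h t : mu keyn 0 Qn (prodm p (n := n)) h t = \prod_i mu key 0 Q p (coordh i h) (tnth t i).
Proof.
elim/last_ind: h => [//|h a IH]; rewrite mu_rcons IH -big_split; apply: eq_bigr => i _ /=.
by rewrite [coordh i (rcons h a)]map_rcons mu_rcons tnth_map size_map.
Qed.

Lemma lsum_prod_seq d (g : 'I_n -> seq A -> R) :
  lsum d (fun h => \prod_i g i (coordh i h)) = \prod_i lsum d (g i).
Proof.
elim: d g => [//|d IH] g /=.
rewrite (eq_bigr _ (fun a _ => IH (fun i h => g i (tnth a i :: h)))).
exact: (sum_tuple_prod (fun i x => lsum d (fun h => g i (x :: h)))).
Qed.

Lemma lsum_prod d (G : 'I_n -> seq A -> T -> R) :
  lsum d (fun h => \sum_(t : n.-tuple T) \prod_i G i (coordh i h) (tnth t i))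
  = \prod_i lsum d (fun h => \sum_t G i h t).
Proof.
rewrite -lsum_prod_seq; apply: eq_lsum => h _.
exact: (sum_tuple_prod (fun i => G i (coordh i h))).
Qed.

Lemma mu_total d : lsum d (fun h => \sum_t mu key 0 Q p h t) = 1.
Proof.
transitivity (lsum (0 + d) (fun h => \sum_t mu key 0 Q p h t * 1)).
  by apply: eq_lsum => h _; apply: eq_bigr => t _; rewrite mulr1.
rewrite (lsum_mu_take key 0 p 0 d (fun _ _ => 1) vQ) /=.
by under eq_bigr do rewrite mulr1.
Qed.

(** Under the product protocol the pairs of a coordinate's letter and history are independent
    copies, so expectations of products factor and centered terms are orthogonal. *)
Lemma mu_lln d (g : seq A -> T -> R) (e dl : R) : (0 < n)%N -> 0 < dl ->
  lsum d (fun h => \sum_t mu key 0 Q p h t * g h t) = e ->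
  lsum d (fun h => \sum_t mu keyn 0 Qn (prodm p (n := n)) h t
     * (n%:R * dl <= `|\sum_i g (coordh i h) (tnth t i) - n%:R * e|)%R%:R)
  <= lsum d (fun h => \sum_t mu key 0 Q p h t * (g h t - e) ^+ 2) / (n%:R * dl ^+ 2).
Proof.
move=> n0 d0 Ee.
set v := lsum d (fun h => \sum_t mu key 0 Q p h t * (g h t - e) ^+ 2).
pose Om : finType := (d.-tuple (n.-tuple A) * n.-tuple T)%type.
pose P (w : Om) := mu keyn 0 Qn (prodm p (n := n)) w.1 w.2.
have EO (G : seq (n.-tuple A) -> n.-tuple T -> R) :
    \sum_(w : Om) P w * G w.1 w.2 = lsum d (fun h => \sum_t mu keyn 0 Qn (prodm p (n := n)) h t * G h t).
  by rewrite lsum_tuple pair_big.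
pose c h t := g h t - e.
pose gi i (w : Om) := c (coordh i w.1) (tnth w.2 i).
have prodE (G : 'I_n -> seq A -> T -> R) :
    \sum_(w : Om) P w * \prod_i G i (coordh i w.1) (tnth w.2 i)
    = \prod_i lsum d (fun h => \sum_t mu key 0 Q p h t * G i h t).
  rewrite (EO (fun h t => \prod_i G i (coordh i h) (tnth t i))) -lsum_prod.
  by apply: eq_lsum => h _; apply: eq_bigr => t _; rewrite mu_Qn -big_split.
have c0 : lsum d (fun h => \sum_t mu key 0 Q p h t * c h t) = 0.
  transitivity (lsum d (fun h => \sum_t mu key 0 Q p h t * g h t - e * \sum_t mu key 0 Q p h t)).
    apply: eq_lsum => h _; rewrite mulr_sumr -sumrB; apply: eq_bigr => t _; rewrite /c; ring.
  by rewrite lsumB lsumZ mu_total mulr1 Ee subrr.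
have := @chebyshev_sum R Om P n gi v dl n0 d0.
rewrite -(EO (fun h t => (n%:R * dl <= `|\sum_i g (coordh i h) (tnth t i) - n%:R * e|)%R%:R)).
rewrite [X in _ -> X <= _](eq_bigr (fun w => P w * (n%:R * dl <= `|\sum_i gi i w|)%R%:R)) => [|w _]; last first.
  by congr (_ * (_ <= `|_|)%R%:R); rewrite /gi /c sumrB sumr_const card_ord -[e *+ n]mulr_natl.
apply.
- by move=> w; apply: mu_ge0 => [|t]; [exact: valid_Qn | exact: prodm_ge0].
- move=> i j ij.
  pose G l := if l == i then c else if l == j then c else fun _ _ => 1.
  transitivity (\sum_(w : Om) P w * \prod_l G l (coordh l w.1) (tnth w.2 l)).
    apply: eq_bigr => w _; congr (_ * _); rewrite (bigD1 i) //= (bigD1 j) //= /G eqxx (negbTE ij) eqxx.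
    by rewrite big1 ?mulr1 // => l /andP[/negbTE -> /negbTE ->].
  by rewrite prodE (bigD1 i) //= /G eqxx c0 mul0r.
- move=> i.
  pose G l := if l == i then (fun h t => c h t ^+ 2) else fun _ _ => 1.
  transitivity (\sum_(w : Om) P w * \prod_l G l (coordh l w.1) (tnth w.2 l)).
    apply: eq_bigr => w _; congr (_ * _); rewrite (bigD1 i) //= /G eqxx.
    by rewrite big1 ?mulr1 ?expr2 // => l /negbTE ->.
  rewrite prodE (bigD1 i) //= /G eqxx big1 ?mulr1 // => l /negbTE ->.
  by rewrite -[RHS](mu_total d); apply: eq_lsum => h _; apply: eq_bigr => t _; rewrite mulr1.
Qed.

End Product.

Section Typicality.
Variables (R : realType) (T S A : finType) (key : nat -> T -> S).
Variables (Q : seq A -> S -> A -> R) (p : T -> R).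
Hypotheses (vQ : valid Q) (p0 : forall t, 0 <= p t) (p1 : \sum_t p t = 1).
Notation m := (mu key 0 Q p).
Notation mn n := (mu (keyn key (n := n)) 0 (@Qn R S A Q n) (prodm p (n := n))).

Lemma mn_ge0 n h t : 0 <= mn n h t.
Proof. by apply: mu_ge0 => [|w]; [exact: valid_Qn | exact: prodm_ge0]. Qed.

Lemma mn_gt0 n h t i : mn n h t != 0 -> 0 < m (coordh i h) (tnth t i).
Proof.
rewrite mu_Qn => /prodf_neq0/(_ i isT); rewrite lt0r => -> /=.
exact: mu_ge0.
Qed.

Lemma mean_concentration d (g : seq A -> T -> R) (e dl : R) : 0 < dl ->
  lsum d (fun h => \sum_t m h t * g h t) = e ->
  exists C, forall n, (0 < n)%N ->
    lsum d (fun h => \sum_t mn n h t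
      * (~~ (n%:R * (e - dl) <= \sum_i g (coordh i h) (tnth t i) <= n%:R * (e + dl)))%:R) <= C / n%:R.
Proof.
move=> d0 Ee; exists (lsum d (fun h => \sum_t m h t * (g h t - e) ^+ 2) / dl ^+ 2) => n n0.
rewrite -mulrA -invfM [_ * n%:R]mulrC.
apply: le_trans (mu_lln vQ p0 p1 n0 d0 Ee).
apply: ler_lsum => h _; apply: ler_sum => t _; apply: ler_wpM2l; first exact: mn_ge0.
set s := \sum_i _; case: (boolP (_ <= s <= _)) => // h1.
have -> : (n%:R * dl <= `|s - n%:R * e|) => //.
rewrite leNgt; apply: contra h1; rewrite ltr_norml => /andP[h1 h2].
by rewrite !(mulrDr, mulrN); apply/andP; split; lra.
Qed.

Lemma typical_product d (phi : seq A -> T -> R) (e dl : R) : 0 < dl ->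
  (forall h t, size h = d -> 0 < m h t -> 0 < phi h t) ->
  lsum d (fun h => \sum_t m h t * ln (phi h t)) = e ->
  exists C, forall n, (0 < n)%N ->
    lsum d (fun h => \sum_t mn n h t
      * (~~ (expR (n%:R * (e - dl)) <= \prod_i phi (coordh i h) (tnth t i) <= expR (n%:R * (e + dl))))%:R)
    <= C / n%:R.
Proof.
move=> d0 phi0 Ee; have [C hC] := mean_concentration d0 Ee.
exists C => n n0; apply: le_trans (hC n n0).
apply: ler_lsum => h sh; apply: ler_sum => t _.
(* Off the support some factor may vanish; on it all are positive and the logarithm of the product
   is the sum. *)
case: (eqVneq (mn n h t) 0) => [->|nz]; first by rewrite !mul0r.
rewrite ler_wpM2l ?mn_ge0 //.
have ph i : 0 < phi (coordh i h) (tnth t i) by apply: phi0; rewrite ?size_map // mn_gt0.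
have P0 : 0 < \prod_i phi (coordh i h) (tnth t i) by apply: prodr_gt0.
have -> : \prod_i phi (coordh i h) (tnth t i) = expR (\sum_i ln (phi (coordh i h) (tnth t i))).
  by rewrite -ln_prod // lnK.
by rewrite !ler_expR.
Qed.

End Typicality.

Section Likelihood.
Variables (R : realType) (T S A : finType) (a0 : A) (key : nat -> T -> S) (f : bool -> T -> S).
Variables (Q : seq A -> S -> A -> R) (p : T -> R).
Hypotheses (vQ : valid Q) (p0 : forall t, 0 <= p t) (p1 : \sum_t p t = 1).
Notation m := (mu key 0 Q p).

(* The conditional law of the next letter given the history, as seen by user [u]. *)
Definition ulik h u s a : R := marg (f u) (m (rcons h a)) s / marg (f u) (m h) s.

Let m0 h t : 0 <= m h t. Proof. exact: mu_ge0. Qed.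

Lemma ulik_ge0 h u s a : 0 <= ulik h u s a.
Proof. by rewrite /ulik divr_ge0 // marg_ge0. Qed.

Lemma ulik_sum h u s : \sum_a ulik h u s a <= 1.
Proof.
rewrite -mulr_suml /marg exchange_big /=.
under eq_bigr do rewrite sum_mu_rcons //.
rewrite -/(marg (f u) (m h) s); case: (eqVneq (marg (f u) (m h) s) 0) => [->|nz].
  by rewrite mul0r.
by rewrite divff.
Qed.

Lemma marg_gt0 h u t : 0 < m h t -> 0 < marg (f u) (m h) (f u t).
Proof.
move=> ht; rewrite /marg (bigD1 t) //=; apply: ltr_wpDr => //; exact: sumr_ge0.
Qed.

Lemma mu_rcons_gt0 h a t : 0 < m (rcons h a) t -> 0 < m h t /\ 0 < Q h (key (size h) t) a.
Proof.
rewrite mu_rcons add0n => h0; split; rewrite lt0r ?m0 ?vQ.1 andbT.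
  by apply: contraTneq h0 => ->; rewrite mul0r ltxx.
by apply: contraTneq h0 => ->; rewrite mulr0 ltxx.
Qed.

(** Reads a function of a history and its next letter as a function of a history of length [j.+1],
    the form the concentration lemmas take. *)
Definition stepf j (g : seq A -> T -> A -> R) (h : seq A) t : R := g (take j h) t (last a0 h).

Lemma stepf_rcons j g h a t : size h = j -> stepf j g (rcons h a) t = g h t a.
Proof. by move=> <-; rewrite /stepf last_rcons -cats1 take_size_cat. Qed.

Lemma mean_ln_ulik j u :
  lsum j.+1 (fun h => \sum_t m h t * ln (stepf j (fun h t a => ulik h u (f u t) a) h t))
  = - (lent key Q p (f u) j.+1 - lent key Q p (f u) j).
Proof.
rewrite /lent lsum_rcons lsum_rcons -lsumB -lsumN; apply: eq_lsum => h sh.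
rewrite (eq_bigr (fun a => \sum_t (m (rcons h a) t * ln (marg (f u) (m (rcons h a)) (f u t))
   - m (rcons h a) t * ln (marg (f u) (m h) (f u t))))) => [|a _]; last first.
  apply: eq_bigr => t _; rewrite stepf_rcons // /ulik.
  case: (eqVneq (m (rcons h a) t) 0) => [->|nz]; first by rewrite !mul0r subrr.
  have h1 : 0 < m (rcons h a) t by rewrite lt0r nz m0.
  have [h2 _] := mu_rcons_gt0 h1.
  by rewrite ln_div ?posrE ?marg_gt0 // mulrBr.
rewrite opprB hentE (eq_bigr (fun a => - hent (f u) (m (rcons h a))
   - \sum_t m (rcons h a) t * ln (marg (f u) (m h) (f u t)))) => [|a _]; last first.
  by rewrite sumrB hentE opprK.
rewrite sumrB sumrN addrC; congr (- _ - _); rewrite exchange_big; apply: eq_bigr => t _.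
by rewrite -mulr_suml sum_mu_rcons.
Qed.

Lemma mean_ln_Q j :
  lsum j.+1 (fun h => \sum_t m h t * ln (stepf j (fun h t a => Q h (key j t) a) h t)) = - lentQ key Q p j.
Proof.
rewrite /lentQ opprK lsum_rcons; apply: eq_lsum => h sh; rewrite exchange_big.
by apply: eq_bigr => t _; apply: eq_bigr => a _; rewrite stepf_rcons.
Qed.

Lemma stepf_ulik_gt0 j u h t : size h = j.+1 -> 0 < m h t ->
  0 < stepf j (fun h t a => ulik h u (f u t) a) h t.
Proof.
case/lastP: h => // h a; rewrite size_rcons => -[sh] h0; rewrite stepf_rcons //.
have [h1 _] := mu_rcons_gt0 h0.
by rewrite /ulik divr_gt0 // marg_gt0.
Qed.

Lemma stepf_Q_gt0 j h t : size h = j.+1 -> 0 < m h t -> 0 < stepf j (fun h t a => Q h (key j t) a) h t.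
Proof.
case/lastP: h => // h a; rewrite size_rcons => -[sh] h0; rewrite stepf_rcons // -sh.
by have [_] := mu_rcons_gt0 h0.
Qed.

Lemma stepf_coordh n j (g : seq A -> T -> A -> R) (h : seq (n.-tuple A)) (a : n.-tuple A) (t : n.-tuple T) i : size h = j ->
  stepf j g (coordh i (rcons h a)) (tnth t i) = g (coordh i h) (tnth t i) (tnth a i).
Proof. by move=> sh; rewrite [coordh i _]map_rcons stepf_rcons // size_map. Qed.

End Likelihood.

Lemma expRN_le_inv (R : realType) (x : R) : 0 < x -> expR (- x) <= x^-1.
Proof.
move=> x0; rewrite expRN lef_pV2 ?posrE ?expR_gt0 //.
by apply: le_trans (expR_ge1Dx x); rewrite lerDr.
Qed.

(** * Choice of thresholds and codebook sizes *)

Section Codebook.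
Variables (R : realType) (T S A : finType) (a0 : A) (key : nat -> T -> S) (f : bool -> T -> S).
Variables (Q : seq A -> S -> A -> R) (p : T -> R).
Hypotheses (vQ : valid Q) (p0 : forall t, 0 <= p t) (p1 : \sum_t p t = 1).
Variables (need : nat -> pred bool) (N : nat) (rate : nat -> R) (dl : R) (gx gz : seq A -> T -> R).
Hypothesis dl0 : 0 < dl.

Definition gainH u j : R := lent key Q p (f u) j.+1 - lent key Q p (f u) j.

Hypothesis rateP : forall j u, need j u -> gainH u j - lentQ key Q p j <= rate j.

Notation m := (mu key 0 Q p).
Notation mn n := (mu (keyn key (n := n)) 0 (@Qn R S A Q n) (prodm p (n := n))).
Notation HQ := (lentQ key Q p).
Notation lik := (ulik key f Q p).
Let ex := lsum N (fun h => \sum_t m h t * gx h t).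
Let ez := lsum N (fun h => \sum_t m h t * gz h t).

(** Here and below [tau] and [kappa] lie one [dl] beyond the typical exponents. The sizes are
    balanced so that [kappa * F] is at most exp(-n dl), the square of [csg], and so that tau
    (M+1)(F+1) is at least exp(n dl): the shifts add up to -1 + 4 - 2 = 1. *)
Definition ctau n j u : R := expR (n%:R * (- gainH u j - dl)).
Definition ckappa n j : R := expR (n%:R * (- HQ j + dl)).
Definition csg n : R := expR (- (n%:R * dl / 2)).
Definition cF n j : nat := Num.truncn (expR (n%:R * (HQ j - 2 * dl))).
Definition cM n j : nat := Num.truncn (expR (n%:R * (rate j + 4 * dl))).
Definition ulikn n (h : seq (n.-tuple A)) u (s : n.-tuple S) (a : n.-tuple A) : R :=
  \prod_i lik (coordh i h) u (tnth s i) (tnth a i).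
Definition fn n u (t : n.-tuple T) : n.-tuple S := map_tuple (f u) t.
Definition cleaf n (h : seq (n.-tuple A)) (t : n.-tuple T) : bool :=
  ~~ (\sum_i gx (coordh i h) (tnth t i) <= n%:R * (ex + dl))
  || ~~ (\sum_i gz (coordh i h) (tnth t i) <= n%:R * (ez + dl)).

Lemma ckappa_cF n j : ckappa n j * (cF n j)%:R <= csg n ^+ 2.
Proof.
apply: le_trans (_ : ckappa n j * expR (n%:R * (HQ j - 2 * dl)) <= _).
  by rewrite ler_wpM2l ?expR_ge0 // /cF truncn_le expR_ge0.
by rewrite /ckappa /csg expr2 -!expRD ler_expR le_eqVlt; apply/orP; left; apply/eqP; field.
Qed.

(** exp(-x) <= 1/x turns the exponentials into 1/n. The two possible listeners give 2/(n dl), and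
    [csg] gives another 2/(n dl). *)
Lemma nconst_le n j : (0 < n)%N -> nconst (need j) (ctau n j) (csg n) (cM n j) (cF n j) <= 4 / dl / n%:R.
Proof.
move=> n0; have nr : 0 < n%:R :> R by rewrite ltr0n.
have nd : 0 < n%:R * dl by rewrite mulr_gt0.
rewrite /nconst; have -> : 4 / dl / n%:R = 2 * (n%:R * dl)^-1 + (n%:R * dl / 2)^-1.
  by field; rewrite !lt0r_neq0.
apply: lerD; last by apply: expRN_le_inv; rewrite divr_gt0.
apply: le_trans (_ : \sum_(u : bool) (n%:R * dl)^-1 <= _); last by rewrite big_bool /=; lra.
rewrite [leRHS](bigID (need j)) /= -[leLHS]addr0; apply: lerD; last first.
  by apply: sumr_ge0 => u _; rewrite invr_ge0 ltW.
apply: ler_sum => u nu; apply: le_trans (expRN_le_inv nd); rewrite expRN lef_pV2 ?posrE ?expR_gt0 //; last first.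
  by rewrite !mulr_gt0 ?expR_gt0 // ltr0n.
apply: le_trans (_ : ctau n j u * expR (n%:R * (rate j + 4 * dl)) * expR (n%:R * (HQ j - 2 * dl)) <= _); last first.
  apply: ler_pM; rewrite ?mulr_ge0 ?expR_ge0 //; last by apply: ltW; apply: truncnS_gt.
  by rewrite ler_pM2l ?expR_gt0 //; apply: ltW; apply: truncnS_gt.
rewrite -!expRD ler_expR -!mulrDr ler_pM2l //.
have := rateP nu; lra.
Qed.

Lemma miss_bound j : exists C, forall n, (0 < n)%N ->
  lsum j (fun h => \sum_t \sum_a mn n (rcons h a) t
     * nmiss (fn (n := n)) (Qn Q h) (ulikn h) (need j) (ctau n j) (ckappa n j) (keyn key j t) t a) <= C / n%:R.
Proof.
pose stl u := stepf a0 j (fun h t a => lik h u (f u t) a).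
pose stq := stepf a0 j (fun h t a => Q h (key j t) a).
have /choice [Cr hCr] u := typical_product vQ p0 p1 dl0
   (fun h t => @stepf_ulik_gt0 R T S A a0 key f Q p vQ p0 j u h t) (mean_ln_ulik a0 key f vQ p0 j u).
have [CQ hCQ] := typical_product vQ p0 p1 dl0
   (fun h t => @stepf_Q_gt0 R T S A a0 key Q p vQ p0 j h t) (mean_ln_Q a0 key Q p j).
exists (\sum_(u | need j u) Cr u + 2 * CQ) => n n0.
pose B1 u (h : seq (n.-tuple A)) t : R := (~~ (expR (n%:R * (- gainH u j - dl)) <=
   \prod_i stl u (coordh i h) (tnth t i) <= expR (n%:R * (- gainH u j + dl))))%:R.
pose B2 (h : seq (n.-tuple A)) t : R := (~~ (expR (n%:R * (- HQ j - dl)) <=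
   \prod_i stq (coordh i h) (tnth t i) <= expR (n%:R * (- HQ j + dl))))%:R.
apply: le_trans (_ : lsum j.+1 (fun h => \sum_t mn n h t * (\sum_(u | need j u) B1 u h t + 2 * B2 h t)) <= _).
  rewrite lsum_rcons; apply: ler_lsum => h sh; rewrite exchange_big; apply: ler_sum => a _; apply: ler_sum => t _.
  rewrite ler_wpM2l ?mn_ge0 // /nmiss; apply: lerD.
    apply: ler_sum => u _; rewrite /B1.
    have -> : \prod_i stl u (coordh i (rcons h a)) (tnth t i) = ulikn h u (fn u t) a.
      by apply: eq_bigr => i _; rewrite /stl stepf_coordh // tnth_map.
    by rewrite ltNge negb_and; case: (ctau n j u <= _).
  rewrite ler_pM2l // /B2.
  have -> : \prod_i stq (coordh i (rcons h a)) (tnth t i) = Qn Q h (keyn key j t) a.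
    by apply: eq_bigr => i _; rewrite /stq stepf_coordh // tnth_map.
  by rewrite ltNge negb_and orbC; case: (_ <= ckappa n j).
rewrite (eq_lsum (G := fun h => \sum_(u | need j u) \sum_t mn n h t * B1 u h t
   + 2 * \sum_t mn n h t * B2 h t)); last first.
  move=> h _; rewrite exchange_big mulr_sumr -big_split; apply: eq_bigr => t _ /=.
  by rewrite mulrDr mulr_sumr mulrCA.
rewrite lsumD lsumZ [leRHS]mulrDl -[2 * CQ / _]mulrA; apply: lerD; last by rewrite ler_pM2l //; apply: hCQ.
rewrite (eq_lsum (G := fun h => \sum_u (if need j u then \sum_t mn n h t * B1 u h t else 0))); last first.
  by move=> h _; rewrite big_mkcond.
rewrite lsum_sum mulr_suml [leRHS]big_mkcond; apply: ler_sum => u _.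
by case: ifP => _; [apply: hCr | rewrite lsum0].
Qed.

Lemma good_code : exists C, forall n, (0 < n)%N -> exists rho be,
  (forall h a, ((be h a).1 < (cM n (size h)).+1)%N) /\
  \sum_(t : n.-tuple T) prodm p t * (tbad (keyn key (n := n)) (fn (n := n)) need (ctau n) N 0
     (@ulikn n) (@cleaf n) rho be t)%:R <= C / n%:R.
Proof.
have [Cx hx] := mean_concentration vQ p0 p1 dl0 (erefl ex).
have [Cz hz] := mean_concentration vQ p0 p1 dl0 (erefl ez).
have /choice [Cj hj] := miss_bound.
exists (Cx + Cz + \sum_(j < N) (Cj j + 4 / dl)) => n n0.
have vn : valid (@Qn R S A Q n) by apply: valid_Qn.
have pn0 (t : n.-tuple T) : 0 <= prodm p t by apply: prodm_ge0.
have r0 (h : seq (n.-tuple A)) u s a : 0 <= ulikn h u s a by apply: prodr_ge0 => i _; apply: ulik_ge0.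
have r1 (h : seq (n.-tuple A)) u s : \sum_a ulikn h u s a <= 1.
  rewrite (sum_tuple_prod (fun i => lik (coordh i h) u (tnth s i))).
  by apply: prodr_ile1 => i _; rewrite ulik_sum // andbT; apply: sumr_ge0 => a _; apply: ulik_ge0.
have t0 j u : 0 < ctau n j u by apply: expR_gt0.
have k0 j : 0 < ckappa n j by apply: expR_gt0.
have s0 : 0 < csg n by apply: expR_gt0.
have [rho [be [h1 h2]]] := tree_binning [tuple a0 | _ < n] (keyn key (n := n)) (fn (n := n)) need (cM n)
  t0 k0 s0 (ckappa_cF n) N 0 (@cleaf n) vn pn0 r0 r1.
exists rho, be; split; first by move=> h a; apply: h1.
apply: le_trans h2 _; rewrite tcostE // mulrDl; apply: lerD.
  rewrite mulrDl; apply: le_trans (lerD (hx n n0) (hz n n0)); rewrite -lsumD; apply: ler_lsum => h _.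
  rewrite -big_split; apply: ler_sum => t _ /=; rewrite -mulrDr ler_wpM2l ?mn_ge0 //.
  have bl (a b c d : bool) : (~~ b || ~~ d)%:R <= (~~ (a && b))%:R + (~~ (c && d))%:R :> R.
    by case: a b c d => [] [] [] [] /=; lra.
  exact: bl.
rewrite mulr_suml; apply: ler_sum => j _; rewrite add0n [leRHS]mulrDl; apply: lerD; first exact: hj.
by rewrite sum_prodm // mulr1; apply: nconst_le.
Qed.

End Codebook.

(** * Decoders and the block code *)

Section Decoder.
Variables (R : realType) (T S A : finType) (a0 : A) (key : nat -> T -> S) (f : bool -> T -> S).
Variables (need : nat -> pred bool) (tau : nat -> bool -> R) (r : seq A -> bool -> S -> A -> R).
Variables (rho : seq A -> S -> A) (be : seq A -> A -> nat * nat).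

Definition dec j u h s (c : nat) : A :=
  odflt a0 [pick a | (be h a == (c, 0%N)) && (tau j u <= r h u s a)].

(** A user decodes the letters of the others and recomputes its own, which is possible because [rho]
    is deterministic. *)
Fixpoint uhist u s (msg : nat -> nat) L : seq A :=
  if L is L'.+1 then
    let h := uhist u s msg L' in
    rcons h (if need L' u then dec L' u h s (msg L') else rho h s)
  else [::].

Lemma size_uhist u s msg L : size (uhist u s msg L) = L.
Proof. by elim: L => //= L IH; rewrite size_rcons IH. Qed.

Lemma uhist_correct d t h u msg L : size h = d ->
  (forall i, (i < d)%N -> nth a0 h i = rho (take i h) (key i t) /\
    ~~ nerr f (r (take i h)) (need i) (tau i) (be (take i h)) t (nth a0 h i)) ->
  (L <= d)%N ->
  (forall j, (j < L)%N -> ~~ need j u -> key j t = f u t) ->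
  (forall j, (j < L)%N -> need j u -> msg j = (be (take j h) (nth a0 h j)).1) ->
  uhist u (f u t) msg L = take L h.
Proof.
move=> sh good; elim: L => [|L IH] Ld hk hm /=; first by rewrite take0.
rewrite IH ?(ltnW Ld) //; last 2 first.
- by move=> j jL; apply: hk; rewrite ltnS ltnW.
- by move=> j jL; apply: hm; rewrite ltnS ltnW.
rewrite (take_nth a0) ?sh //; congr (rcons _ _).
have [hL1 hL2] := good L Ld; case: ifPn => nd; last by rewrite hL1 hk.
set a := nth a0 h L in hL1 hL2 *; set g := take L h in hL1 hL2 *.
move: hL2; rewrite /nerr negb_or negbK => /andP[/eqP b0 /existsPn /(_ u)].
rewrite nd /= negb_or -leNgt => /andP[ra /existsPn un].
rewrite /dec hm // -/a -/g; case: pickP => [a' /andP[/eqP be' ra']|/(_ a)] /=; last first.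
  by rewrite ra andbT -b0 -surjective_pairing eqxx.
apply/eqP; apply: contraT => aa; have := un a'.
by rewrite aa ra' be' -b0 -surjective_pairing eqxx.
Qed.

End Decoder.

Lemma eq_lent_rel (R : realType) (T S A B C : finType) (key : nat -> T -> S) (Q : seq A -> S -> A -> R) p
    (f : T -> B) (g : T -> C) j :
  (forall t t', (f t == f t') = (g t == g t')) -> lent key Q p f j = lent key Q p g j.
Proof.
move=> fg; apply: eq_lsum => h _; rewrite !hentE; congr (- _); apply: eq_bigr => t _.
by congr (_ * ln _); apply: eq_bigl => t'; apply: fg.
Qed.

Section Rates.
Variables (R : realType) (X Y Z A : finType).
Variables (pxy : X -> Y -> R) (pzx : X -> Z -> R).
Hypothesis hp : is_source pxy pzx.
Notation T := (src X Y Z).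
Notation p := (psrc pxy pzx).
Variable (Q : seq A -> skey X Y Z -> A -> R).
Hypothesis vQ : valid Q.
Notation L := (lent (@key X Y Z) Q p).
Notation H := (gainH (@key X Y Z) (@ukey X Y Z) Q p).
Notation HQ := (lentQ (@key X Y Z) Q p).

(** User Z speaks at odd stages, where user X ([true]) listens; both listen to the helper. So
    [odd j] names the listener, and at stage 0 it selects user Z, for whom the helper's rate is
    set. *)
Definition needs (j : nat) (u : bool) : bool := (j == 0%N) || (u == odd j).
Definition srate j : R := H (odd j) j - HQ j.

Let p0 := psrc_ge0 hp.
Let p1 := psrc1 hp.

Lemma lent_ukey_x j : L (ukey true) j = L (@sx X Y Z) j.
Proof. by apply: eq_lent_rel => t t'; rewrite ukey_eq. Qed.

Lemma lent_ukey_z j : L (ukey false) j = L (@sz X Y Z) j.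
Proof. by apply: eq_lent_rel => t t'; rewrite ukey_eq. Qed.

(** Reweighting the source by a function of Y leaves p(z|x) intact, so H(Z|X) stays an average of
    fixed entropies. It is used with the constant 1 and with the kernel of the first letter. *)
Lemma hent_sxz (c : Y -> R) : (forall y, 0 <= c y) ->
  hent (@sxz X Y Z) (fun t => p t * c (sy t))
  = hent (@sx X Y Z) (fun t => p t * c (sy t))
    - \sum_x (\sum_y pxy x y * c y) * \sum_z xlnx (pzx x z).
Proof.
move=> c0; case: hp => h1 [_ [h2 h3]].
have sT (F : T -> R) : \sum_t F t = \sum_x \sum_y \sum_z F (x, y, z) by rewrite pair_big pair_big; apply: eq_bigr => -[[]].
pose w x := \sum_y pxy x y * c y.
have w0 x : 0 <= w x by apply: sumr_ge0 => y _; rewrite mulr_ge0.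
have E1 x z : marg (@sxz X Y Z) (fun t => p t * c (sy t)) (x, z) = pzx x z * w x.
  rewrite /marg big_mkcond sT (bigD1 x) //= [X in _ + X]big1 ?addr0 => [|x' xx]; last first.
    by apply: big1 => y _; apply: big1 => z' _; rewrite /sxz xpair_eqE /sx /= (negbTE xx).
  rewrite /w mulr_sumr; apply: eq_bigr => y _; rewrite (bigD1 z) //= [X in _ + X]big1 ?addr0 => [|z' zz]; last first.
    by rewrite /sxz xpair_eqE /sz /= (negbTE zz) andbF.
  by rewrite /sxz /= eqxx /psrc /sx /sy /sz /=; ring.
have E2 x : marg (@sx X Y Z) (fun t => p t * c (sy t)) x = w x.
  rewrite /marg big_mkcond sT (bigD1 x) //= [X in _ + X]big1 ?addr0 => [|x' xx]; last first.
    by apply: big1 => y _; apply: big1 => z' _; rewrite /sx /= (negbTE xx).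
  apply: eq_bigr => y _; rewrite /sx /= eqxx /psrc /sx /sy /sz /= -[RHS]mulr1 -(h3 x) mulr_sumr.
  by apply: eq_bigr => z _; ring.
rewrite /hent -opprD; congr (- _); rewrite -(pair_bigA _ (fun x z => xlnx (marg (@sxz X Y Z) _ (x, z)))) /=.
rewrite -big_split; apply: eq_bigr => x _ /=; rewrite E2.
rewrite (eq_bigr (fun z => xlnx (w x) * pzx x z + w x * xlnx (pzx x z))) => [|z _]; last first.
  by rewrite E1 xlnxM // [pzx x z * _]mulrC.
by rewrite big_split /= -!mulr_sumr h3 mulr1.
Qed.

(* Since [Z] depends on [(X, Y)] only through [X], the first letter satisfies
   H(U|X) = H(U|X,Z) <= H(U|Z), so user X can decode it at the rate designed for user Z. *)
Lemma gain0_le : H true 0 <= H false 0.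
Proof.
rewrite /gainH !lent_ukey_x !lent_ukey_z.
have le := lent_cond (@key X Y Z) vQ p0 p1 (f := @sxz X Y Z) (g := @sz X Y Z) (k := snd) 0 (fun=> erefl).
apply: le_trans le.
pose W x := \sum_z xlnx (pzx x z).
have E0 : L (@sxz X Y Z) 0 = L (@sx X Y Z) 0 - \sum_x (\sum_y pxy x y) * W x.
  rewrite /lent /=.
  have pE : p =1 (fun t => p t * (fun=> 1) (sy t)) by move=> t; rewrite mulr1.
  rewrite !(eq_hent _ pE) (hent_sxz (c := fun=> 1)) //; congr (_ - _).
  by apply: eq_bigr => x _; congr (_ * _); apply: eq_bigr => y _; rewrite mulr1.
have E1 : L (@sxz X Y Z) 1 = L (@sx X Y Z) 1 - \sum_x (\sum_y pxy x y) * W x.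
  rewrite /lent /=.
  rewrite (eq_bigr _ (fun a _ => hent_sxz (c := fun y => Q [::] (inl (inl y)) a) (fun y => vQ.1 _ _ _))).
  rewrite sumrB; congr (_ - _); rewrite exchange_big; apply: eq_bigr => x _ /=.
  rewrite -mulr_suml; congr (_ * _); rewrite exchange_big; apply: eq_bigr => y _.
  by rewrite -mulr_sumr vQ.2 mulr1.
by rewrite E0 E1; lra.
Qed.

Lemma srate_needs j u : needs j u -> H u j - HQ j <= srate j.
Proof.
rewrite /needs /srate => /orP[/eqP ->|/eqP -> //]; rewrite lerD2r /=.
by case: u => //; apply: gain0_le.
Qed.

(** [lentQ] is also the conditional entropy given the whole source letter, hence at most that given
    one user's observation. The sign matters for [ln_bins]. *)
Lemma srate_ge0 j : 0 <= srate j.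
Proof.
rewrite /srate subr_ge0 /gainH.
have -> : HQ j = L id j.+1 - L id j.
  by rewrite (lent_refine vQ p0 (f := id) (g := @key X Y Z j)) // addrC addKr.
exact: (lent_cond (@key X Y Z) vQ p0 p1 (f := id) (g := ukey (odd j)) (k := ukey (odd j)) j (fun=> erefl)).
Qed.

Lemma srate_y : srate 0 = L (@syz X Y Z) 0 - L (@sz X Y Z) 0 - (L (@syz X Y Z) 1 - L (@sz X Y Z) 1).
Proof.
rewrite /srate /gainH /= !lent_ukey_z.
by rewrite (lent_refine vQ p0 (f := @syz X Y Z) (g := fun b => inl (inl b.1))) //; ring.
Qed.

Lemma srate_z K : \sum_(k < K) srate k.*2.+1
  = L (@sxz _ _ _) 1 - L (@sx _ _ _) 1 - (L (@sxz _ _ _) K.*2.+1 - L (@sx _ _ _) K.*2.+1).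
Proof.
rewrite -(telescope_z hp vQ); apply: eq_bigr => k _.
rewrite /srate /gainH /= odd_double /= !lent_ukey_x.
rewrite (lent_refine vQ p0 (f := @sxz X Y Z) (g := fun b => inl (inr b.2)) (j := k.*2.+1)); last first.
  by move=> t; rewrite /key odd_double.
ring.
Qed.

Lemma srate_x K : \sum_(k < K) srate k.*2.+2
  = L (@sxz _ _ _) 1 - L (@sz _ _ _) 1 - (L (@sxz _ _ _) K.*2.+1 - L (@sz _ _ _) K.*2.+1).
Proof.
rewrite -(telescope_x hp vQ); apply: eq_bigr => k _.
rewrite /srate /gainH /= negbK odd_double /= !lent_ukey_z.
rewrite (lent_refine vQ p0 (f := @sxz X Y Z) (g := fun b => inr b.1) (j := k.*2.+2)); last first.
  by move=> t; rewrite /key /= odd_double.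
ring.
Qed.

End Rates.

Section BlockCode.
Variables (R : realType) (X Y Z A : finType) (n K : nat) (a0 : n.-tuple A).
Notation T := (n.-tuple (src X Y Z)).
Notation S := (n.-tuple (skey X Y Z)).
Variables (tau : nat -> bool -> R) (r : seq (n.-tuple A) -> bool -> S -> n.-tuple A -> R).
Variables (rho : seq (n.-tuple A) -> S -> n.-tuple A) (be : seq (n.-tuple A) -> n.-tuple A -> nat * nat).

Definition obs_y (yn : n.-tuple Y) : S := map_tuple (fun y => inl (inl y)) yn.
Definition obs_z (zn : n.-tuple Z) : S := map_tuple (fun z => inl (inr z)) zn.
Definition obs_x (xn : n.-tuple X) : S := map_tuple inr xn.

(* Stage [j > 0] is described to the listener by the [(j.-1)./2]-th message it receives. *)
Definition heard (ty : nat) (ms : seq nat) (j : nat) : nat := if j is j'.+1 then nth 0%N ms j'./2 else ty.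

Notation uh := (uhist a0 needs tau r rho be).

Definition bc_y yn : nat := (be [::] (rho [::] (obs_y yn))).1.
Definition bc_z k zn ty txs : nat :=
  let h := uh false (obs_z zn) (heard ty txs) k.*2.+1 in (be h (rho h (obs_z zn))).1.
Definition bc_x k xn ty tzs : nat :=
  let h := uh true (obs_x xn) (heard ty tzs) k.*2.+2 in (be h (rho h (obs_x xn))).1.

Notation kn := (keyn (@key X Y Z) (n := n)).
Notation fu := (fn (@ukey X Y Z) (n := n)).

Lemma obs_yE (t : T) : obs_y (ys t) = kn 0 t.
Proof. by apply: eq_from_tnth => i; rewrite !tnth_map. Qed.

Lemma obs_zE (t : T) : obs_z (zs t) = fu false t.
Proof. by apply: eq_from_tnth => i; rewrite !tnth_map. Qed.

Lemma obs_xE (t : T) : obs_x (xs t) = fu true t.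
Proof. by apply: eq_from_tnth => i; rewrite !tnth_map. Qed.

Lemma kn_fu j u (t : T) : ~~ needs j u -> kn j t = fu u t.
Proof.
rewrite /needs negb_or; case: j => //= j uj; apply: eq_from_tnth => i; rewrite !tnth_map.
by congr (ukey _ _); case: u (odd j) uj => [] [].
Qed.

Variables (t : T) (h : seq (n.-tuple A)).
Hypotheses (sh : size h = K.*2.+1)
  (good : forall i, (i < K.*2.+1)%N -> nth a0 h i = rho (take i h) (kn i t) /\
    ~~ nerr fu (r (take i h)) (needs i) (tau i) (be (take i h)) t (nth a0 h i)).

Let c j : nat := (be (take j h) (nth a0 h j)).1.

Lemma bc_y_good : bc_y (ys t) = c 0.
Proof. by rewrite /bc_y obs_yE /c take0; have [-> _] := good (ltn0Sn _); rewrite take0. Qed.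

(** With T_y and k messages from user X, user Z knows stages 0 to 2k and its own stage 2k+1. *)
Lemma uh_z_good k L : (k <= K)%N -> (L <= k.*2.+2)%N -> (L <= K.*2.+1)%N ->
  uh false (fu false t) (heard (c 0) (mkseq (fun i => c i.*2.+2) k)) L = take L h.
Proof.
move=> kK Lk LK; apply: (uhist_correct sh good LK) => [j _|j jL]; first exact: kn_fu.
rewrite /needs; case: j jL => [//|j] jL /= nj; rewrite nth_mkseq; last by lia.
have oj : odd j by move: nj; rewrite /=; case: (odd j).
by congr c; lia.
Qed.

Lemma uh_x_good k L : (k <= K)%N -> (L <= k.*2.+1)%N ->
  uh true (fu true t) (heard (c 0) (mkseq (fun i => c i.*2.+1) k)) L = take L h.
Proof.
move=> kK Lk; have LK : (L <= K.*2.+1)%N by lia.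
apply: (uhist_correct sh good LK) => [j _|j jL]; first exact: kn_fu.
rewrite /needs; case: j jL => [//|j] jL /= nj; rewrite nth_mkseq; last by lia.
have oj : ~~ odd j by move: nj; rewrite /=; case: (odd j).
by congr c; lia.
Qed.

Lemma msgs_good k : (k <= K)%N -> msgs bc_z bc_x (xs t) (zs t) (bc_y (ys t)) k
  = (mkseq (fun i => c i.*2.+2) k, mkseq (fun i => c i.*2.+1) k).
Proof.
rewrite bc_y_good; elim: k => [//|k IH] kK /=; rewrite IH ?(ltnW kK) //.
have Ez : bc_z k (zs t) (c 0) (mkseq (fun i => c i.*2.+2) k) = c k.*2.+1.
  rewrite /bc_z obs_zE uh_z_good //; [|by rewrite ltnW|by lia].
  have kK' : (k.*2.+1 < K.*2.+1)%N by lia.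
  rewrite /c; have [-> _] := good kK'; congr (be _ (rho _ _)).1.
  by symmetry; apply: kn_fu; rewrite /needs /= odd_double.
have Ex : bc_x k (xs t) (c 0) (mkseq (fun i => c i.*2.+1) k.+1) = c k.*2.+2.
  rewrite /bc_x obs_xE uh_x_good //.
  have kK' : (k.*2.+2 < K.*2.+1)%N by lia.
  rewrite /c; have [-> _] := good kK'; congr (be _ (rho _ _)).1.
  by symmetry; apply: kn_fu; rewrite /needs /= odd_double.
by rewrite Ez -mkseqS Ex -mkseqS.
Qed.

End BlockCode.

Section Achievability.
Variables (R : realType) (X Y Z Xh Zh : finType).
Variables (pxy : X -> Y -> R) (pzx : X -> Z -> R).
Variables (dx : X -> Xh -> R) (dz : Z -> Zh -> R) (K : nat).
Hypotheses (hp : is_source pxy pzx).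
Hypotheses (hdx : forall x xh, 0 <= dx x xh) (hdz : forall z zh, 0 <= dz z zh).
Notation T := (src X Y Z).
Notation p := (psrc pxy pzx).

Let p0 := psrc_ge0 hp.
Let p1 := psrc1 hp.

Lemma ler_double_sum (I J : finType) (d : I -> J -> R) i j : (forall i j, 0 <= d i j) ->
  d i j <= \sum_i \sum_j d i j.
Proof.
move=> d0; rewrite (bigD1 i) //= (bigD1 j) //= -addrA lerDl addr_ge0 ?sumr_ge0 // => k _.
exact: sumr_ge0.
Qed.

Lemma mean_dist_le n (D dl q dm : R) (bad : n.-tuple T -> bool) (cost : n.-tuple T -> R) :
  (0 < n)%N -> 0 <= D + dl -> 0 <= dm ->
  (forall t, cost t <= n%:R * dm) -> (forall t, ~~ bad t -> cost t <= n%:R * (D + dl)) ->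
  \sum_t prodm p t * (bad t)%:R <= q ->
  \sum_t prodm p t * (n%:R^-1 * cost t) <= D + dl + dm * q.
Proof.
move=> n0 D0 dm0 cm cg hq; have nr : 0 < n%:R :> R by rewrite ltr0n.
apply: le_trans (_ : \sum_t prodm p t * (D + dl + dm * (bad t)%:R) <= _).
  apply: ler_sum => t _; apply: ler_wpM2l; first exact: prodm_ge0.
  rewrite mulrC ler_pdivrMr // [leRHS]mulrC; case: (boolP (bad t)) => [_|/cg].
    by apply: le_trans (cm t) _; rewrite mulr1 ler_pM2l // lerDr.
  by rewrite mulr0 addr0.
rewrite (eq_bigr (fun t => (D + dl) * prodm p t + dm * (prodm p t * (bad t)%:R))) => [|t _]; last by ring.
by rewrite big_split /= -!mulr_sumr sum_prodm // mulr1 lerD2l ler_wpM2l.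
Qed.

(** For x >= 1 the number of bins is at most x + 1 <= 2x, below x times the base of [ln]; the
    rounding costs 1/n in rate. *)
Lemma ln_bins (n : nat) (e : R) : 0 <= e -> ln (Num.truncn (expR (n%:R * e))).+1%:R <= n%:R * e + 1.
Proof.
move=> e0; rewrite -ler_expR lnK ?posrE ?ltr0n // expRD -natr1.
have h1 : (Num.truncn (expR (n%:R * e)))%:R <= expR (n%:R * e) by rewrite truncn_le expR_ge0.
have h2 : 1 <= expR (n%:R * e) by rewrite -[leLHS]expR0 ler_expR mulr_ge0.
have h3 : 2 <= expR 1 :> R by apply: le_trans (expR_ge1Dx 1); lra.
nra.
Qed.

Lemma ler_rates n (I : nat) (s : 'I_I -> R) (e : R) : (0 < n)%N -> (forall i, 0 <= s i) -> 0 <= e ->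
  n%:R^-1 * \sum_(i < I) ln (Num.truncn (expR (n%:R * (s i + e)))).+1%:R
  <= \sum_(i < I) s i + I%:R * (e + n%:R^-1).
Proof.
move=> n0 s0 e0; have nr : 0 < n%:R :> R by rewrite ltr0n.
have -> : I%:R * (e + n%:R^-1) = \sum_(i < I) (e + n%:R^-1) by rewrite sumr_const card_ord mulr_natl.
rewrite -big_split mulr_sumr; apply: ler_sum => i _ /=.
rewrite mulrC ler_pdivrMr //; apply: le_trans (ln_bins _ _) _; first by rewrite addr_ge0.
by rewrite le_eqVlt; apply/orP; left; apply/eqP; field; rewrite lt0r_neq0.
Qed.

Lemma NF_achievable (Dx Dz Rx Ry Rz : R) :
  NF pxy pzx dx dz K Dx Dz Rx Ry Rz -> achievable pxy pzx dx dz K Dx Dz Rx Ry Rz.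
Proof.
case=> x0 [z0 [A [Q [vQ [hRy hRz hRx hDx hDz]]]]] eps eps0.
have [t0 _] : exists t : T, true.
  case: (pickP (fun _ : T => true)) => [t _|no]; first by exists t.
  by exfalso; move: p1; rewrite big_pred0 // => /eqP; rewrite eq_sym oner_eq0.
have [a0 _] : exists a : A, true.
  case: (pickP (fun _ : A => true)) => [a _|no]; first by exists a.
  by exfalso; move: (vQ.2 [::] (key 0 t0)); rewrite big_pred0 // => /eqP; rewrite eq_sym oner_eq0.
pose bx := best Q p x0 (@sz X Y Z) (fun t => dx (sx t)).
pose bz := best Q p z0 (@sx X Y Z) (fun t => dz (sz t)).
pose gx h (t : T) := dx (sx t) (bx h (sz t)); pose gz h (t : T) := dz (sz t) (bz h (sx t)).
have [k1 k1E] : exists k1 : R, k1 = K.+1%:R by exists K.+1%:R.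
have k11 : 1 <= k1 by rewrite k1E ler1n.
have k10 : 0 < k1 by apply: lt_le_trans k11.
(* A terminal sends at most K+1 messages, each with excess rate 4 dl + 1/n; the factor 8 makes the
   dl parts at most eps/2 in total. *)
pose dl := eps / (8 * k1); have dl0 : 0 < dl by rewrite divr_gt0 // mulr_gt0.
pose rate := srate pxy pzx Q.
have m0 h t : 0 <= mu (@key X Y Z) 0 Q p h t by apply: mu_ge0.
pose N := K.*2.+1.
have ex : lsum N (fun h => \sum_t mu (@key X Y Z) 0 Q p h t * gx h t) <= Dx.
  by apply: le_trans hDx; apply: ler_lsum => h _; rewrite /psi_x psi_best.
have ez : lsum N (fun h => \sum_t mu (@key X Y Z) 0 Q p h t * gz h t) <= Dz.
  by apply: le_trans hDz; apply: ler_lsum => h _; rewrite /psi_z psi_best.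
have ex0 : 0 <= Dx.
  by apply: le_trans ex; apply: lsum_ge0 => h _; apply: sumr_ge0 => t _; apply: mulr_ge0; [apply: m0 | apply: hdx].
have ez0 : 0 <= Dz.
  by apply: le_trans ez; apply: lsum_ge0 => h _; apply: sumr_ge0 => t _; apply: mulr_ge0; [apply: m0 | apply: hdz].
have [C hC] := good_code a0 vQ p0 p1 N gx gz dl0 (srate_needs hp vQ).
pose dmx := \sum_x \sum_xh dx x xh; pose dmz := \sum_z \sum_zh dz z zh.
have dmx0 : 0 <= dmx by apply: sumr_ge0 => x _; apply: sumr_ge0.
have dmz0 : 0 <= dmz by apply: sumr_ge0 => x _; apply: sumr_ge0.
(* B/n <= eps/2 covers both the rounding of all bin counts and the distortion on bad blocks, whose
   probability is at most C/n. *)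
pose B := k1 + (dmx + dmz) * `|C|.
have B0 : 0 <= B by rewrite addr_ge0 ?mulr_ge0 ?addr_ge0 // ltW.
exists (Num.truncn (2 * B / eps)).+1 => n nN.
have n0 : (0 < n)%N by apply: leq_trans nN.
have nr : 0 < n%:R :> R by rewrite ltr0n.
have nB : B / n%:R <= eps / 2.
  have : 2 * B / eps <= n%:R by apply: le_trans (ltW (truncnS_gt _)) _; rewrite ler_nat.
  rewrite !ler_pdivrMr // => h; lra.
have k1n : k1 / n%:R <= eps / 2.
  by apply: le_trans nB; rewrite ler_pM2r ?invr_gt0 // lerDl mulr_ge0 // addr_ge0.
have Cn (d : R) : 0 <= d -> d <= dmx + dmz -> dl + d * (C / n%:R) <= eps.
  move=> d0 dd; have dle : dl <= eps / 2.
    rewrite /dl ler_pM2l // lef_pV2 ?posrE ?mulr_gt0 //.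
    by lra.
  have : d * (C / n%:R) <= B / n%:R.
    rewrite mulrA ler_pM2r ?invr_gt0 //; apply: le_trans (ler_wpM2l d0 (ler_norm C)) _.
    by apply: le_trans (ler_wpM2r (normr_ge0 C) dd) _; rewrite lerDr ltW.
  lra.
have ratek (I : nat) : (I <= K.+1)%N -> I%:R * (4 * dl + n%:R^-1) <= eps.
  move=> IK; apply: le_trans (_ : k1 * (4 * dl + n%:R^-1) <= _).
    have q0 : 0 < 4 * dl + n%:R^-1 by apply: addr_gt0; rewrite ?invr_gt0 // mulr_gt0.
    by rewrite ler_pM2r // k1E ler_nat.
  have -> : k1 * (4 * dl + n%:R^-1) = eps / 2 + k1 / n%:R by rewrite /dl; field; rewrite ?lt0r_neq0.
  lra.
have [rho [be [beM hbad]]] := hC n n0.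
pose an := [tuple a0 | _ < n].
pose tau := ctau (@key X Y Z) (@ukey X Y Z) Q p dl n.
pose rn := @ulikn R T (skey X Y Z) A (@key X Y Z) (@ukey X Y Z) Q p n.
pose ge := uhist an needs tau rn rho be.
pose Dgx xn ty tzs : n.-tuple Zh :=
  [tuple bz (coordh i (ge true (obs_x Y Z xn) (heard ty tzs) N)) (tnth xn i) | i < n].
pose Dgz zn ty txs : n.-tuple Xh :=
  [tuple bx (coordh i (ge false (obs_z X Y zn) (heard ty txs) N)) (tnth zn i) | i < n].
pose M j := (cM rate dl n j).+1.
exists (M 0%N), (fun k => M k.*2.+2), (fun k => M k.*2.+1), (bc_y rho be),
  (bc_z an tau rn rho be), (bc_x an tau rn rho be), Dgx, Dgz.
split.
- by move=> yn; apply: beM.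
- by move=> k zn ty s _; have := beM (ge false (obs_z X Y zn) (heard ty s) k.*2.+1) (rho (ge false (obs_z X Y zn) (heard ty s) k.*2.+1) (obs_z X Y zn)); rewrite size_uhist.
- by move=> k xn ty s _; have := beM (ge true (obs_x Y Z xn) (heard ty s) k.*2.+2) (rho (ge true (obs_x Y Z xn) (heard ty s) k.*2.+2) (obs_x Y Z xn)); rewrite size_uhist.
- have dl40 : 0 <= 4 * dl by rewrite mulr_ge0 // ltW.
  have s0 j : 0 <= rate j by apply: srate_ge0.
  split.
  + have := ler_rates (s := fun _ : 'I_1 => rate 0%N) n0 (fun=> s0 _) dl40.
    rewrite !big_ord1 => h1; apply: le_trans h1 _; apply: lerD; last exact: ratek.
    by rewrite /rate srate_y.
  + apply: le_trans (ler_rates (s := fun k : 'I_K => rate k.*2.+2) n0 (fun=> s0 _) dl40) _.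
    by apply: lerD; [rewrite /rate srate_x | apply: ratek].
  + apply: le_trans (ler_rates (s := fun k : 'I_K => rate k.*2.+1) n0 (fun=> s0 _) dl40) _.
    by apply: lerD; [rewrite /rate srate_z | apply: ratek].
set bad := tbad _ _ _ _ _ _ _ _ _ _ in hbad.
have goodP t : ~~ bad t -> exists h, [/\ size h = N, ~~ cleaf (@key X Y Z) Q p N dl gx gz h t &
    forall i, (i < N)%N -> nth an h i = rho (take i h) (keyn (@key X Y Z) i t) /\
    ~~ nerr (fn (@ukey X Y Z) (n := n)) (rn (take i h)) (needs i) (tau i) (be (take i h)) t (nth an h i)].
  by move/(tbadP an).
split.
- rewrite /exp_dist_x (sum_blocks (fun xn yn zn => ptuple pxy pzx xn yn zn * (n%:R^-1 * \sum_(i < n)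
     dx (tnth xn i) (tnth (Dgz zn (bc_y rho be yn)
       (msgs (bc_z an tau rn rho be) (bc_x an tau rn rho be) xn zn (bc_y rho be yn) K).1) i)))).
  rewrite (eq_bigr _ (fun w _ => congr1 (fun v => v * _) (ptuple_prodm pxy pzx w))).
  apply: le_trans (mean_dist_le (bad := bad) (D := Dx) (dl := dl) (dm := dmx) n0 _ dmx0 _ _ hbad) _.
  + by rewrite addr_ge0 // ltW.
  + move=> t; rewrite -[n in leRHS]card_ord mulr_natl -sumr_const; apply: ler_sum => i _.
    exact: ler_double_sum.
  + move=> t /goodP [h [sh lf gd]].
    rewrite (msgs_good sh gd (leqnn K)) (bc_y_good gd) /=.
    apply: le_trans (_ : \sum_i gx (coordh i h) (tnth t i) <= _).
      apply: ler_sum => i _; rewrite tnth_mktuple !tnth_map /ge obs_zE.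
      by rewrite (uh_z_good sh gd (leqnn K)) // -sh take_size.
    by move: lf; rewrite /cleaf negb_or !negbK => /andP[h1 _]; apply: le_trans h1 _; rewrite ler_pM2l // lerD2r.
  by rewrite -addrA lerD2l; apply: Cn => //; rewrite lerDl.
- rewrite /exp_dist_z (sum_blocks (fun xn yn zn => ptuple pxy pzx xn yn zn * (n%:R^-1 * \sum_(i < n)
     dz (tnth zn i) (tnth (Dgx xn (bc_y rho be yn)
       (msgs (bc_z an tau rn rho be) (bc_x an tau rn rho be) xn zn (bc_y rho be yn) K).2) i)))).
  rewrite (eq_bigr _ (fun w _ => congr1 (fun v => v * _) (ptuple_prodm pxy pzx w))).
  apply: le_trans (mean_dist_le (bad := bad) (D := Dz) (dl := dl) (dm := dmz) n0 _ dmz0 _ _ hbad) _.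
  + by rewrite addr_ge0 // ltW.
  + move=> t; rewrite -[n in leRHS]card_ord mulr_natl -sumr_const; apply: ler_sum => i _.
    exact: ler_double_sum.
  + move=> t /goodP [h [sh lf gd]].
    rewrite (msgs_good sh gd (leqnn K)) (bc_y_good gd) /=.
    apply: le_trans (_ : \sum_i gz (coordh i h) (tnth t i) <= _).
      apply: ler_sum => i _; rewrite tnth_mktuple !tnth_map /ge obs_xE.
      by rewrite (uh_x_good sh gd (leqnn K)) // -sh take_size.
    by move: lf; rewrite /cleaf negb_or !negbK => /andP[_ h1]; apply: le_trans h1 _; rewrite ler_pM2l // lerD2r.
  by rewrite -addrA lerD2l; apply: Cn => //; rewrite lerDr.
Qed.

End Achievability.

Lemma NF_mono (R : realType) (X Y Z Xh Zh : finType) (pxy : X -> Y -> R) (pzx : X -> Z -> R)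
    (dx : X -> Xh -> R) (dz : Z -> Zh -> R) K Dx Dz Rx Ry Rz Dx' Dz' Rx' Ry' Rz' :
  Dx <= Dx' -> Dz <= Dz' -> Rx <= Rx' -> Ry <= Ry' -> Rz <= Rz' ->
  NF pxy pzx dx dz K Dx Dz Rx Ry Rz -> NF pxy pzx dx dz K Dx' Dz' Rx' Ry' Rz'.
Proof.
move=> h1 h2 h3 h4 h5 [x0 [z0 [A [Q [vQ [r1 r2 r3 r4 r5]]]]]].
exists x0, z0, A, Q; split=> //; split.
- exact: le_trans r1 h4.
- exact: le_trans r2 h5.
- exact: le_trans r3 h3.
- exact: le_trans r4 h1.
- exact: le_trans r5 h2.
Qed.

Theorem theorem4 (R : realType) (X Y Z Xh Zh : finType)
  (pxy : X -> Y -> R) (pzx : X -> Z -> R)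
  (dx : X -> Xh -> R) (dz : Z -> Zh -> R) (K : nat)
  (hK : (1 <= K)%N)
  (hp : is_source pxy pzx)
  (hdx : forall x xh, 0 <= dx x xh) (hdz : forall z zh, 0 <= dz z zh)
  (Dx Dz : R) :
  forall Rx Ry Rz : R,
    in_RO pxy pzx dx dz K Dx Dz Rx Ry Rz <-> in_RK pxy pzx dx dz K Dx Dz Rx Ry Rz.
Proof.
move=> Rx Ry Rz; split=> [ro|/(in_RK_NF hp)/(NF_achievable hp hdx hdz) ach delta delta0]; last first.
  by exists Rx, Ry, Rz; rewrite !subrr normr0.
apply: (NF_in_RK hK hp); apply: (NF_closed hp) => eps eps0.
(* Half of [eps] goes to approximating the point of the closure, half to the slack of
   achievability. *)
have e2 : 0 < eps / 2 by rewrite divr_gt0.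
have [Rx' [Ry' [Rz' [ach]]]] := ro _ e2.
rewrite !ltr_norml => /andP[_ hx] /andP[_ hy] /andP[_ hz].
have [N hN] := ach _ e2.
(* One code for each [eps] is enough; the length [N.+1] is chosen to be positive. *)
have nf := code_NF hK hp (ltn0Sn N) (hN N.+1 (leqnSn N)).
by apply: NF_mono nf; lra.
Qed.
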